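(* Let $r\ge 3$ be an odd integer, let $(p_k,q_k)$, $k=1,\dots,n$, be pairs of coprime nonzero integers, and put $P=\prod_kp_k$, $H=P\sum_k\frac{q_k}{p_k}$ (the case $H=0$ is allowed). If $r$ is coprime to at least $n-2$ of the integers $p_1,\dots,p_n$, then $$\tau'_r\big(X(p_1/q_1,p_2/q_2,\dots,p_n/q_n)\big)\Big(\sqrt{\tfrac1r}\,\sin\tfrac{\pi}{r}\Big)^{\operatorname{sign}|H|-1}$$ is an algebraic integer in the $r$-th cyclotomic field $\mathbb Q(e^{2\pi i/r})$.
   Context: $\operatorname{sign}$ is the sign function with $\operatorname{sign}0=0$. **Seifert manifolds.** For pairs of coprime nonzero integers $(p_k,q_k)$, $X(p_1/q_1,\dots,p_n/q_n)$ is the closed oriented 3-manifold obtained by surgery on $S^3$ along the link consisting of a central unknot with surgery coefficient $0$ and $n$ parallel (unlinked) meridians of it with rational surgery coefficients $p_1/q_1,\dots,p_n/q_n$. Equivalently, it is the plumbed manifold of the star-shaped tree with central vertex of framing $0$ and, for each $k$, an arm with framings $m_{k,l_k},\dots,m_{k,1}$ (starting next to the centre), where $p_k/q_k=m_{k,l_k}-1/(m_{k,l_k-1}-1/(\cdots-1/m_{k,1}))$. It is a rational homology sphere iff $H\ne0$. **The invariant $\tau'_r$** (Kirby–Melvin's $SO(3)$ invariant, $r\ge3$ odd). Let $s=e^{\pi i/r}$, $t=e^{\pi i/(2r)}$, $[k]=\frac{s^k-s^{-k}}{s-s^{-1}}$. Let $M$ be obtained by surgery on an (integrally) framed link $L\subset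 S^3$ with $N$ components, whose linking matrix has $b_+$ positive and $b_-$ negative eigenvalues; then $\nu=N-b_+-b_-$ is the first Betti number of $M$. Let $J_{L,\mathbf k}$ be the framed colored Jones invariant of $L$ with component $i$ colored by the $k_i$-dimensional irreducible representation of quantum $sl_2$ at $q=e^{2\pi i/r}$, normalized so that the unknot with framing $a$ has value $t^{a(k^2-1)}[k]$ (and the Hopf link with framings $0$, colors $k,l$, has value $[kl]$). Put $$F(L)=\sum_{\mathbf k}\Big(\prod_i[k_i]\Big)J_{L,\mathbf k},$$ the sum over all $\mathbf k=(k_1,\dots,k_N)$ with each $k_i$ odd and $0<k_i<r$, and $G_\pm=F(\text{unknot with framing }\pm1)$. Then $$\tau'_r(M)=\Big(\sqrt{\tfrac4r}\,\sin\tfrac{\pi}{r}\Big)^{\nu}\,\frac{F(L)}{G_+^{b_+}G_-^{b_-}}.$$ *)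

(* Defs.v *)
From mathcomp Require Import all_boot all_order all_algebra.
From mathcomp Require Import complex.
From mathcomp Require Import all_classical all_reals all_analysis.

Set Implicit Arguments.
Unset Strict Implicit.
Unset Printing Implicit Defensive.

Import Order.TTheory GRing.Theory Num.Theory.
Local Open Scope ring_scope.
Local Open Scope complex_scope.

(** * Quantum sl2

The quantum group is that of Kassel's book, with parameter s = t^2:
[K E = s^2 E K], [K F = s^-2 F K], [E F - F E = (K - K^-1) / (s - s^-1)],
[Delta E = 1 (x) E + E (x) K], [Delta F = K^-1 (x) F + F (x) 1].  Its
k-dimensional irreducible representation V_k has the basis e_0, ..., e_{k-1}:
[K e_j = s^(k-1-2j) e_j], [E e_j = [k-j] e_{j-1}], [F e_j = [j+1] e_{j+1}].
Everything below is used at t = exp (i pi / 2r) with k < r. *)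

Definition qint (F : fieldType) (s : F) (k : nat) : F :=
  (s ^+ k - s ^- k) / (s - s^-1).

Definition qfact (F : fieldType) (s : F) (n : nat) : F :=
  \prod_(1 <= i < n.+1) qint s i.

(* K acts on e_j in V_k by s ^ (weight k j). *)
Definition weight (k j : nat) : int := k%:Z - 1 - 2 * j%:Z.

(* The coefficient of e_{a-n} (x) e_{b+n} in (E^n (x) F^n) (e_a (x) e_b), on
   V_k (x) V_l, for n <= a < k and b + n < l; it does not depend on l. *)
Definition EnFn (F : fieldType) (s : F) (k n a b : nat) : F :=
  \prod_(i < n) (qint s (k - a + i) * qint s (b + i.+1)).

(* The coefficient of e_c (x) e_d in R (e_a (x) e_b), on V_k (x) V_l, where
     R = s^(H (x) H / 2)
         sum_n s^(n(n-1)/2) (s - s^-1)^n / [n]! E^n (x) F^n;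
   only n = a - c = d - b contributes. *)
Definition Rmat (F : fieldType) (t : F) (k l a b c d : nat) : F :=
  let s := t ^+ 2 in let n := (a - c)%N in
  if (c <= a)%N && (d == b + n)%N then
    t ^ (weight k c * weight l d) * s ^+ 'C(n, 2) * (s - s^-1) ^+ n / qfact s n
      * EnFn s k n a b
  else 0.

(* The same for
     R^-1 = (sum_n (-1)^n s^(-n(n-1)/2) (s - s^-1)^n / [n]! E^n (x) F^n)
            s^(- H (x) H / 2). *)
Definition Rinv (F : fieldType) (t : F) (k l a b c d : nat) : F :=
  let s := t ^+ 2 in let n := (a - c)%N in
  if (c <= a)%N && (d == b + n)%N then
    (-1) ^+ n * s ^- 'C(n, 2) * (s - s^-1) ^+ n / qfact s n
      * EnFn s k n a b * t ^ (- (weight k a * weight l b))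
  else 0.

(* The coefficient of e_d (x) e_c (in V_l (x) V_k) in the image of e_a (x) e_b
   (in V_k (x) V_l) under the braiding P R if [pos], and under the inverse
   R^-1 P of the braiding V_l (x) V_k -> V_k (x) V_l otherwise. *)
Definition braiding (F : fieldType) (t : F) (pos : bool) (k l a b d c : nat) :
    F :=
  if pos then Rmat t k l a b c d else Rinv t l k b a d c.

(** * Framed links

A link diagram is cut into horizontal slices, each containing one elementary
event.  The cross-section between two slices is the list, from left to right,
of its strands: the component of the strand, and whether it is oriented in the
direction in which the slices are listed ("forward") or against it.  Every link
has a diagram whose crossings join forward strands only. *)

Definition strand : Type := (nat * bool)%type.

Inductive event : Type :=
  (* an extremum creating strands i and i.+1, both of component c; the first
     one is forward iff [fwd] *)
| Birth (i c : nat) (fwd : bool)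
  (* an extremum joining strands i and i.+1 *)
| Death (i : nat)
  (* a positive (if [pos]) or negative crossing of the forward strands i and
     i.+1 *)
| Cross (i : nat) (pos : bool).

Definition strand0 : strand := (0%N, true).

(* [u] replaces the [n] entries of [w] from position [i] on. *)
Definition splice (T : Type) (i n : nat) (u w : seq T) : seq T :=
  take i w ++ u ++ drop (i + n) w.

Definition section_after (sec : seq strand) (e : event) : seq strand :=
  match e with
  | Birth i c fwd => splice i 0 [:: (c, fwd); (c, ~~ fwd)] sec
  | Death i => splice i 2 [::] sec
  | Cross i _ => splice i 2 [:: nth strand0 sec i.+1; nth strand0 sec i] sec
  end.

Definition event_ok (sec : seq strand) (e : event) : bool :=
  match e with
  | Birth i _ _ => (i <= size sec)%N
  | Death i => (i.+1 < size sec)%N &&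
      (nth strand0 sec i.+1 ==
         ((nth strand0 sec i).1, ~~ (nth strand0 sec i).2))
  | Cross i _ =>
      [&& (i.+1 < size sec)%N, (nth strand0 sec i).2 &
          (nth strand0 sec i.+1).2]
  end.

(* [D] is a diagram leading from the cross-section [sec] to [sec']. *)
Fixpoint diagram_between (sec : seq strand) (D : seq event)
    (sec' : seq strand) : bool :=
  match D with
  | [::] => sec == sec'
  | e :: D' => event_ok sec e && diagram_between (section_after sec e) D' sec'
  end.

(* The components are numbered from 0, the strands labelled i being those of
   component i (so together they should form a single circle).  Component i has
   the framing [framings`_i], which need not be the blackboard framing of
   [diagram]. *)
Record framed_link : Type := FramedLink {
  diagram : seq event;
  framings : seq int;
  diagramP : diagram_between [::] diagram [::]
}.

Definition ncomp (L : framed_link) : nat := size (framings L).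

(* The signs of the crossings, with the components of the two strands. *)
Fixpoint crossings (sec : seq strand) (D : seq event) :
    seq (int * (nat * nat)) :=
  match D with
  | [::] => [::]
  | e :: D' =>
      let rest := crossings (section_after sec e) D' in
      match e with
      | Cross i pos => (if pos then 1 else -1,
          ((nth strand0 sec i).1, (nth strand0 sec i.+1).1)) :: rest
      | _ => rest
      end
  end.

Definition self_writhe (L : framed_link) (i : nat) : int :=
  \sum_(x <- crossings [::] (diagram L) | x.2 == (i, i)) x.1.

Definition linking_number (L : framed_link) (i j : nat) : int :=
  ((\sum_(x <- crossings [::] (diagram L) |
          (x.2 == (i, j)) || (x.2 == (j, i))) x.1) %/ 2)%Z.

Definition linking_matrix (L : framed_link) : 'M[int]_(ncomp L) :=
  \matrix_(i, j)
    if i == j then (framings L)`_i else linking_number L i j.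

(** * The colored Jones invariant

A forward strand of color k carries V_k and a backward one its dual; the
invariant is the composite of the morphisms attached to the events.  A vector
in the tensor product attached to a cross-section is given by its coordinates
in the basis of words in the e_j and the dual basis vectors e_j^*.  The pivotal
element is K, so that
  Birth: 1 |-> sum_j e_j (x) e_j^*, resp. sum_j e_j^* (x) K^-1 e_j;
  Death: e_a (x) e_b^* |-> e_b^* (K e_a), resp. e_b^* (x) e_a |-> e_b^* (e_a).
*)

Definition apply_event (F : fieldType) (t : F) (col : seq nat)
    (sec : seq strand) (e : event) (v : seq nat -> F) : seq nat -> F :=
  let s := t ^+ 2 in
  let color i := nth 0%N col (nth strand0 sec i).1 in
  match e with
  | Birth i c fwd => fun w =>
      let a := nth 0%N w i in
      if nth 0%N w i.+1 == a then
        (if fwd then 1 else s ^ (- weight (nth 0%N col c) a))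
          * v (splice i 2 [::] w)
      else 0
  | Death i => fun w =>
      \sum_(a < color i)
        (if (nth strand0 sec i).2 then s ^ weight (color i) a else 1)
          * v (splice i 0 [:: val a; val a] w)
  | Cross i pos => fun w =>
      \sum_(a < color i) \sum_(b < color i.+1)
        braiding t pos (color i) (color i.+1) a b (nth 0%N w i) (nth 0%N w i.+1)
          * v (splice i 2 [:: val a; val b] w)
  end.

Fixpoint apply_diagram (F : fieldType) (t : F) (col : seq nat)
    (sec : seq strand) (D : seq event) (v : seq nat -> F) : seq nat -> F :=
  match D with
  | [::] => v
  | e :: D' => apply_diagram t col (section_after sec e) D'
                 (apply_event t col sec e v)
  end.

(* J_{L,k}, with component i colored by the k_i-dimensional representation:
   changing the framing of component i by one multiplies the invariant by
   t^(k_i^2 - 1), and the diagram itself gives the invariant for the blackboard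
   framing, which is the self-writhe. *)
Definition colored_jones (F : fieldType) (t : F) (L : framed_link)
    (k : seq nat) : F :=
  (\prod_(i < ncomp L)
     t ^ (((framings L)`_i - self_writhe L i) * ((nth 0%N k i)%:Z ^+ 2 - 1)))
  * apply_diagram t k [::] (diagram L) (fun=> 1) [::].

(** * Kirby and Melvin's SO(3) invariant *)

Definition expi (R : realType) (x : R) : R[i] := cos x +i* sin x.

(* t = exp (i pi / 2r); then s = t^2 and exp (2 i pi / r) = t^4. *)
Definition root_t (R : realType) (r : nat) : R[i] := expi (pi / (2 * r)%:R).

(* F(L): the sum over odd colors 0 < k_i < r. *)
Definition kirby_sum (R : realType) (r : nat) (L : framed_link) : R[i] :=
  \sum_(k : (ncomp L).-tuple 'I_r | all (fun c : 'I_r => odd c) k)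
    (\prod_(i < ncomp L) qint (root_t R r ^+ 2) (tnth k i))
      * colored_jones (root_t R r) L [seq val c | c <- k].

Definition unknot (a : int) : framed_link :=
  @FramedLink [:: Birth 0 0 true; Death 0] [:: a] isT.

Definition gauss_pos (R : realType) (r : nat) : R[i] := kirby_sum R r (unknot 1).
Definition gauss_neg (R : realType) (r : nat) : R[i] :=
  kirby_sum R r (unknot (-1)).

(* The complex eigenvalues of an integral matrix, with multiplicities. *)
Definition eigenvalues (R : realType) (n : nat) (A : 'M[int]_n) : seq R[i] :=
  sval (closed_field_poly_normal (char_poly (map_mx intr A : 'M[R[i]]_n))).

(* In R[i], 0 < z means that z is real and positive. *)
Definition b_pos (R : realType) (L : framed_link) : nat :=
  count (fun z => 0 < z) (eigenvalues R (linking_matrix L)).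
Definition b_neg (R : realType) (L : framed_link) : nat :=
  count (fun z => z < 0) (eigenvalues R (linking_matrix L)).

(* The invariant of the manifold obtained by surgery on L. *)
Definition tau' (R : realType) (r : nat) (L : framed_link) : R[i] :=
  let nu := (ncomp L - b_pos R L - b_neg R L)%N in
  (Num.sqrt (4 / r%:R) * sin (pi / r%:R))%:C ^+ nu * kirby_sum R r L
    / (gauss_pos R r ^+ b_pos R L * gauss_neg R r ^+ b_neg R L).

(** * Seifert manifolds *)

(* m - 1 / x in the rational projective line, [None] being the infinite
   point. *)
Definition cf_step (m : int) (x : option rat) : option rat :=
  match x with
  | None => Some m%:~R
  | Some y => if y == 0 then None else Some (m%:~R - y^-1)
  end.

(* m_l - 1 / (m_{l-1} - 1 / (... - 1 / m_1)) for [:: m_l; ...; m_1] *)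
Definition cont_frac (ms : seq int) : option rat := foldr cf_step None ms.

(* A chain of unknots numbered from c on, one for each element of ms, the first
   one clasping the forward strand i and each of the others its predecessor. *)
Fixpoint arm_diagram (i c : nat) (ms : seq int) : seq event :=
  match ms with
  | [::] => [::]
  | _ :: ms' =>
      Birth i.+1 c true :: arm_diagram i.+1 c.+1 ms' ++
        [:: Cross i true; Cross i true; Death i.+1]
  end.

Fixpoint arms_diagram (c : nat) (arms : seq (seq int)) : seq event :=
  match arms with
  | [::] => [::]
  | ms :: arms' => arm_diagram 0 c ms ++ arms_diagram (c + size ms) arms'
  end.

Definition star_diagram (arms : seq (seq int)) : seq event :=
  Birth 0 0 true :: arms_diagram 1 arms ++ [:: Death 0].

Lemma diagram_between_cat sec D1 sec1 D2 sec2 :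
  diagram_between sec D1 sec1 -> diagram_between sec1 D2 sec2 ->
  diagram_between sec (D1 ++ D2) sec2.
Proof.
elim: D1 sec => [|e D1 IH] sec /=; first by move/eqP->.
by move=> /andP[-> /IH]; apply.
Qed.

Lemma diagram_between_cons sec e D sec' :
  event_ok sec e -> diagram_between (section_after sec e) D sec' ->
  diagram_between sec (e :: D) sec'.
Proof. by move=> /= -> ->. Qed.

Lemma splice_cat (T : Type) (i : nat) (pre u u' suf : seq T) :
  size pre = i -> splice i (size u) u' (pre ++ u ++ suf) = pre ++ u' ++ suf.
Proof.
by move=> <-; rewrite /splice take_size_cat // (catA pre u) -size_cat drop_size_cat.
Qed.

Lemma arm_diagramP pre x suf c ms :
  diagram_between (pre ++ (x, true) :: suf)
    (arm_diagram (size pre) c ms) (pre ++ (x, true) :: suf).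
Proof.
elim: ms pre x suf c => [|m ms IH] pre x suf c; first exact: eqxx.
have nth0 (l1 : seq strand) y l : nth strand0 (l1 ++ y :: l) (size l1) = y.
  by rewrite nth_cat ltnn subnn.
have nth1 (l1 : seq strand) y z l :
    nth strand0 (l1 ++ [:: y, z & l]) (size l1).+1 = z.
  by rewrite nth_cat ltnNge leqnSn subSnn.
have sz (l1 : seq strand) y z l :
    ((size l1).+1 < size (l1 ++ [:: y, z & l]))%N.
  by rewrite size_cat !addnS !ltnS leq_addr.
have crossP (y z : nat) l D sec' :
    diagram_between (pre ++ [:: (z, true), (y, true) & l]) D sec' ->
    diagram_between (pre ++ [:: (y, true), (z, true) & l])
      (Cross (size pre) true :: D) sec'.
  move=> H; apply: diagram_between_cons; first by rewrite /= sz nth0 nth1.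
  by rewrite /section_after nth0 nth1 (@splice_cat _ _ pre [:: _; _] _ l).
have rcE (y : strand) l : pre ++ y :: l = rcons pre y ++ l by rewrite cat_rcons.
apply: diagram_between_cons.
  by rewrite /= size_cat /= addnS ltnS leq_addr.
rewrite /section_after rcE.
rewrite (@splice_cat _ _ _ [::]) ?size_rcons // -!rcE.
apply: (@diagram_between_cat _ _
          (pre ++ [:: (x, true), (c, true), (c, false) & suf])).
  rewrite rcE -(size_rcons pre (x, true)); exact: IH.
apply: (crossP); apply: (crossP).
apply: diagram_between_cons.
  by rewrite /= rcE -(size_rcons pre (x, true)) sz nth0 nth1 eqxx.
rewrite /section_after !rcE (@splice_cat _ _ _ [:: _; _]) ?size_rcons //.
exact: eqxx.
Qed.

Lemma star_diagramP arms : diagram_between [::] (star_diagram arms) [::].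
Proof.
apply: diagram_between_cons => //.
apply: (@diagram_between_cat _ _ [:: (0, true); (0, false)]%N) => //.
elim: arms 1%N => [|ms arms IH] c //=.
exact: diagram_between_cat (@arm_diagramP [::] _ _ _ _) (IH _).
Qed.

(* The link of the star-shaped plumbing with a central vertex of framing 0; an
   arm lists its framings starting next to the centre. *)
Definition star_link (arms : seq (seq int)) : framed_link :=
  @FramedLink (star_diagram arms) (0 :: flatten arms) (star_diagramP arms).

(* L is an integral surgery presentation, of star-shaped plumbing type, of
   X(p_1/q_1, ..., p_n/q_n). *)
Definition presents_seifert (n : nat) (p q : 'I_n -> int) (L : framed_link) :
    Prop :=
  exists arms : 'I_n -> seq int,
    (forall k, cont_frac (arms k) = Some ((p k)%:~R / (q k)%:~R))
    /\ L = star_link [seq arms k | k <- enum 'I_n].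

Definition algebraic_integer (F : fieldType) (z : F) : Prop :=
  integralOver (intr : int -> F) z.

(* z lies in the field Q(zeta) = Q[zeta], where zeta is algebraic. *)
Definition in_Q_adjoin (F : fieldType) (zeta z : F) : Prop :=
  exists g : {poly rat}, z = (map_poly (ratr : rat -> F) g).[zeta].

(* Main.v *)
(* Write {x} = sigma^x - sigma^-x for a primitive r-th root of unity sigma.  An
   arm of the star acts on the strand of the centre by a scalar, so that the
   Kirby sum of a plumbing with N vertices is
     {1}^-(N+1) / 2 * sum_(x != 0 mod r) {x}^2 prod_arms (beta_arm(x) / {x}),
   where beta_arm is a quadratic Gauss sum in as many variables as the arm has
   vertices.  If p is prime to r, completing the square turns beta_arm(x) / {x}
   into a Gauss sum times a combination of exponentials of quadratic
   polynomials in x.  With the two other arms, the sum over x is then a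
   combination of differences z(b) - z(b') of Gauss sums z of a single quadratic
   form Q mod r, with different linear terms.

   Since -1 = u^2 + v^2 mod r, the forms Q + Q and - Q - Q are equivalent, and
   z_Q z_(-Q) is computed by orthogonality; hence z^2 is divisible by
   r^m |ker Q|, m being the number of variables.  If ker Q = 0 then z(b) and
   z(b') differ by a root of unity; otherwise |ker Q| is divisible by some d > 1
   dividing r, and thus by {1}^2.  In both cases z(b) - z(b') is divisible by
   sqrt(r)^m {1}.  As G_+ and G_- are sqrt(r) / {1} up to units, this is the
   claim for H != 0.  For H = 0 the linking matrix has nullity 1, so that one
   factor G is missing in the denominator, but {1}^2 divides r. *)

Require Import Defs.
From mathcomp Require Import all_boot all_order all_fingroup all_algebra cyclic.
From mathcomp Require Import spectral sesquilinear complex.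
From mathcomp Require Import all_classical all_reals all_analysis.
From mathcomp Require Import ring zify lra.

Set Implicit Arguments.
Unset Strict Implicit.
Unset Printing Implicit Defensive.

Import Order.TTheory GRing.Theory Num.Theory.
Local Open Scope ring_scope.
Local Open Scope complex_scope.

(** * Partial quantum trace of the double braiding *)

(** The number t is not in Q(zeta), zeta = t^4. Odd colors see it only through t^4: k^2 - 1 is a
    multiple of 8, and [k] does not change under s -> -s. So t may be traded for an r-th root of
    unity tau with tau^4 = t^4, and all exponents live in Z/r, where 2 is invertible. Two arms
    escape the coprimality condition because {x}^2 cancels two denominators {x}. Any further arm
    must be divisible by {x} by itself; this is what a numerator prime to r provides, {bx} / {x}
    being a geometric sum. In a bad arm, the {y} at the free end is a difference of two
    exponentials, for boundary values 1 and -1. Two bad arms give four terms, which x -> -x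
    identifies in pairs; this absorbs the factor 1/2. Divisibility by sqrt(r)^m is tested on
    squares, so that no square root is chosen: sums remain divisible because the mixed term is
    itself a square root of an algebraic integer. The signature enters only through b_+ + b_-, hence
    through the nullity. Continuants solve the kernel equations along each arm, and what is left at
    the centre is the equation sum q/p = 0, unless the central entry vanishes. *)

Section Convolution.
Variable F : fieldType.
Implicit Types f g : nat -> F.

Definition conv f g (L : nat) : F := \sum_(b < L.+1) f b * g (L - b)%N.

(** In generating functions, [conv] is the product and [lagged c f] is (1 - c z) f(z). *)
Definition lagged (c : F) f (b : nat) : F :=
  f b - (if b is b'.+1 then c * f b' else 0).

Lemma conv_laggedl c f g L : conv (lagged c f) g L = lagged c (conv f g) L.
Proof.
rewrite /conv /lagged; under eq_bigr do rewrite mulrBl.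
rewrite sumrB; congr (_ - _); rewrite big_ord_recl mul0r add0r.
case: L => [|L]; first by rewrite big_ord0.
rewrite mulr_sumr; apply: eq_bigr => i _.
by rewrite mulrA lift0 subSS.
Qed.

Lemma convC f g L : conv f g L = conv g f L.
Proof.
rewrite /conv (reindex_inj rev_ord_inj) /=; apply: eq_bigr => i _.
rewrite mulrC subSS; congr (g _ * f _); have := ltn_ord i; lia.
Qed.

Lemma eq_conv f f' g g' L : f =1 f' -> g =1 g' -> conv f g L = conv f' g' L.
Proof. by move=> ef eg; apply: eq_bigr => i _; rewrite ef eg. Qed.

Lemma eq_lagged c f f' L : f =1 f' -> lagged c f L = lagged c f' L.
Proof. by move=> ef; rewrite /lagged ef; case: L => // L; rewrite ef. Qed.

Lemma conv_lagged c d f g L :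
  conv (lagged c f) (lagged d g) L = lagged c (lagged d (conv f g)) L.
Proof.
rewrite conv_laggedl; apply: eq_lagged => {}L.
rewrite convC conv_laggedl; apply: eq_lagged => {}L; exact: convC.
Qed.

End Convolution.

Section QuantumBinomial.
Variables (F : fieldType) (s : F).
Hypothesis s0 : s != 0.
Hypothesis s1 : s - s^-1 != 0.

(** The quantum binomial coefficient of b + n over n, not of b over n. *)
Definition qbin (b n : nat) : F := (\prod_(i < n) qint s (b + i.+1)) / qfact s n.

Lemma qfactS n : qfact s n.+1 = qfact s n * qint s n.+1.
Proof. by rewrite /qfact big_nat_recr. Qed.

Lemma qbin_n0 b : qbin b 0 = 1.
Proof. by rewrite /qbin big_ord0 /qfact big_nil divr1. Qed.

Lemma qfact_neq0 n : (forall i, (0 < i <= n)%N -> qint s i != 0) -> qfact s n != 0.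
Proof.
elim: n => [|n IH] H; first by rewrite /qfact big_nil oner_eq0.
rewrite qfactS mulf_neq0 ?H ?leqnn //; apply: IH => i /andP[i0 iln].
by rewrite H // i0 leqW.
Qed.

Lemma qbin_0n n : (forall i, (0 < i <= n)%N -> qint s i != 0) -> qbin 0 n = 1.
Proof.
move=> H; rewrite /qbin /qfact big_add1 big_mkord.
under eq_bigr do rewrite add0n.
rewrite divff //; have := qfact_neq0 H; by rewrite /qfact big_add1 big_mkord.
Qed.

Let s2 : s * s - 1 != 0.
Proof.
have -> : s * s - 1 = s * (s - s^-1) by field.
by rewrite mulf_neq0.
Qed.

Lemma qintD a b : qint s (a + b) = s ^+ a * qint s b + s ^- b * qint s a.
Proof. by rewrite /qint !exprD; field; rewrite s2 s0 !expf_neq0. Qed.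

Lemma qintD' a b : qint s (a + b) = s ^- a * qint s b + s ^+ b * qint s a.
Proof. by rewrite /qint !exprD; field; rewrite s2 s0 !expf_neq0. Qed.

(** The three coefficients have ratios [n+b+2] / [n+1], [b+1] / [n+1] and 1 to [qbin b.+1 n], so the
    two forms are the two expansions of [(n+1) + (b+1)]. The first serves positive powers in
    [lagged_qbin_r], the second negative powers in [lagged_qbin_l]. *)
Lemma qbin_pascal b n : (forall i, (0 < i <= n.+1)%N -> qint s i != 0) ->
  qbin b.+1 n.+1 = s ^+ n.+1 * qbin b n.+1 + s ^- b.+1 * qbin b.+1 n /\
  qbin b.+1 n.+1 = s ^- n.+1 * qbin b n.+1 + s ^+ b.+1 * qbin b.+1 n.
Proof.
move=> H.
have Hn : qint s n.+1 != 0 by rewrite H ?leqnn.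
have Hf : qfact s n != 0 by apply: qfact_neq0 => i /andP[? ?]; rewrite H // leqW ?andbT.
have -> : qbin b n.+1 = qint s b.+1 / qint s n.+1 * qbin b.+1 n.
  rewrite /qbin qfactS big_ord_recl /= addn1.
  under eq_bigr do rewrite /bump leq0n add1n addnS -addSn.
  by field; rewrite Hn Hf.
have -> : qbin b.+1 n.+1 = qint s (n.+1 + b.+1) / qint s n.+1 * qbin b.+1 n.
  rewrite /qbin qfactS big_ord_recr /= [(b.+1 + _)%N]addnC.
  by field; rewrite Hn Hf.
by split; [rewrite qintD|rewrite qintD']; rewrite !exprS; field; rewrite ?Hn ?s0 ?expf_neq0.
Qed.


Variables (x : nat) (y0 : F).
Hypothesis y00 : y0 != 0.
Hypothesis qx : forall i, (0 < i <= x)%N -> qint s i != 0.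

(** With Y = y0 s^(2n), it is the middle coefficient of Q_n = (1 - Y z) (1 - z / Y) = 1 -
    [braid_al n] z + z^2. *)
Definition braid_al (n : nat) : F := y0 * s ^+ n * s ^+ n + (y0 * s ^+ n * s ^+ n)^-1.

Definition braid_conv (n : nat) : nat -> F :=
  conv (fun b => qbin b n * (y0 * s ^+ n) ^- b) (fun b => qbin b n * (y0 * s ^+ n) ^+ b).

Definition braid_S (n l : nat) : F :=
  if (n < l)%N then braid_conv n (l - n.+1) else 0.

Lemma conv_delta (L : nat) :
  conv (fun b => (b == 0)%:R : F) (fun b => (b == 0)%:R) L = (L == 0)%:R.
Proof.
rewrite /conv big_ord_recl /= mul1r subn0 big1 ?addr0 // => i _.
by rewrite mul0r.
Qed.

(** The q-binomial theorem, one factor at a time: the generating function is the product over i <= n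
    of 1 / (1 - s^(-2i) z / y0), and the lag cancels the factor i = n. *)
Lemma lagged_qbin_l n b : (n <= x)%N ->
  lagged (y0 * s ^+ n * s ^+ n)^-1 (fun b => qbin b n * (y0 * s ^+ n) ^- b) b =
  if n is n'.+1 then qbin b n' * (y0 * s ^+ n') ^- b else (b == 0)%:R.
Proof.
move=> nx; have yn m : y0 * s ^+ m != 0 by rewrite mulf_neq0 ?expf_neq0.
rewrite /lagged; case: b => [|b].
  rewrite expr0 invr1 mulr1 subr0; case: n nx => [|n] nx; first by rewrite qbin_n0.
  rewrite ?expr0 ?invr1 mulr1 !qbin_0n // => i /andP[i0 ile]; apply: qx; rewrite i0 /=; lia.
case: n nx => [|n] nx.
  rewrite !qbin_n0 !expr0 !mulr1 !mul1r /= exprS; field.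
  by rewrite y00 expf_neq0.
have [//|_ ->] := @qbin_pascal b n.
  by move=> i /andP[i0 ile]; apply: qx; rewrite i0 /=; lia.
have -> : (y0 * s ^+ n) ^- b.+1 = s ^+ b.+1 * (y0 * s ^+ n.+1) ^- b.+1.
  rewrite !exprMn -!exprM mulSn exprD; field.
  by rewrite !expf_neq0.
rewrite [(y0 * s ^+ n.+1) ^+ b.+1]exprS; set Y := y0 * s ^+ n.+1.
rewrite -/Y invfM.
by field; rewrite !expf_neq0 ?yn.
Qed.

Lemma lagged_qbin_r n b : (n <= x)%N ->
  lagged (y0 * s ^+ n * s ^+ n) (fun b => qbin b n * (y0 * s ^+ n) ^+ b) b =
  if n is n'.+1 then qbin b n' * (y0 * s ^+ n') ^+ b else (b == 0)%:R.
Proof.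
move=> nx; have yn m : y0 * s ^+ m != 0 by rewrite mulf_neq0 ?expf_neq0.
rewrite /lagged; case: b => [|b].
  rewrite expr0 mulr1 subr0; case: n nx => [|n] nx; first by rewrite qbin_n0.
  rewrite ?expr0 mulr1 !qbin_0n // => i /andP[i0 ile]; apply: qx; rewrite i0 /=; lia.
case: n nx => [|n] nx.
  by rewrite !qbin_n0 !expr0 !mulr1 !mul1r /= exprS subrr.
have [//|-> _] := @qbin_pascal b n.
  by move=> i /andP[i0 ile]; apply: qx; rewrite i0 /=; lia.
have -> : (y0 * s ^+ n) ^+ b.+1 = s ^- b.+1 * (y0 * s ^+ n.+1) ^+ b.+1.
  rewrite !exprMn -!exprM mulSn exprD; field.
  by rewrite !expf_neq0.
rewrite [(y0 * s ^+ n.+1) ^+ b.+1]exprS; set Y := y0 * s ^+ n.+1.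
by field; rewrite !expf_neq0 ?yn.
Qed.

Lemma braid_conv_rec n L : (n <= x)%N ->
  braid_conv n L.+2 - braid_al n * braid_conv n L.+1 + braid_conv n L =
    (if n is n'.+1 then braid_conv n' L.+2 else 0) /\ braid_conv n 1 - braid_al n * braid_conv n 0 =
    (if n is n'.+1 then braid_conv n' 1 else 0).
Proof.
move=> nx; have yn m : y0 * s ^+ m != 0 by rewrite mulf_neq0 ?expf_neq0.
have E K : lagged (y0 * s ^+ n * s ^+ n)^-1
             (lagged (y0 * s ^+ n * s ^+ n) (braid_conv n)) K =
           if n is n'.+1 then braid_conv n' K else (K == 0)%:R.
  rewrite -conv_lagged (eq_conv K (fun b => lagged_qbin_l b nx) (fun b => lagged_qbin_r b nx)).
  by case: (n) => [|n'] //; exact: conv_delta.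
split.
  have := E L.+2; rewrite /lagged /braid_al => <-; field.
  by rewrite y00 !expf_neq0.
have := E 1%N; rewrite /lagged /braid_al => <-; ring.
Qed.

Lemma braid_conv0 n : (n <= x)%N -> braid_conv n 0 = 1.
Proof.
move=> nx; rewrite /braid_conv /conv big_ord_recl big_ord0 addr0 /= subn0 !expr0 invr1 !mulr1.
by rewrite !qbin_0n ?mulr1 // => i /andP[i0 ile]; apply: qx; rewrite i0 /=; lia.
Qed.

(** Coefficientwise Q_n S_n = z S_(n-1), the truncation in [braid_S] being multiplication by
    z^(n+1). *)
Lemma braid_S_rec n l : (n <= x)%N ->
  braid_S n l.+2 - braid_al n * braid_S n l.+1 + braid_S n l =
  if n is n'.+1 then braid_S n' l.+1 else 0.
Proof.
move=> nx; rewrite /braid_S.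
have [nl|ln] := ltnP n l.
  have [L ->] : exists L, l = (L + n.+1)%N by exists (l - n.+1)%N; lia.
  rewrite !ifT; try lia.
  rewrite -!addSn !addnK; have [-> _] := braid_conv_rec L nx.
  case: n {nl} nx => [|n] nx //; rewrite ifT; try lia.
  by congr braid_conv; lia.
(* At l = n the recursion has only its first two terms, whence the second half of
   [braid_conv_rec]. *)
move: ln; rewrite leq_eqVlt => /orP[/eqP->|ln].
  rewrite ltnS leqnSn ltnSn subnn subSnn addr0.
  have [_ ->] := braid_conv_rec 0 nx.
  case: n nx => [|n] nx //; rewrite ifT; try lia.
  by congr braid_conv; lia.
rewrite addr0; case: n nx ln => [|n] nx // ln.
have -> : (n.+1 < l.+1)%N = false by lia.
rewrite mulr0 subr0; have [->|nl] := eqVneq n l.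
  by rewrite ltnSn ltnSn !subnn !braid_conv0 //; lia.
by rewrite !ifF //; lia.
Qed.

Definition braid_c (n : nat) : F := \prod_(i < n) (braid_al x - braid_al i).

Lemma braid_cS n : braid_c n.+1 = braid_c n * (braid_al x - braid_al n).
Proof. by rewrite /braid_c big_ord_recr. Qed.

Definition braid_D (l : nat) : F := \sum_(n < x.+1) braid_c n * braid_S n l.

(** As Q_x = Q_n - ([braid_al x] - [braid_al n]) z, multiplying the n-th term by Q_x gives z (c_n
    S_(n-1) - c_(n+1) S_n), which telescopes. *)
Lemma braid_D_rec l : braid_D l.+2 = braid_al x * braid_D l.+1 - braid_D l.
Proof.
have E : braid_D l.+2 - braid_al x * braid_D l.+1 + braid_D l = 0.
  rewrite /braid_D mulr_sumr -sumrB -big_split /=.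
  rewrite (eq_bigr (fun n : 'I_x.+1 =>
    (if n : nat is n'.+1 then braid_c n * braid_S n' l.+1 else 0)
      - braid_c n.+1 * braid_S n l.+1)); last first.
    move=> n _; have nx : (n <= x)%N by rewrite -ltnS.
    have := braid_S_rec l nx.
    rewrite braid_cS => E.
    transitivity (braid_c n * (if n : nat is n'.+1 then braid_S n' l.+1 else 0) -
       braid_c n * (braid_al x - braid_al n) * braid_S n l.+1).
      by rewrite -E; ring.
    by congr (_ - _); case: (nat_of_ord n) => [|n']; rewrite ?mulr0.
  rewrite sumrB big_ord_recl big_ord_recr /= add0r.
  (* The last term dies: [braid_c x.+1] has the factor i = x, which is 0. *)
  rewrite braid_cS subrr mulr0 mul0r addr0.
  by apply/eqP; rewrite subr_eq0; apply/eqP; apply: eq_bigr.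
by apply/eqP; rewrite -subr_eq0 -E; apply/eqP; ring.
Qed.

Lemma braid_DE l : y0 * s ^+ x * s ^+ x - (y0 * s ^+ x * s ^+ x)^-1 != 0 ->
  braid_D l = ((y0 * s ^+ x * s ^+ x) ^+ l - (y0 * s ^+ x * s ^+ x) ^- l) /
    (y0 * s ^+ x * s ^+ x - (y0 * s ^+ x * s ^+ x)^-1).
Proof.
set Y := y0 * _ * _ => Y1.
have Y0 : Y != 0 by rewrite !mulf_neq0 ?expf_neq0.
suff [//] : braid_D l = (Y ^+ l - Y ^- l) / (Y - Y^-1) /\ braid_D l.+1 = (Y ^+ l.+1 - Y ^- l.+1) / (Y - Y^-1).
elim: l => [|l [IH1 IH2]]; split => //.
- rewrite expr0 invr1 subrr mul0r /braid_D big1 // => i _.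
  by rewrite /braid_S ltn0 mulr0.
- rewrite expr1 divff // /braid_D big_ord_recl big1 => [|i _].
    by rewrite /braid_S ltnS leqnn subnn braid_conv0 // /braid_c big_ord0 mulr1 addr0.
  by rewrite /braid_S /= mulr0.
have Y2 : Y * Y - 1 != 0.
  have -> : Y * Y - 1 = Y * (Y - Y^-1) by field.
  by rewrite mulf_neq0.
rewrite braid_D_rec IH1 IH2 /braid_al -/Y !exprS; field.
by rewrite Y0 Y2 expf_neq0.
Qed.

End QuantumBinomial.

Lemma EnFnE (F : fieldType) (s : F) k n a b :
  EnFn s k n a b = \prod_(i < n) qint s (k - a + i) * \prod_(i < n) qint s (b + i.+1).
Proof. exact: big_split. Qed.

Section DoubleBraiding.
Variables (F : fieldType) (t : F).
Let s := t ^+ 2.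
Variables (k l x : nat).
Hypothesis xk : (x < k)%N.
Hypothesis t0 : t != 0.
Hypothesis qk : forall i, (0 < i <= k)%N -> qint s i != 0.

Let s0 : s != 0. Proof. by rewrite expf_neq0. Qed.

Let s1 : s - s^-1 != 0.
Proof.
have k0 : (0 < k)%N by apply: leq_trans xk.
by have := qk (i := 1); rewrite k0 => /(_ isT); apply: contra => /eqP e; rewrite /qint e invr0 mulr0.
Qed.

Let y0 : F := s ^ (k%:Z - 2 * x%:Z).

(** With u = k - x + i and v = x - i, this is (s^(u+v) + s^-(u+v)) - (s^(u-v) + s^(v-u)) = (s^u -
    s^-u) (s^v - s^-v). It identifies [braid_c] with coefficients of E^n and F^n on V_k. *)
Lemma braid_al_diff i : (i <= x)%N ->
  braid_al s y0 x - braid_al s y0 i =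
  (s - s^-1) ^+ 2 * (qint s (k - x + i) * qint s (x - i)).
Proof.
move=> ix; rewrite /braid_al /y0 /qint.
have e j : s ^ (k%:Z - 2 * x%:Z) * s ^+ j * s ^+ j = s ^ (k%:Z - 2 * x%:Z + 2 * j%:Z).
  by rewrite !exprnP -!expfzDr //; congr (_ ^ _); ring.
rewrite !e.
have -> : k%:Z - 2 * x%:Z + 2 * x%:Z = (k - x + i)%:Z + (x - i)%:Z by lia.
have -> : k%:Z - 2 * x%:Z + 2 * i%:Z = (k - x + i)%:Z - (x - i)%:Z by lia.
have eB a b : s ^ (a%:Z - b%:Z) = s ^+ a / s ^+ b by rewrite expfzDr // exprnN.
rewrite eB -PoszD -exprnP exprD.
have A : s ^+ (k - x + i) != 0 by rewrite expf_neq0.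
have B : s ^+ (x - i) != 0 by rewrite expf_neq0.
move: (s ^+ (k - x + i)) (s ^+ (x - i)) A B => u v u0 v0.
have s2 : s * s - 1 != 0.
  have -> : s * s - 1 = s * (s - s^-1) by field.
  by rewrite mulf_neq0.
by field; rewrite ?u0 ?v0 ?s0 ?s2.
Qed.

Lemma braid_cE n : (n <= x)%N ->
  braid_c s x y0 n = ((s - s^-1) ^+ n) ^+ 2 *
    (\prod_(i < n) qint s (k - x + i) * \prod_(i < n) qint s (x - n + i.+1)).
Proof.
move=> nx; rewrite /braid_c.
rewrite (eq_bigr (fun i : 'I_n => (s - s^-1) ^+ 2 * (qint s (k - x + i) * qint s (x - i)))); last first.
  by move=> i _; rewrite braid_al_diff //; have := ltn_ord i; lia.
rewrite big_split /= prodr_const card_ord big_split /=.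
congr (_ * (_ * _)); first by rewrite -!exprM mulnC.
rewrite [RHS](reindex_inj rev_ord_inj); apply: eq_bigr => i _ /=.
by congr qint; have := ltn_ord i; lia.
Qed.

Lemma double_braiding_term b n : (n <= x)%N -> (b + n < l)%N ->
  s ^ weight l b * (Rmat t l k (b + n) (x - n) b x * Rmat t k l x b (x - n) (b + n)) =
  braid_c s x y0 n * ((qbin s b n * (y0 * s ^+ n) ^- b) *
    (qbin s (l - n.+1 - b) n * (y0 * s ^+ n) ^+ (l - n.+1 - b))).
Proof.
move=> nx bnl; rewrite /Rmat leq_addr leq_subr /=.
have e1 : (b + n - b)%N = n by lia.
have e2 : (x - (x - n))%N = n by lia.
rewrite e1 e2 (_ : (x - n + n)%N = x) ?eqxx; last by lia.
rewrite -/s !EnFnE braid_cE // /qbin.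
rewrite (eq_bigr (fun i : 'I_n => qint s (l - (b + n) + i))
   (F1 := fun i : 'I_n => qint s (l - n.+1 - b + i.+1))); last first.
  by move=> i _; congr qint; lia.
move: (\prod_(i < n) qint s (l - (b + n) + i)) (\prod_(i < n) qint s (x - n + i.+1))
  (\prod_(i < n) qint s (k - x + i)) (\prod_(i < n) qint s (b + i.+1)) => p1 p2 p3 p4.
have q0 : qfact s n != 0.
  by apply: qfact_neq0 => i /andP[i0 ile]; apply: qk; rewrite i0 /=; lia.
(* With W = l - 1 - 2b and V = k - 1 - 2x, the exponent of t on the left factors as 2 (V + 1 + n) (W
   - n), and [y0 * s ^+ n] is t^(2 (V + 1 + n)). *)
have key : s ^ weight l b * (t ^ (weight l b * weight k x) *
    t ^ (weight k (x - n) * weight l (b + n))) * (s ^+ 'C(n, 2)) ^+ 2 =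
    (y0 * s ^+ n) ^- b * (y0 * s ^+ n) ^+ (l - n.+1 - b).
  have tE (z : int) : s ^ z = t ^ (2 * z) by rewrite /s exprnP exprz_exp.
  have -> : y0 * s ^+ n = t ^ (2 * (k%:Z - 2 * x%:Z + n%:Z)).
    by rewrite /y0 exprnP -expfzDr // tE.
  rewrite -exprM [_ ^- b]exprnN !exprnP !tE !exprz_exp -!expfzDr //.
  congr (_ ^ _); rewrite /weight.
  have -> : ('C(n, 2) * 2)%N%:Z = n%:Z * n%:Z - n%:Z.
    by rewrite bin2 muln2; have := halfK (n * n.-1); rewrite oddM; case: n {nx bnl e1 e2 q0} => [|n] //=; rewrite andNb /=; lia.
  have -> : (l - n.+1 - b)%N%:Z = l%:Z - n%:Z - 1 - b%:Z by lia.
  have -> : (x - n)%N%:Z = x%:Z - n%:Z by lia.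
  by rewrite PoszD; ring.
transitivity (s ^ weight l b * (t ^ (weight l b * weight k x) *
    t ^ (weight k (x - n) * weight l (b + n))) * (s ^+ 'C(n, 2)) ^+ 2 *
   (((s - s^-1) ^+ n) ^+ 2 / qfact s n ^+ 2 * p1 * p2 * p3 * p4)).
  by field.
by rewrite key; field; rewrite q0 expf_neq0 // mulf_neq0 ?expf_neq0 // /y0 expfz_neq0.
Qed.

(** Total weight is conserved at a crossing, so the intermediate state is determined by n = x - c
    alone. *)
Lemma double_braiding_row b : (b < l)%N ->
  \sum_(d < l) \sum_(c < k) Rmat t l k d c b x * Rmat t k l x b c d =
  \sum_(n < x.+1) if (b + n < l)%N then
     Rmat t l k (b + n) (x - n) b x * Rmat t k l x b (x - n) (b + n) else 0.
Proof.
move=> bl; rewrite exchange_big /=.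
pose G (c : nat) : F := if (b + (x - c) < l)%N then
     Rmat t l k (b + (x - c)) c b x * Rmat t k l x b c (b + (x - c)) else 0.
transitivity (\sum_(c < k) if (c < x.+1)%N then G c else 0).
  apply: eq_bigr => c _; rewrite ltnS; have [cx|xc] := leqP c x; last first.
    by apply: big1 => d _; rewrite /Rmat [(c <= x)%N]leqNgt xc mulr0.
  rewrite /G; case: ifP => [dl|/negbT]; last rewrite -leqNgt => ld.
    rewrite (bigD1 (Ordinal dl)) //= big1 ?addr0 // => d /eqP nd.
    rewrite [Rmat t k l _ _ _ _]/Rmat; case: ifP => [/andP[_ /eqP e]|]; last by rewrite mulr0.
    by case: nd; apply: val_inj.
  apply: big1 => d _; rewrite [Rmat t k l _ _ _ _]/Rmat.
  by case: ifP => [/andP[_ /eqP e]|]; [move: (ltn_ord d) ld; lia | rewrite mulr0].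
rewrite -big_mkcond -(big_ord_widen _ G xk) (reindex_inj rev_ord_inj) /=.
apply: eq_bigr => n _; rewrite /G; have := ltn_ord n => nx.
by rewrite subSS (_ : x - (x - n) = n)%N //; lia.
Qed.

(* Expanding in powers of E (x) F, the n-th term of the partial trace is
   [braid_c n * braid_S n l]; the S_n have the generating functions
   z^(n+1) / (Q_0 ... Q_n), where Q_i = 1 - braid_al i z + z^2, so that the sum
   over n telescopes to z / Q_x. *)
Lemma double_braiding :
  \sum_(b < l) s ^ weight l b *
    (\sum_(d < l) \sum_(c < k) Rmat t l k d c b x * Rmat t k l x b c d) =
  qint s (k * l) / qint s k.
Proof.
transitivity (braid_D s x y0 l).
  under eq_bigr => b _ do rewrite double_braiding_row // mulr_sumr.
  rewrite exchange_big /=; apply: eq_bigr => n _.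
  have nx : (n <= x)%N by rewrite -ltnS.
  rewrite /braid_S; case: ifP => [nl|/negbT]; last first.
    rewrite -leqNgt mulr0 => ln; apply: big1 => b _.
    by rewrite ifF ?mulr0 //; apply/negP; lia.
  rewrite /braid_conv /conv mulr_sumr.
  pose G b := s ^ weight l b * (Rmat t l k (b + n) (x - n) b x * Rmat t k l x b (x - n) (b + n)).
  transitivity (\sum_(b < l) if (b < (l - n.+1).+1)%N then G b else 0).
    apply: eq_bigr => b _; have -> : (b + n < l)%N = (b < (l - n.+1).+1)%N by lia.
    by case: ifP; rewrite // mulr0.
  have ll : ((l - n.+1).+1 <= l)%N by lia.
  rewrite -big_mkcond -(big_ord_widen _ G ll); apply: eq_bigr => b _.
  by rewrite /G double_braiding_term //; have := ltn_ord b; lia.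
have qkx i : (0 < i <= x)%N -> qint s i != 0.
  by move=> /andP[i0 ix]; apply: qk; rewrite i0 /=; lia.
have k0 : (0 < k)%N by apply: leq_trans xk.
have Yk : y0 * s ^+ x * s ^+ x = s ^+ k.
  by rewrite /y0 !exprnP -!expfzDr //; congr (_ ^ _); ring.
have sk : s ^+ k - s ^- k != 0.
  by have := qk (i := k); rewrite k0 leqnn => /(_ isT); apply: contra => /eqP e; rewrite /qint e mul0r.
rewrite braid_DE ?Yk ?expfz_neq0 // /qint.
rewrite -!exprM invf_div mulrA divfK //.
Qed.

End DoubleBraiding.

(** * Colored Jones invariants of star-shaped plumbing links *)

Lemma nth_size_cat (T : Type) (x0 : T) s x s' : nth x0 (s ++ x :: s') (size s) = x.
Proof. by rewrite nth_cat ltnn subnn. Qed.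

Lemma nth_size_cat1 (T : Type) (x0 : T) s x y s' :
  nth x0 (s ++ x :: y :: s') (size s).+1 = y.
Proof. by rewrite nth_cat ltnNge leqnSn subSnn. Qed.

Section StarEvaluation.
Variables (F : fieldType) (t : F) (col : seq nat).
Let s := t ^+ 2.
Hypothesis t0 : t != 0.
Hypothesis qcol : forall c i, (0 < i <= nth 0%N col c)%N -> qint s i != 0.

Lemma apply_diagram_cat sec D1 sec1 D2 v : diagram_between sec D1 sec1 ->
  apply_diagram t col sec (D1 ++ D2) v =
  apply_diagram t col sec1 D2 (apply_diagram t col sec D1 v).
Proof.
elim: D1 sec v => [|e D1 IH] sec v /=; first by move/eqP->.
by case/andP=> _ /IH ->.
Qed.

(** A circle of color l clasping a strand of color k contributes [kl] / [k], the Hopf link divided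
    by the unknot. *)
Fixpoint arm_scalar (k c : nat) (ms : seq int) : F :=
  if ms is _ :: ms' then
    qint s (k * nth 0%N col c) / qint s k * arm_scalar (nth 0%N col c) c.+1 ms'
  else 1.

(** The inner arm acts on its own strand by a scalar, by induction with one more strand on the left;
    the remaining birth, two crossings and death are the partial trace of [double_braiding]. *)
Lemma apply_arm pre x suf c ms v preW a sufW :
  size preW = size pre -> (a < nth 0%N col x)%N ->
  apply_diagram t col (pre ++ (x, true) :: suf) (arm_diagram (size pre) c ms) v
    (preW ++ a :: sufW) =
  arm_scalar (nth 0%N col x) c ms * v (preW ++ a :: sufW).
Proof.
elim: ms pre x suf c v preW a sufW => [|m ms IH] pre x suf c v preW a sufW sz ax.
  by rewrite /= mul1r.
set k := nth 0%N col x; set l := nth 0%N col c.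
have rcE (T : Type) (p : seq T) (y : T) r : p ++ y :: r = rcons p y ++ r by rewrite cat_rcons.
have sec1 : section_after (pre ++ (x, true) :: suf) (Birth (size pre).+1 c true) =
    pre ++ [:: (x, true), (c, true), (c, false) & suf].
  by rewrite /section_after rcE (@splice_cat _ _ _ [::]) ?size_rcons // -!rcE.
rewrite [arm_diagram _ _ _]/=.
rewrite -[apply_diagram _ _ _ _ _]/(apply_diagram t col
  (section_after (pre ++ (x, true) :: suf) (Birth (size pre).+1 c true)) _ _) sec1.
set v1 := apply_event _ _ _ _ v.
have D1 : diagram_between (pre ++ [:: (x, true), (c, true), (c, false) & suf])
   (arm_diagram (size pre).+1 c.+1 ms) (pre ++ [:: (x, true), (c, true), (c, false) & suf]).
  by rewrite rcE -(size_rcons pre (x, true)); exact: arm_diagramP.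
rewrite (apply_diagram_cat _ _ D1).
set v2 := apply_diagram _ _ _ (arm_diagram _ _ _) v1.
(* After the birth and the inner arm, the new strand and its dual still carry the same index. *)
have v2E p a' b' q r : size p = size pre -> (b' < l)%N ->
    v2 (p ++ [:: a', b', q & r]) = arm_scalar l c.+1 ms *
      (if q == b' then v (p ++ a' :: r) else 0).
  move=> szp b'l; rewrite /v2 (rcE _ pre) -(size_rcons pre (x, true)) (rcE _ p).
  rewrite IH ?size_rcons ?szp // -!rcE /v1 /= -szp nth_size_cat1.
  rewrite (_ : nth 0%N _ (size p).+2 = q); last first.
    by rewrite rcE -(size_rcons p a') nth_size_cat1.
  case: eqP => // _; rewrite mul1r; congr (_ * v _) => /=.
  by rewrite rcE -(size_rcons p a') (@splice_cat _ _ _ [:: _; _] [::]).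
have crossE (y z : nat) r p a1 a2 r' u : size p = size pre ->
    apply_event t col (pre ++ [:: (y, true), (z, true) & r]) (Cross (size pre) true) u
      (p ++ [:: a1, a2 & r']) =
    \sum_(a' < nth 0%N col y) \sum_(b' < nth 0%N col z)
      Rmat t (nth 0%N col y) (nth 0%N col z) a' b' a2 a1 * u (p ++ [:: val a', val b' & r']).
  move=> szp; rewrite /= nth_size_cat nth_size_cat1 -szp nth_size_cat nth_size_cat1 /=.
  apply: eq_bigr => a' _; apply: eq_bigr => b' _.
  by rewrite (@splice_cat _ _ p [:: _; _]).
have sec2 y z r pos : section_after (pre ++ [:: y, z & r]) (Cross (size pre) pos) =
    pre ++ [:: z, y & r].
  by rewrite /section_after nth_size_cat nth_size_cat1 (@splice_cat _ _ pre [:: _; _]).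
have consE sec e D u : apply_diagram t col sec (e :: D) u =
  apply_diagram t col (section_after sec e) D (apply_event t col sec e u) by [].
have deathE sec i u w : apply_event t col sec (Death i) u w =
  \sum_(a' < nth 0%N col (nth strand0 sec i).1)
        (if (nth strand0 sec i).2 then s ^ weight (nth 0%N col (nth strand0 sec i).1) a' else 1)
          * u (splice i 0 [:: val a'; val a'] w) by [].
rewrite consE sec2 consE sec2 consE [apply_diagram _ _ _ [::] _]/apply_diagram deathE nth_size_cat1 [(c, true).1]/= [(c, true).2]/= -/l.
have qk i : (0 < i <= k)%N -> qint s i != 0 by exact: qcol.
rewrite [arm_scalar _ _ _]/= -/l -[qint s _ / _](double_braiding l ax t0 qk) -/k -/s -mulrA mulr_suml.
apply: eq_bigr => b _; rewrite -!mulrA; congr (_ * _).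
have -> : splice (size pre).+1 0 [:: val b; val b] (preW ++ a :: sufW) =
    preW ++ [:: a, val b, val b & sufW].
  by rewrite rcE -sz -(size_rcons preW a) (@splice_cat _ _ _ [::]) ?cat_rcons.
rewrite crossE // -/k -/l mulr_suml; apply: eq_bigr => d _.
rewrite mulr_suml; apply: eq_bigr => e _; rewrite -!mulrA.
have [z|nz] := eqVneq (Rmat t l k d e b a) 0; first by rewrite z !mul0r.
congr (_ * _).
rewrite crossE // -/k -/l.
(* The birth forces b' = b, and conservation of weight at both crossings then forces a' = a. *)
rewrite (bigD1 (Ordinal ax)) //= [X in _ + X]big1 => [|a' /eqP na'].
  rewrite addr0 (bigD1 b) //= [X in _ + X]big1 => [|b' /eqP nb'].
    by rewrite addr0 v2E // eqxx.
  rewrite v2E //; case: eqP => [e1|_]; last by rewrite !mulr0.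
  by case: nb'; apply: val_inj.
rewrite big1 // => b' _; rewrite v2E //; case: eqP => [e1|_]; last by rewrite !mulr0.
rewrite /Rmat -e1; case: ifP => [/andP[ea /eqP ed]|]; last by rewrite mul0r.
case: na'; apply: val_inj => /=.
move: nz; rewrite /Rmat; case: ifP => [/andP[bd /eqP ->] _|]; last by rewrite eqxx.
by rewrite ed addKn subnKC.
Qed.

Fixpoint arms_scalar (k c : nat) (arms : seq (seq int)) : F :=
  if arms is ms :: arms' then
    arm_scalar k c ms * arms_scalar k (c + size ms) arms'
  else 1.

Lemma apply_arms arms x suf c v a sufW : (a < nth 0%N col x)%N ->
  apply_diagram t col ((x, true) :: suf) (arms_diagram c arms) v (a :: sufW) =
  arms_scalar (nth 0%N col x) c arms * v (a :: sufW).
Proof.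
move=> ax; elim: arms c v => [|ms arms IH] c v; first by rewrite /= mul1r.
rewrite [arms_diagram _ _]/= (apply_diagram_cat _ _ (@arm_diagramP [::] x suf c ms)).
rewrite IH (@apply_arm [::] x suf c ms v [::] a sufW) //= mulrA.
by congr (_ * _); rewrite mulrC.
Qed.

Lemma sum_weight k : s - s^-1 != 0 -> \sum_(a < k) s ^ weight k a = qint s k.
Proof.
move=> s1; have s0 : s != 0 by rewrite expf_neq0.
rewrite /qint -exprVn subrXX mulrAC divff // mul1r; apply: eq_bigr => a _.
rewrite exprVn exprnN exprnP -expfzDr //; congr (_ ^ _).
by rewrite /weight; have := ltn_ord a; lia.
Qed.

Lemma apply_star arms : s - s^-1 != 0 ->
  apply_diagram t col [::] (star_diagram arms) (fun=> 1) [::] =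
  qint s (nth 0%N col 0) * arms_scalar (nth 0%N col 0) 1 arms.
Proof.
move=> s1; rewrite /star_diagram.
have D1 : diagram_between [:: (0, true); (0, false)]%N (arms_diagram 1 arms) [:: (0, true); (0, false)]%N.
  elim: arms 1%N => [|ms arms IH] c //=.
  exact: diagram_between_cat (@arm_diagramP [::] _ _ _ _) (IH _).
rewrite -[LHS]/(apply_diagram t col [:: (0, true); (0, false)]%N _ _ _).
rewrite (apply_diagram_cat _ _ D1).
set v1 := apply_event _ _ _ _ _; set v2 := apply_diagram _ _ _ _ v1.
rewrite -sum_weight // mulr_suml /=; apply: eq_bigr => a _; congr (_ * _).
by rewrite /v2 /splice /= apply_arms // /v1 /= eqxx !mulr1.
Qed.

End StarEvaluation.

(** * Crossings and linking numbers of the star *)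

Lemma crossings_cat sec D1 sec1 D2 : diagram_between sec D1 sec1 ->
  crossings sec (D1 ++ D2) = crossings sec D1 ++ crossings sec1 D2.
Proof.
elim: D1 sec => [|e D1 IH] sec /=; first by move/eqP->.
by case/andP=> _ /IH ->; case: e.
Qed.

Fixpoint arm_edges (x c : nat) (ms : seq int) : seq (nat * nat) :=
  if ms is _ :: ms' then (x, c) :: arm_edges c c.+1 ms' else [::].

Fixpoint arms_edges (c : nat) (arms : seq (seq int)) : seq (nat * nat) :=
  if arms is ms :: arms' then arm_edges 0 c ms ++ arms_edges (c + size ms) arms'
  else [::].

(** The two positive crossings of a clasp meet the strands in either order, so each edge of the tree
    occurs once in each orientation. A permutation suffices, as only sums over crossings are
    used. *)
Lemma perm_arm_crossings pre x suf c ms :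
  perm_eq (crossings (pre ++ (x, true) :: suf) (arm_diagram (size pre) c ms))
    ([seq (1, e) | e <- arm_edges x c ms] ++ [seq (1, (e.2, e.1)) | e <- arm_edges x c ms]).
Proof.
elim: ms pre x suf c => [|m ms IH] pre x suf c //.
have rcE (T : Type) (p : seq T) (y : T) r : p ++ y :: r = rcons p y ++ r by rewrite cat_rcons.
have sec1 : section_after (pre ++ (x, true) :: suf) (Birth (size pre).+1 c true) =
    pre ++ [:: (x, true), (c, true), (c, false) & suf].
  by rewrite /section_after rcE (@splice_cat _ _ _ [::]) ?size_rcons // -!rcE.
have D1 : diagram_between (pre ++ [:: (x, true), (c, true), (c, false) & suf])
   (arm_diagram (size pre).+1 c.+1 ms) (pre ++ [:: (x, true), (c, true), (c, false) & suf]).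
  by rewrite rcE -(size_rcons pre (x, true)); exact: arm_diagramP.
have sec2 y z r pos : section_after (pre ++ [:: y, z & r]) (Cross (size pre) pos) =
    pre ++ [:: z, y & r].
  by rewrite /section_after nth_size_cat nth_size_cat1 (@splice_cat _ _ pre [:: _; _]).
have crossE sec i D : crossings sec (Cross i true :: D) =
   (1, ((nth strand0 sec i).1, (nth strand0 sec i.+1).1)) :: crossings (section_after sec (Cross i true)) D by [].
rewrite [arm_diagram _ _ _]/=.
rewrite -[crossings _ _]/(crossings
  (section_after (pre ++ (x, true) :: suf) (Birth (size pre).+1 c true)) _) sec1.
rewrite (crossings_cat _ D1) crossE sec2 crossE sec2 [crossings _ [:: Death _]]/=.
rewrite !nth_size_cat !nth_size_cat1 /=.
have := IH (rcons pre (x, true)) c ((c, false) :: suf) c.+1.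
rewrite -rcE size_rcons => H.
apply: perm_trans (_ : perm_eq _ ([:: (1, (x, c)); (1, (c, x))] ++
  ([seq (1, e) | e <- arm_edges c c.+1 ms] ++ [seq (1, (e.2, e.1)) | e <- arm_edges c c.+1 ms]))) _.
  by rewrite perm_catC perm_cat2l.
by rewrite /= perm_cons perm_sym perm_catC /= perm_cons perm_catC.
Qed.

Lemma perm_star_crossings arms :
  perm_eq (crossings [::] (star_diagram arms))
    ([seq (1, e) | e <- arms_edges 1 arms] ++ [seq (1, (e.2, e.1)) | e <- arms_edges 1 arms]).
Proof.
rewrite /star_diagram -[crossings _ _]/(crossings [:: (0, true); (0, false)]%N _).
have D1 c : diagram_between [:: (0, true); (0, false)]%N (arms_diagram c arms) [:: (0, true); (0, false)]%N.
  elim: arms c => [|ms arms IH] c //=.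
  exact: diagram_between_cat (@arm_diagramP [::] _ _ _ _) (IH _).
rewrite (crossings_cat _ (D1 1%N)) [crossings _ [:: Death _]]/= cats0.
elim: arms 1%N {D1} => [|ms arms IH] c //=.
rewrite (crossings_cat _ (@arm_diagramP [::] 0%N [:: (0, false)]%N c ms)).
rewrite !map_cat.
apply: perm_trans (perm_cat (@perm_arm_crossings [::] 0%N [:: (0, false)]%N c ms) (IH _)) _.
by rewrite -!catA perm_cat2l perm_catCA.
Qed.

Lemma arm_edges_lt x c ms e : (x < c)%N -> e \in arm_edges x c ms -> (e.1 < e.2)%N.
Proof.
elim: ms x c => [|m ms IH] x c //= xc; rewrite inE => /orP[/eqP-> //|].
by apply: IH.
Qed.

Lemma arms_edges_lt c arms e : (0 < c)%N -> e \in arms_edges c arms -> (e.1 < e.2)%N.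
Proof.
elim: arms c => [|ms arms IH] c //= c0; rewrite mem_cat => /orP[/arm_edges_lt|]; first exact.
by apply: IH; rewrite addn_gt0 c0.
Qed.

Lemma star_self_writhe arms i : self_writhe (star_link arms) i = 0.
Proof.
rewrite /self_writhe (perm_big _ (perm_star_crossings arms)) /= big_cat /= !big_map /=.
have ne e : e \in arms_edges 1 arms -> e.1 != e.2.
  by move=> he; rewrite neq_ltn (arms_edges_lt _ he).
rewrite [X in X + _]big_seq_cond [X in _ + X]big_seq_cond !big1 ?addr0 // => -[a b] /andP[/ne /= ab];
  by rewrite xpair_eqE => /andP[/eqP ea /eqP eb]; rewrite ea eb eqxx in ab.
Qed.

(** Each clasp counts twice, which cancels the division by 2. *)
Lemma star_linking_number arms i j : linking_number (star_link arms) i j =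
  \sum_(e <- arms_edges 1 arms | (e == (i, j)) || (e == (j, i))) 1.
Proof.
rewrite /linking_number (perm_big _ (perm_star_crossings arms)) /= big_cat /= !big_map /=.
set A := \sum_(e <- _ | _) _; rewrite (_ : \sum_(e <- _ | _) _ = A).
  by rewrite (_ : A + A = A * 2) ?mulzK //; ring.
apply: eq_bigl => -[a b] /=; rewrite !xpair_eqE.
by rewrite orbC [(b == j) && _]andbC [(b == i) && _]andbC.
Qed.

(** * State sums along the arms *)

Section NestedSums.
Variables (F : fieldType) (r : nat).

(** Iterated sums over lists of colors, unlike sums over tuples, can be cut at the boundary between
    two arms. *)
Fixpoint odd_sum (n : nat) (G : seq nat -> F) : F :=
  if n is n'.+1 then \sum_(k < r | odd k) odd_sum n' (fun w => G (val k :: w))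
  else G [::].

Lemma odd_sumE n G :
  \sum_(k : n.-tuple 'I_r | all (fun c : 'I_r => odd c) k) G [seq val c | c <- k] =
  odd_sum n G.
Proof.
elim: n G => [|n IH] G /=.
  by rewrite (big_pred1 [tuple]) // => k; rewrite tuple0 /= eqxx.
under [RHS]eq_bigr do rewrite -IH.
rewrite pair_big /=.
rewrite (reindex (fun p : 'I_r * n.-tuple 'I_r => [tuple of p.1 :: p.2])) //=.
exists (fun k : n.+1.-tuple 'I_r => (thead k, [tuple of behead k])) => [[x k] _|k _] /=.
  by congr (_, _); apply: val_inj.
by rewrite -tuple_eta.
Qed.

Lemma eq_odd_sum n G G' :
  (forall w, size w = n -> G w = G' w) -> odd_sum n G = odd_sum n G'.
Proof.
elim: n G G' => [|n IH] G G' H /=; first exact: H.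
by apply: eq_bigr => k ok; apply: IH => w sw; apply: H => /=; rewrite sw.
Qed.

Lemma odd_sumZ n c G : odd_sum n (fun w => c * G w) = c * odd_sum n G.
Proof.
elim: n G => [|n IH] G //=; rewrite mulr_sumr; apply: eq_bigr => k _; exact: IH.
Qed.

Lemma odd_sum_cat m n G H :
  odd_sum (m + n) (fun w => G (take m w) * H (drop m w)) = odd_sum m G * odd_sum n H.
Proof.
elim: m G => [|m IH] G; last by rewrite mulr_suml; apply: eq_bigr => k _; exact: IH.
rewrite /= -odd_sumZ; apply: eq_odd_sum => w _; by rewrite take0 drop0.
Qed.

End NestedSums.

Section StarSum.
Variables (F : fieldType) (r : nat) (t : F).
Let s := t ^+ 2.
Hypothesis t0 : t != 0.
Hypothesis qr : forall i, (0 < i < r)%N -> qint s i != 0.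
Hypothesis s1 : s - s^-1 != 0.

(** The state sum of an arm on a strand of color k, multiplied by [k]: in this normalization the
    denominator of each [k k'] / [k] cancels. *)
Fixpoint arm_sum (ms : seq int) (k : nat) : F :=
  if ms is m :: ms' then
    \sum_(k' < r | odd k') qint s (k * k') * t ^ (m * (k'%:Z ^+ 2 - 1)) * arm_sum ms' k'
  else qint s k.

Definition vertex_weight (m : int) (k : nat) : F := qint s k * t ^ (m * (k%:Z ^+ 2 - 1)).

Fixpoint weights (ms : seq int) (w : seq nat) : F :=
  if ms is m :: ms' then vertex_weight m (head 0%N w) * weights ms' (behead w) else 1.

Fixpoint arm_word (ms : seq int) (k : nat) (w : seq nat) : F :=
  if ms is _ :: ms' then
    qint s (k * head 0%N w) / qint s k * arm_word ms' (head 0%N w) (behead w)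
  else 1.

Fixpoint arms_word (arms : seq (seq int)) (k : nat) (w : seq nat) : F :=
  if arms is ms :: arms' then
    arm_word ms k (take (size ms) w) * arms_word arms' k (drop (size ms) w)
  else 1.

Lemma arm_scalarE col k c ms :
  arm_scalar t col k c ms = arm_word ms k (take (size ms) (drop c col)).
Proof.
elim: ms k c => [|m ms IH] k c //=.
have e : drop c.+1 col = behead (drop c col) by rewrite -drop1 drop_drop add1n.
have h : nth 0%N col c = head 0%N (drop c col) by rewrite -nth0 nth_drop addn0.
rewrite IH e h -/s; by case: (drop c col) => [|a u].
Qed.

Lemma arms_scalarE col k c arms :
  arms_scalar t col k c arms = arms_word arms k (drop c col).
Proof.
elim: arms c => [|ms arms IH] c //=.
by rewrite arm_scalarE IH drop_drop [(size ms + c)%N]addnC.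
Qed.

Lemma arm_sumE ms k : qint s k != 0 ->
  qint s k * odd_sum r (size ms) (fun w => weights ms w * arm_word ms k w) = arm_sum ms k.
Proof.
elim: ms k => [|m ms IH] k qk0 /=; first by rewrite !mulr1.
rewrite mulr_sumr; apply: eq_bigr => k' ok.
have k'0 : qint s k' != 0 by apply: qr; rewrite ltn_ord andbT; case: (val k') ok.
rewrite -IH // mulrA -!odd_sumZ; apply: eq_odd_sum => w _.
rewrite /vertex_weight /=.
by move: (qint s k) (qint s k') (qint s (k * k')) qk0 k'0 => a b c a0 b0; field.
Qed.

Lemma weights_cat ms ms' w :
  weights (ms ++ ms') w = weights ms (take (size ms) w) * weights ms' (drop (size ms) w).
Proof.
elim: ms w => [|m ms IH] w /=; first by rewrite drop0 mul1r.
by rewrite IH mulrA; case: w.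
Qed.

Lemma arms_sumE arms k : qint s k != 0 ->
  odd_sum r (size (flatten arms)) (fun w => weights (flatten arms) w * arms_word arms k w) =
  \prod_(ms <- arms) (arm_sum ms k / qint s k).
Proof.
move=> qk0; elim: arms => [|ms arms IH] /=; first by rewrite big_nil mulr1.
rewrite big_cons -IH size_cat -arm_sumE // [X in _ = X * _]mulrAC divff // mul1r -odd_sum_cat.
by apply: eq_odd_sum => w _; rewrite weights_cat mulrACA.
Qed.

Lemma prod_vertex_weight fr col : size col = size fr ->
  \prod_(i < size fr) vertex_weight (nth 0 fr i) (nth 0%N col i) = weights fr col.
Proof.
elim: fr col => [|m fr IH] [|k col] //=; first by rewrite big_ord0.
by case=> sz; rewrite big_ord_recl /= -IH.
Qed.

(** Of the two factors [k], one is the weight of the central color and the other the value of the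
    central unknot; its framing 0 gives no power of t. *)
Lemma star_sum arms :
  \sum_(k : (ncomp (star_link arms)).-tuple 'I_r | all (fun c : 'I_r => odd c) k)
    (\prod_(i < ncomp (star_link arms)) qint s (tnth k i))
      * colored_jones t (star_link arms) [seq val c | c <- k] =
  \sum_(k < r | odd k) qint s k ^+ 2 * \prod_(ms <- arms) (arm_sum ms k / qint s k).
Proof.
set L := star_link arms; set N := ncomp L.
pose G (w : seq nat) := weights (0 :: flatten arms) w *
   (qint s (head 0%N w) * arms_word arms (head 0%N w) (behead w)).
transitivity (odd_sum r N G).
  rewrite -odd_sumE; apply: eq_bigr => k /allP ok.
  set col := [seq val c | c <- k].
  have colr c i : (0 < i <= nth 0%N col c)%N -> qint s i != 0.
    case/andP=> i0 ile; apply: qr; rewrite i0 /=.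
    have [cs|sc] := ltnP c (size col); last by move: ile; rewrite nth_default //; lia.
    apply: leq_ltn_trans ile _.
    have /mapP [j _ ->] := mem_nth 0%N cs; exact: ltn_ord.
  rewrite /colored_jones [apply_diagram _ _ _ _ _ _]apply_star //.
  rewrite mulrA -big_split /= /G -nth0 arms_scalarE drop1; congr (_ * _).
  rewrite -prod_vertex_weight; last by rewrite size_map size_tuple.
  apply: eq_bigr => i _; rewrite star_self_writhe subr0 /vertex_weight.
  by congr (qint s _ * _); rewrite (nth_map (tnth k i)) ?size_tuple // -tnth_nth.
rewrite /N /ncomp /= /G; apply: eq_bigr => k ok.
have k0 : qint s k != 0 by apply: qr; rewrite ltn_ord andbT; case: (val k) ok.
rewrite -arms_sumE // -odd_sumZ; apply: eq_odd_sum => w _ /=.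
by rewrite /vertex_weight mul0r expr0z; move: (qint s k) => a; ring.
Qed.

End StarSum.

(** * Quadratic Gauss sums modulo r *)

Lemma dvdz_ex (d a : int) : (d %| a)%Z -> exists t : int, a = t * d.
Proof. by case/dvdzP => t ->; exists t. Qed.

Lemma coprimez_ex (m n : int) : coprimez m n -> exists a b : int, a * m + b * n = 1.
Proof. by case/coprimezP => -[a b] /= ab; exists a, b. Qed.

(** Pigeonhole: the (p + 1) / 2 squares a and the (p + 1) / 2 values -1 - a cannot be disjoint among
    p residues. *)
Lemma sum_two_squares_prime p : prime p -> odd p ->
  exists u v : int, (p%:Z %| u ^+ 2 + v ^+ 2 + 1)%Z.
Proof.
move=> pp op; set h := p./2.+1.
have p_gt1 := prime_gt1 pp.
have ph : (p = p./2 * 2 + 1)%N.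
  by rewrite -{1}(odd_double_half p) op muln2 addnC.
have hi (i : 'I_h) : (i <= p./2)%N by rewrite -ltnS ltn_ord.
pose A := [set (((val i)%:R : 'F_p) ^+ 2) | i in 'I_h].
have cA : #|A| = h.
  rewrite card_imset ?card_ord // => i j /eqP; rewrite eqf_sqr => /orP[|] /eqP e.
    apply: val_inj; move/(congr1 (@nat_of_ord _)): e => /=.
    by rewrite !val_Fp_nat // !modn_small //; have := hi i; have := hi j; lia.
  have : (val i + val j)%:R = 0 :> 'F_p by rewrite natrD e addNr.
  move/(congr1 (@nat_of_ord _)); rewrite val_Fp_nat // modn_small => [|]; last first.
    by have := hi i; have := hi j; rewrite /=; lia.
  by move=> /= e0; apply: val_inj => /=; lia.
pose B := [set - 1 - a | a in A].
have cB : #|B| = h by rewrite card_imset // => a b /addrI /oppr_inj.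
have : A :&: B != finset.set0.
  apply/negP => /eqP e; have := cardsUI A B; rewrite e cards0 addn0 cA cB => c.
  have := max_card (mem (A :|: B)); rewrite card_Fp // c.
  by rewrite /h; lia.
case/set0Pn => a /setIP[/imsetP[i _ ai] /imsetP[b /imsetP[j _ ->] ab]].
exists (val i)%:Z, (val j)%:Z.
have : ((val i) ^ 2 + (val j) ^ 2 + 1)%:R = 0 :> 'F_p.
  by rewrite !natrD !natrX -ai ab subrK addNr.
move/eqP; rewrite -(dvdn_pcharf (pchar_Fp pp)) -!mulnn.
by rewrite !expr2 -!PoszM -!PoszD.
Qed.

(** Induction removing one prime p at a time: Chinese remainders if p is new, Hensel lifting if it
    is repeated. *)
Lemma sum_two_squares_mod r : odd r ->
  exists u v : int, (r%:Z %| u ^+ 2 + v ^+ 2 + 1)%Z.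
Proof.
elim/ltn_ind: r => r IH odd_r.
have [r1|r1] := leqP r 1.
  by exists 0, 0; case: r r1 odd_r {IH} => [|[|]] //; rewrite dvd1z.
have pp := pdiv_prime r1; set p := pdiv r in pp.
have /dvdnP [m rE] : (p %| r)%N by exact: pdiv_dvd.
have op : odd p by move: odd_r; rewrite rE oddM => /andP[].
have om : odd m by move: odd_r; rewrite rE oddM => /andP[].
have m0 : (0 < m)%N by case: (m) om.
have m_lt : (m < r)%N by rewrite rE ltn_Pmulr ?prime_gt1.
have [u [v /dvdz_ex [t ut]]] := IH m m_lt om.
(* The linear congruence of Hensel's lemma, solvable since 2w is a unit mod p. *)
have lift (w : int) : ~~ (p%:Z %| w)%Z -> exists x : int, (p%:Z %| t + 2 * w * x)%Z.
  move=> pw; have : coprimez (2 * w) p%:Z.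
    rewrite coprimez_sym coprimezE /= prime_coprime // abszM Euclid_dvdM // negb_or.
    by rewrite pw andbT gtnNdvd //; case: (p) (prime_gt1 pp) op => [|[|[|]]].
  case/coprimez_ex => a [b ab]; exists (- t * a).
  have -> : t + 2 * w * (- t * a) = t * b * p%:Z.
    transitivity (t * (a * (2 * w) + b * p%:Z) + 2 * w * (- t * a)); first by rewrite ab mulr1.
    by ring.
  exact: dvdz_mull.
have rZ : r%:Z = m%:Z * p%:Z by rewrite rE.
have [pm|pm] := boolP (p %| m)%N; last first.
  (* The coefficients a m + b p = 1 glue the solutions mod m and mod p. *)
  have [a [b ab]] : exists a b, a * m%:Z + b * p%:Z = 1.
    by apply: coprimez_ex; rewrite coprimez_sym coprimezE /= prime_coprime.
  have [u' [v' uv']] := sum_two_squares_prime pp op.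
  exists (u * b * p%:Z + u' * a * m%:Z), (v * b * p%:Z + v' * a * m%:Z).
  rewrite rZ Gauss_dvdz; last by rewrite coprimez_sym coprimezE /= prime_coprime.
  case/dvdz_ex: uv' => t' ut'; apply/andP; split; apply/dvdzP.
    exists (t + 2 * u * (a * (u' - u)) + 2 * v * (a * (v' - v)) +
            m%:Z * ((a * (u' - u)) ^+ 2 + (a * (v' - v)) ^+ 2)).
    have E w w' : w * b * p%:Z + w' * a * m%:Z = w + m%:Z * (a * (w' - w)).
      transitivity (w * (a * m%:Z + b * p%:Z) + m%:Z * (a * (w' - w))); [ring | by rewrite ab mulr1].
    rewrite !E; transitivity (u ^+ 2 + v ^+ 2 + 1 + (2 * u * (a * (u' - u)) + 2 * v * (a * (v' - v)) +
       m%:Z * ((a * (u' - u)) ^+ 2 + (a * (v' - v)) ^+ 2)) * m%:Z); first by ring.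
    by rewrite ut; ring.
  exists (t' + 2 * u' * (b * (u - u')) + 2 * v' * (b * (v - v')) +
          p%:Z * ((b * (u - u')) ^+ 2 + (b * (v - v')) ^+ 2)).
  have E w w' : w * b * p%:Z + w' * a * m%:Z = w' + p%:Z * (b * (w - w')).
    transitivity (w' * (a * m%:Z + b * p%:Z) + p%:Z * (b * (w - w'))); [ring | by rewrite ab mulr1].
  rewrite !E; transitivity (u' ^+ 2 + v' ^+ 2 + 1 + (2 * u' * (b * (u - u')) + 2 * v' * (b * (v - v')) +
     p%:Z * ((b * (u - u')) ^+ 2 + (b * (v - v')) ^+ 2)) * p%:Z); first by ring.
  by rewrite ut'; ring.
case/dvdnP: pm => m' mE.
have mZ : m%:Z = m'%:Z * p%:Z by rewrite mE.
(* As p divides m, adding m x to u or to v changes the value mod m p only by the linear term. *)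
have [pu|pu] := boolP (p%:Z %| u)%Z; last first.
  have [x /dvdz_ex [y xy]] := lift _ pu; exists (u + m%:Z * x), v.
  apply/dvdzP; exists (y + m'%:Z * x ^+ 2).
  transitivity (u ^+ 2 + v ^+ 2 + 1 + m%:Z * (2 * u * x) + m%:Z * m%:Z * x ^+ 2); first by ring.
  rewrite ut rZ; transitivity (m%:Z * (t + 2 * u * x) + m%:Z * m%:Z * x ^+ 2); first by ring.
  by rewrite xy {2}mZ; ring.
have [pv|pv] := boolP (p%:Z %| v)%Z; last first.
  have [x /dvdz_ex [y xy]] := lift _ pv; exists u, (v + m%:Z * x).
  apply/dvdzP; exists (y + m'%:Z * x ^+ 2).
  transitivity (u ^+ 2 + v ^+ 2 + 1 + m%:Z * (2 * v * x) + m%:Z * m%:Z * x ^+ 2); first by ring.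
  rewrite ut rZ; transitivity (m%:Z * (t + 2 * v * x) + m%:Z * m%:Z * x ^+ 2); first by ring.
  by rewrite xy {2}mZ; ring.
case/dvdz_ex: pu => u1 uE; case/dvdz_ex: pv => v1 vE.
(* If p divides both u and v, it divides 1. *)
have : (p%:Z %| 1)%Z.
  apply/dvdzP; exists (t * m'%:Z - u1 ^+ 2 * p%:Z - v1 ^+ 2 * p%:Z).
  have -> : 1 = (u ^+ 2 + v ^+ 2 + 1) - u ^+ 2 - v ^+ 2 :> int by ring.
  by rewrite ut mZ uE vE; ring.
by rewrite dvdz1 absz_nat => /eqP p1; move: (prime_gt1 pp); rewrite p1.
Qed.

Section AlgebraicIntegers.
Variable C : fieldType.
Implicit Types x y : C.

Lemma aint0 : algebraic_integer (0 : C). Proof. exact: mxpoly.integral0. Qed.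
Lemma aint1 : algebraic_integer (1 : C). Proof. exact: mxpoly.integral1. Qed.
Lemma aint_nat n : algebraic_integer (n%:R : C). Proof. exact: mxpoly.integral_nat. Qed.
Lemma aintN x : algebraic_integer x -> algebraic_integer (- x). Proof. exact: mxpoly.integral_opp. Qed.
Lemma aintD x y : algebraic_integer x -> algebraic_integer y -> algebraic_integer (x + y). Proof. exact: mxpoly.integral_add. Qed.
Lemma aintB x y : algebraic_integer x -> algebraic_integer y -> algebraic_integer (x - y). Proof. exact: mxpoly.integral_sub. Qed.
Lemma aintM x y : algebraic_integer x -> algebraic_integer y -> algebraic_integer (x * y). Proof. exact: mxpoly.integral_mul. Qed.

Lemma aintX x n : algebraic_integer x -> algebraic_integer (x ^+ n).
Proof.
move=> ax; elim: n => [|n IH]; first by rewrite expr0; exact: aint1.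
by rewrite exprS; apply: aintM.
Qed.

Lemma aint_sum (I : Type) (s : seq I) (P : pred I) (f : I -> C) :
  (forall i, P i -> algebraic_integer (f i)) -> algebraic_integer (\sum_(i <- s | P i) f i).
Proof. by move=> H; apply: big_ind => //; [exact: aint0 | exact: aintD]. Qed.

Lemma aint_prod (I : Type) (s : seq I) (P : pred I) (f : I -> C) :
  (forall i, P i -> algebraic_integer (f i)) -> algebraic_integer (\prod_(i <- s | P i) f i).
Proof. by move=> H; apply: big_ind => //; [exact: aint1 | exact: aintM]. Qed.

(** Transitivity of integrality, for the monic polynomial X^n - x^n. Every later passage from a
    square to its root rests on it. *)
Lemma aint_root x n : (0 < n)%N -> algebraic_integer (x ^+ n) -> algebraic_integer x.
Proof.
move=> n0 ax; apply: (@integral_root_monic _ _ _ x ('X^n - (x ^+ n)%:P)).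
- by rewrite monicXnsubC.
- by rewrite /root !hornerE subrr.
apply/integral_poly => i; rewrite coefB coefXn coefC; apply: aintB.
  exact: aint_nat.
by case: (i == 0)%N; [exact: ax | exact: aint0].
Qed.

Lemma aint_root1 x n : (0 < n)%N -> x ^+ n = 1 -> algebraic_integer x.
Proof. by move=> n0 x1; apply: (aint_root n0); rewrite x1; exact: aint1. Qed.

End AlgebraicIntegers.

(** * Characters of Z/r and quadratic Gauss sums *)

Section Character.
Variables (C : fieldType) (r : nat) (tau : C).
Hypothesis r_gt1 : (1 < r)%N.
Hypothesis tau_prim : r.-primitive_root tau.

Definition chi (x : 'Z_r) : C := tau ^+ x.

Lemma chi0 : chi 0 = 1. Proof. by []. Qed.

Lemma chi_nat n : chi n%:R = tau ^+ n.
Proof. by rewrite /chi val_Zp_nat // (prim_expr_mod tau_prim). Qed.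

Lemma chiD x y : chi (x + y) = chi x * chi y.
Proof.
by rewrite -[x]natr_Zp -[y]natr_Zp -natrD !chi_nat exprD.
Qed.

Lemma chi_unit x : chi x != 0.
Proof.
apply/eqP => e; have := chiD x (- x); rewrite subrr e mul0r chi0 => /eqP.
by rewrite oner_eq0.
Qed.

Lemma chiN x : chi (- x) = (chi x)^-1.
Proof. by apply: (mulfI (chi_unit x)); rewrite -chiD subrr divff ?chi_unit. Qed.

Lemma chiX x n : chi x ^+ n = chi (n%:R * x).
Proof.
elim: n => [|n IH]; first by rewrite mul0r.
by rewrite exprS IH -chiD -natr1 mulrDl mul1r addrC.
Qed.

Lemma chi_eq1 x : (chi x == 1) = (x == 0).
Proof.
apply/idP/eqP => [|->]; last by rewrite chi0.
rewrite /chi -(prim_order_dvd tau_prim) => rx.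
have xr : (x < r)%N by apply: leq_trans (ltn_ord x) _; rewrite Zp_cast.
apply: val_inj => /=; apply/eqP; move: rx; rewrite /dvdn modn_small //.
Qed.

Lemma aint_chi x : algebraic_integer (chi x).
Proof.
apply: (@aint_root1 _ _ r); first exact: ltnW.
by rewrite chiX pchar_Zp // mul0r.
Qed.

(** Translating by v multiplies the sum by [chi (phi v)], which differs from 1 as soon as [phi v] is
    nonzero because tau is primitive. *)
Lemma sum_chi_subgroup (V : finZmodType) (K : pred V) (phi : V -> 'Z_r) :
  K 0 -> (forall u v, K v -> K (u + v) = K u) ->
  (forall u v, K u -> K v -> phi (u + v) = phi u + phi v) ->
  \sum_(u | K u) chi (phi u) =
  if [forall u, K u ==> (phi u == 0)] then #|K|%:R else 0.
Proof.
move=> K0 KD phiD; case: ifP => [/forallP H|/negbT].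
  rewrite (eq_bigr (fun=> 1)) ?sumr_const // => u Ku.
  by have := H u; rewrite Ku => /eqP ->.
rewrite negb_forall => /existsP [v]; rewrite negb_imply => /andP[Kv nz].
set S := \sum_(u | _) _.
have e : S = S * chi (phi v).
  rewrite {1}/S (reindex_inj (addIr v)) /= mulr_suml.
  by apply: eq_big => [u|u]; rewrite KD // => Ku; rewrite phiD // chiD.
apply/eqP; have : S * (1 - chi (phi v)) == 0 by rewrite mulrBr mulr1 {1}e subrr.
by rewrite mulf_eq0 subr_eq0 [1 == _]eq_sym chi_eq1 (negbTE nz) orbF.
Qed.


Section GaussSum.
Variables (l : nat).
Local Notation V := 'rV['Z_r]_l.
Implicit Types (Q : 'M['Z_r]_l) (b u v k : V).

Definition dot u v : 'Z_r := (u *m v^T) 0 0.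

Lemma dotC u v : dot u v = dot v u.
Proof. by rewrite /dot -[in LHS](trmxK u) -trmx_mul mxE. Qed.

Lemma dotDl u v k : dot (u + v) k = dot u k + dot v k.
Proof. by rewrite /dot mulmxDl mxE. Qed.

Lemma dotDr u v k : dot k (u + v) = dot k u + dot k v.
Proof. by rewrite dotC dotDl !(dotC k). Qed.

Lemma dotZl a u v : dot (a *: u) v = a * dot u v.
Proof. by rewrite /dot -scalemxAl mxE. Qed.

Lemma dotZr a u v : dot u (a *: v) = a * dot u v.
Proof. by rewrite dotC dotZl dotC. Qed.

Lemma dotNl u v : dot (- u) v = - dot u v.
Proof. by rewrite -scaleN1r dotZl mulN1r. Qed.

Lemma dotNr u v : dot u (- v) = - dot u v.
Proof. by rewrite dotC dotNl dotC. Qed.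

Lemma dot_sym Q u v : Q^T = Q -> dot (u *m Q) v = dot (v *m Q) u.
Proof. by move=> sQ; rewrite dotC {1}/dot trmx_mul sQ mulmxA. Qed.

Lemma sum_chi_dot u :
  \sum_k chi (dot u k) = if u == 0 then (r ^ l)%:R else 0.
Proof.
rewrite (@sum_chi_subgroup V predT (dot u)) //; last by move=> *; exact: dotDr.
case: ifP => [/forallP H|/negbT]; last first.
  rewrite negb_forall => /existsP [k]; rewrite negb_imply /= => nz.
  by case: eqP => // u0; rewrite u0 /dot mul0mx mxE eqxx in nz.
have -> : u = 0.
  apply/rowP => i; have /= /eqP := H (delta_mx 0 i).
  by rewrite dotC /dot -rowE !mxE.
by rewrite eqxx cardT -cardE card_mx card_ord mul1n Zp_cast.
Qed.

(** The linear term is doubled so that completing the square takes no halving: one shifts by u with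
    u Q = b. *)
Definition quad Q b k : 'Z_r := dot (k *m Q) k + 2 * dot b k.

Definition gauss_sum Q b : C := \sum_k chi (quad Q b k).

Definition kerQ Q : pred V := fun u => u *m Q == 0.

Hypothesis odd_r : odd r.

Lemma unit2 : (2 : 'Z_r) \is a GRing.unit.
Proof. by rewrite unitZpE // coprimen2. Qed.

Lemma scale2_eq0 u : (2 *: u == 0) = (u == 0).
Proof.
apply/eqP/eqP => [e|->]; last by rewrite scaler0.
by rewrite -[u]scale1r -(mulVr unit2) -scalerA e scaler0.
Qed.

(** After the substitution k = k' + u the terms quadratic in k' cancel, and orthogonality in k'
    selects the u with u Q = -(b + b'). *)
Lemma gauss_sumM Q b b' : Q^T = Q ->
  gauss_sum Q b * gauss_sum (- Q) b' = (r ^ l)%:R *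
    \sum_(u | u *m Q == - (b + b')) chi (dot (b - b') u).
Proof.
move=> sQ; rewrite /gauss_sum mulr_suml.
under eq_bigr do rewrite mulr_sumr.
rewrite exchange_big /=.
rewrite (eq_bigr (fun k' => \sum_u chi (quad Q b (k' + u)) * chi (quad (- Q) b' k'))); last first.
  by move=> k' _; rewrite (reindex_inj (addrI k')).
rewrite exchange_big /= mulr_sumr big_mkcond [RHS]big_mkcond /=; apply: eq_bigr => u _.
have E k' : chi (quad Q b (k' + u)) * chi (quad (- Q) b' k') =
   chi (quad Q b u) * chi (dot (2 *: (u *m Q + (b + b'))) k').
  rewrite -!chiD; congr chi; rewrite /quad mulmxN mulmxDl !(dotDl, dotDr, dotNl, dotZl).
  rewrite (dot_sym k' u sQ); ring.
under eq_bigr do rewrite E.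
rewrite -mulr_sumr sum_chi_dot scale2_eq0 addr_eq0.
case: eqP => [e|_]; last by rewrite mulr0.
rewrite mulrC; congr (_ * chi _); rewrite /quad e !(dotDl, dotDr, dotNl, dotZl); ring.
Qed.

(** The u selected in [gauss_sumM] form the empty set or a coset of the kernel, so the character sum
    is 0 or a root of unity times the order of the kernel. *)
Lemma aint_gauss_sumM Q b b' : Q^T = Q ->
  algebraic_integer (gauss_sum Q b * gauss_sum (- Q) b' / ((r ^ l)%:R * #|kerQ Q|%:R)).
Proof.
move=> sQ; rewrite gauss_sumM //.
have [u0 /eqP e0|no] := pickP (fun u => u *m Q == - (b + b')); last first.
  by rewrite big_pred0 // mulr0 mul0r; exact: aint0.
rewrite (reindex_inj (addIr u0)) /=.
rewrite (eq_big (kerQ Q) (fun u => chi (dot (b - b') u) * chi (dot (b - b') u0))); last first.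
- by move=> u _; rewrite dotDr chiD.
- by move=> u; rewrite mulmxDl e0 -subr_eq0 opprK /kerQ addrNK.
rewrite -mulr_suml (@sum_chi_subgroup V (kerQ Q) (dot (b - b'))); first last.
- by move=> *; exact: dotDr.
- by move=> u v /eqP kv; rewrite /kerQ mulmxDl kv addr0.
- by rewrite /kerQ mul0mx.
(* If a factor of the denominator vanishes in C, the quotient is 0 by the convention on inverses. *)
have [rl0|rl0] := eqVneq ((r ^ l)%:R : C) 0.
  by rewrite rl0 !mul0r; exact: aint0.
have [kk0|kk0] := eqVneq (#|kerQ Q|%:R : C) 0.
  by rewrite kk0 mulr0 invr0 mulr0; exact: aint0.
case: ifP => _; last by rewrite mul0r mulr0 mul0r; exact: aint0.
rewrite mulrA mulrAC divff ?mulf_neq0 // mul1r; exact: aint_chi.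
Qed.

(* With u^2 + v^2 = -1, the substitution (k, k') -> (u k + v k', u k' - v k)
   turns Q + Q into - Q - Q. *)
Lemma gauss_sum_sqr Q b : exists b1 b2,
  gauss_sum Q b ^+ 2 = gauss_sum (- Q) b1 * gauss_sum (- Q) b2.
Proof.
have [u [v uv]] : exists u v : 'Z_r, u * u + v * v = -1.
  have [u [v /dvdz_ex [m um]]] := sum_two_squares_mod odd_r.
  exists u%:~R, v%:~R; apply/eqP; rewrite -subr_eq0 opprK; apply/eqP.
  have : (u ^+ 2 + v ^+ 2 + 1)%:~R = 0 :> 'Z_r.
    by rewrite um rmorphM /= -pmulrn pchar_Zp // mulr0.
  by rewrite !rmorphD /= !rmorphXn rmorph1 /= !expr2.
exists ((u - v) *: b), ((u + v) *: b).
rewrite expr2 /gauss_sum !mulr_suml.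
under eq_bigr do rewrite mulr_sumr.
under [RHS]eq_bigr do rewrite mulr_sumr.
rewrite !pair_bigA /=.
have bij : bijective (fun p : V * V => (u *: p.1 + v *: p.2, u *: p.2 - v *: p.1)).
  exists (fun p : V * V => (v *: p.2 - u *: p.1, - u *: p.2 - v *: p.1)) => [[k k']|[k k']] /=.
    by congr (_, _); apply/rowP => i; rewrite !mxE;
      [transitivity (- (u * u + v * v) * k 0 i) | transitivity (- (u * u + v * v) * k' 0 i)];
      by [ring | rewrite uv opprK mul1r].
  by congr (_, _); apply/rowP => i; rewrite !mxE;
      [transitivity (- (u * u + v * v) * k 0 i) | transitivity (- (u * u + v * v) * k' 0 i)];
      by [ring | rewrite uv opprK mul1r].
rewrite (reindex _ (onW_bij _ bij)) /=; apply: eq_bigr => -[k k'] _ /=.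
rewrite -!chiD; congr chi.
rewrite /quad !mulmxN !mulmxDl ?mulNmx -!scalemxAl !(dotDl, dotDr, dotNl, dotNr, dotZl, dotZr).
transitivity ((u * u + v * v) * (dot (k *m Q) k + dot (k' *m Q) k') + 2 * ((u - v) * dot b k) + 2 * ((u + v) * dot b k')); first by ring.
by rewrite uv; ring.
Qed.

(** With M the denominator and z the sum, [gauss_sum_sqr] writes (z^2 / M)^2 as (z z1 / M) (z z2 /
    M), where z1 and z2 belong to -Q. *)
Lemma aint_gauss_sum Q b : Q^T = Q ->
  algebraic_integer (gauss_sum Q b ^+ 2 / ((r ^ l)%:R * #|kerQ Q|%:R)).
Proof.
move=> sQ; apply: (@aint_root _ _ 2) => //.
have [b1 [b2 e]] := gauss_sum_sqr Q b.
rewrite expr_div_n -exprM (_ : 2 * 2 = 2 + 2)%N // exprD {2}e.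
rewrite (_ : _ / _ = (gauss_sum Q b * gauss_sum (- Q) b1 / ((r ^ l)%:R * #|kerQ Q|%:R)) *
  (gauss_sum Q b * gauss_sum (- Q) b2 / ((r ^ l)%:R * #|kerQ Q|%:R))).
  by apply: aintM; exact: aint_gauss_sumM.
by move: (_ * #|_|%:R) => M; rewrite !expr2 [(M * M)^-1]invfM; ring.
Qed.

Lemma gauss_sum_shift Q b u : Q^T = Q -> u *m Q = b ->
  gauss_sum Q b = chi (- dot b u) * gauss_sum Q 0.
Proof.
move=> sQ e; rewrite /gauss_sum mulr_sumr (reindex_inj (addIr (- u))) /=.
apply: eq_bigr => k _; rewrite -chiD; congr chi.
rewrite /quad !mulmxDl mulNmx e !(dotDl, dotDr, dotNl, dotNr) (dot_sym k u sQ) e.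
by rewrite -[0 in RHS](scale0r b) dotZl; ring.
Qed.

(** An injective endomap of a finite set is onto; this stands in for inverting Q over Z/r. *)
Lemma kerQ_surj Q b : #|kerQ Q| = 1%N -> exists u, u *m Q = b.
Proof.
move=> k1; have inj : injective (fun u : V => u *m Q).
  move=> u v /= e; apply/eqP; rewrite -subr_eq0; apply/eqP.
  have : u - v \in kerQ Q by rewrite unfold_in /kerQ mulmxBl e subrr.
  have : 0 \in kerQ Q by rewrite unfold_in /kerQ mul0mx.
  by move/card_le1P: (eq_leq k1) => H h0; rewrite (H _ h0) => /eqP.
exists (invF inj b); exact: (f_invF inj).
Qed.

End GaussSum.

End Character.

(** d is the order of u; Lagrange. *)
Lemma annihilated_subgroup_card r (V : finZmodType) (K : pred V) u : (0 < r)%N ->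
  (forall v : V, v *+ r = 0) -> K 0 -> (forall v w, K v -> K w -> K (v + w)) ->
  K u -> u != 0 -> exists d, [/\ (1 < d)%N, (d %| r)%N & (d %| #|K|)%N].
Proof.
move=> r0 Vr K0 KD Ku u0.
have gK : group_set [set x | K x].
  apply/group_setP; split; first by rewrite inE.
  by move=> x y; rewrite !inE; apply: KD.
exists #[u]%g; split.
- by rewrite order_gt1.
- by rewrite order_dvdn FinRing.zmodXgE Vr.
- have := @order_dvdG _ (Group gK) u; rewrite inE => /(_ Ku).
  by rewrite cardsE.
Qed.

(** * Divisibility by square roots *)

Section SqrtDivisibility.
Variables (C : fieldType) (M : C).
Implicit Types x y : C.

(* For M != 0: x is a multiple of the square root of M. *)
Definition sqrt_dvd x := algebraic_integer (x ^+ 2 / M).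

Lemma sqrt_dvd0 : sqrt_dvd 0.
Proof. by rewrite /sqrt_dvd expr0n mul0r; exact: aint0. Qed.

Lemma sqrt_dvdM x y : algebraic_integer x -> sqrt_dvd y -> sqrt_dvd (x * y).
Proof. by move=> ax dy; rewrite /sqrt_dvd exprMn -mulrA; apply: aintM => //; exact: aintX. Qed.

(** The mixed term x y / M is integral because its square is the product of x^2 / M and y^2 / M. *)
Lemma sqrt_dvdD x y : sqrt_dvd x -> sqrt_dvd y -> sqrt_dvd (x + y).
Proof.
move=> dx dy; rewrite /sqrt_dvd (_ : _ / M = x ^+ 2 / M + x * y / M * 2%:R + y ^+ 2 / M); last by ring.
have xy : algebraic_integer (x * y / M).
  apply: (@aint_root _ _ 2) => //.
  have -> : (x * y / M) ^+ 2 = (x ^+ 2 / M) * (y ^+ 2 / M) by rewrite !exprMn !expr2; ring.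
  exact: aintM.
by apply: aintD => //; apply: aintD => //; apply: aintM; [|exact: aint_nat].
Qed.

Lemma sqrt_dvdN x : sqrt_dvd x -> sqrt_dvd (- x).
Proof. by rewrite /sqrt_dvd sqrrN. Qed.

Lemma sqrt_dvd_sum (I : Type) (s : seq I) (P : pred I) (f : I -> C) :
  (forall i, P i -> sqrt_dvd (f i)) -> sqrt_dvd (\sum_(i <- s | P i) f i).
Proof. by move=> H; apply: big_ind => //; [exact: sqrt_dvd0 | exact: sqrt_dvdD]. Qed.

End SqrtDivisibility.

Lemma sqrt_dvd_mul (C : fieldType) (M N x y : C) :
  sqrt_dvd M x -> sqrt_dvd N y -> sqrt_dvd (M * N) (x * y).
Proof.
move=> dx dy; rewrite /sqrt_dvd exprMn invfM mulrACA; exact: aintM.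
Qed.

(** * Divisibility of Gauss sums by {1} *)

Section Divisibility.
Variables (C : fieldType) (r : nat) (tau : C).
Hypothesis odd_r : odd r.
Hypothesis r_gt1 : (1 < r)%N.
Hypothesis tau_prim : r.-primitive_root tau.
Local Notation chi := (@chi C r tau).
Implicit Types x y : 'Z_r.

(* With sigma = tau^2, this is sigma^x - sigma^-x. *)
Definition qskew x : C := chi (2 * x) - chi (- (2 * x)).

Lemma qskewN x : qskew (- x) = - qskew x.
Proof. by rewrite /qskew mulrN opprK opprB. Qed.

Lemma qskew0 : qskew 0 = 0.
Proof. by rewrite /qskew mulr0 oppr0 subrr. Qed.

Lemma unit4 : (4 : 'Z_r) \is a GRing.unit.
Proof. by rewrite unitZpE // -[4%N]/(2 ^ 2)%N coprimeXr // coprimen2. Qed.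

Lemma qskewE x : qskew x = chi (- (2 * x)) * (chi (4 * x) - 1).
Proof.
rewrite /qskew mulrBr mulr1 -(chiD r_gt1 tau_prim); congr (chi _ - _).
by ring.
Qed.

Lemma qskew_eq0 x : (qskew x == 0) = (x == 0).
Proof.
rewrite qskewE mulf_eq0 (negbTE (chi_unit r_gt1 tau_prim _)) subr_eq0 chi_eq1 //.
apply/eqP/eqP => [e|->]; last by rewrite mulr0.
by apply: (mulrI unit4); rewrite e mulr0.
Qed.

Lemma qskew1_neq0 : qskew 1 != 0.
Proof. by rewrite qskew_eq0 oner_eq0. Qed.

(** Up to a unit {1} is chi(4) - 1. As 4 is invertible mod r, x is a multiple 4j, and chi(4)^j - 1
    is divisible by chi(4) - 1. *)
Lemma aint_chi_sub1 x : algebraic_integer ((chi x - 1) / qskew 1).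
Proof.
have E : qskew 1 = chi (- 2) * (chi 4 - 1) by rewrite qskewE !mulr1.
have nz : chi 4 - 1 != 0 by have := qskew1_neq0; rewrite E mulf_eq0 negb_or => /andP[].
have -> : x = (val (x / 4))%:R * 4 by rewrite natr_Zp divrK ?unit4.
rewrite -chiX // subrX1 E chiN //.
set S := \sum_(_ < _) _; rewrite (_ : _ / _ = chi 2 * S); last first.
  by field; rewrite nz chi_unit.
by apply: aintM; [exact: aint_chi | apply: aint_sum => i _; apply: aintX; exact: aint_chi].
Qed.

Lemma aint_chi_sub x y : algebraic_integer ((chi x - chi y) / qskew 1).
Proof.
have -> : chi x - chi y = chi y * (chi (x - y) - 1).
  by rewrite mulrBr mulr1 -(chiD r_gt1 tau_prim) [y + _]addrC subrK.
by rewrite -mulrA; apply: aintM; [exact: aint_chi | exact: aint_chi_sub1].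
Qed.

(** Evaluation at 1 of (X^d - 1) / (X - 1). *)
Lemma prod_one_sub_unity_root d (w : C) : (0 < d)%N -> d.-primitive_root w ->
  \prod_(1 <= j < d) (1 - w ^+ j) = d%:R.
Proof.
move=> d0 w_prim.
have e : \prod_(1 <= j < d) ('X - (w ^+ j)%:P) = \sum_(i < d) 'X^i :> {poly C}.
  have nz : ('X - 1%:P : {poly C}) != 0 by rewrite polyXsubC_eq0.
  apply: (mulfI nz); rewrite polyC1 -subrX1 -(factor_Xn_sub_1 w_prim).
  by rewrite [RHS]big_ltn // expr0 polyC1.
have := congr1 (fun p : {poly C} => p.[1]) e.
rewrite horner_prod horner_sum.
under eq_bigr do rewrite hornerXsubC.
move=> ->; under eq_bigr do rewrite hornerXn expr1n.
by rewrite sumr_const card_ord.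
Qed.

(* d = prod_(0 < j < d) (1 - w^j) for a primitive d-th root of unity w, and
   this product has at least two factors, as d is odd. *)
Lemma aint_divisor_skew d n : (1 < d)%N -> (d %| r)%N -> (d %| n)%N ->
  algebraic_integer (n%:R / qskew 1 ^+ 2).
Proof.
move=> d1 dr dn.
have w_prim : d.-primitive_root (tau ^+ (r %/ d)) by exact: dvdn_prim_root.
have odd_d : odd d by move: odd_r; rewrite -(divnK dr) oddM => /andP[].
have d2 : (2 < d)%N by case: d d1 odd_d {dr dn w_prim} => [|[|[|]]].
case/dvdnP: dn => m ->; rewrite natrM -mulrA; apply: aintM; first exact: aint_nat.
rewrite -(prod_one_sub_unity_root (ltnW d1) w_prim) big_ltn // big_ltn //.
have key j : algebraic_integer ((1 - (tau ^+ (r %/ d)) ^+ j) / qskew 1).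
  rewrite -exprM -(chi_nat r_gt1 tau_prim).
  exact: (aint_chi_sub 0).
rewrite (_ : _ / _ = ((1 - (tau ^+ (r %/ d)) ^+ 1) / qskew 1) * ((1 - (tau ^+ (r %/ d)) ^+ 2) / qskew 1) *
   \prod_(3 <= i < d) (1 - tau ^+ (r %/ d) ^+ i)); last first.
  by move: qskew1_neq0 => ?; field.
apply: aintM; first by apply: aintM.
by apply: aint_prod => j _; apply: aintB; [exact: aint1|]; rewrite -exprM -(chi_nat r_gt1 tau_prim); exact: aint_chi.
Qed.

Variable l : nat.
Local Notation gauss_sum := (@gauss_sum C r tau l).
Implicit Types (Q : 'M['Z_r]_l) (b u : 'rV['Z_r]_l).

Hypothesis char0 : forall n, (n.+1%:R : C) != 0.

Lemma natr_r_neq0 : (r%:R : C) != 0.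
Proof. by case: (r) r_gt1 => // n _; exact: char0. Qed.

Lemma kerQ_card_gt0 Q : (0 < #|kerQ Q|)%N.
Proof. by apply/card_gt0P; exists 0; rewrite unfold_in /kerQ mul0mx. Qed.

Lemma kerQ_card_neq0 Q : (#|kerQ Q|%:R : C) != 0.
Proof. by rewrite -(prednK (kerQ_card_gt0 Q)); exact: char0. Qed.

Lemma kerQ_nontrivial Q u : u *m Q = 0 -> u != 0 ->
  exists d, [/\ (1 < d)%N, (d %| r)%N & (d %| #|kerQ Q|)%N].
Proof.
move=> uQ u0; apply: (@annihilated_subgroup_card r 'rV['Z_r]_l (kerQ Q) u) => //.
- exact: ltnW.
- by move=> v; rewrite -scaler_nat pchar_Zp // scale0r.
- by rewrite /kerQ mul0mx.
- by move=> v w /eqP kv /eqP kw; rewrite /kerQ mulmxDl kv kw addr0.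
- by rewrite /kerQ uQ.
Qed.

Lemma gauss_sum_sqrt_dvd Q b : Q^T = Q -> sqrt_dvd (r ^ l)%:R (gauss_sum Q b).
Proof.
move=> sQ; have := aintM (aint_gauss_sum r_gt1 tau_prim odd_r b sQ) (aint_nat C #|kerQ Q|).
by rewrite invfM -!mulrA mulVf ?mulr1 ?kerQ_card_neq0 // /sqrt_dvd expr2 -mulrA.
Qed.

Lemma degenerate_gauss_sum Q b u : Q^T = Q -> u *m Q = 0 -> u != 0 ->
  sqrt_dvd ((r ^ l)%:R * qskew 1 ^+ 2) (gauss_sum Q b).
Proof.
move=> sQ uQ u0; have [d [d1 dr dK]] := kerQ_nontrivial uQ u0.
have := aintM (aint_gauss_sum r_gt1 tau_prim odd_r b sQ) (aint_divisor_skew d1 dr dK).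
rewrite /sqrt_dvd (_ : _ * _ = gauss_sum Q b ^+ 2 / ((r ^ l)%:R * qskew 1 ^+ 2)) //.
move: (kerQ_card_neq0 Q) (gauss_sum Q b ^+ 2) => K0 z; move: (#|_|%:R) K0 => K K0.
have -> : z / ((r ^ l)%:R * K) * (K / qskew 1 ^+ 2) = z / (r ^ l)%:R / qskew 1 ^+ 2 * (K / K).
  by rewrite invfM; ring.
by rewrite divff // mulr1 [(_%:R * _)^-1]invfM mulrA.
Qed.

Lemma gauss_sum_sub Q b b' : Q^T = Q ->
  sqrt_dvd ((r ^ l)%:R * qskew 1 ^+ 2) (gauss_sum Q b - gauss_sum Q b').
Proof.
move=> sQ; have [k1|k1] := eqVneq #|kerQ Q| 1%N.
  have [u e] := kerQ_surj b k1; have [u' e'] := kerQ_surj b' k1.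
  rewrite (gauss_sum_shift r_gt1 tau_prim sQ e) (gauss_sum_shift r_gt1 tau_prim sQ e').
  rewrite -mulrBl [(_ - _) * _]mulrC; apply: sqrt_dvd_mul; first exact: gauss_sum_sqrt_dvd.
  by rewrite /sqrt_dvd -expr_div_n; apply: aintX; exact: aint_chi_sub.
have : (1 < #|kerQ Q|)%N by have := kerQ_card_gt0 Q; case: #|_| k1 => [|[|]].
case/card_gt1P => u [v [uK vK uv]].
have uvQ : (u - v) *m Q = 0.
  by apply/eqP; rewrite mulmxBl subr_eq0; move: uK vK; rewrite !unfold_in => /eqP-> /eqP->.
have uv0 : u - v != 0 by rewrite subr_eq0.
by apply: sqrt_dvdD; [|apply: sqrt_dvdN]; exact: (degenerate_gauss_sum _ sQ uvQ uv0).
Qed.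

End Divisibility.

(** * Integrality of the Kirby sum *)

(** Numerator and denominator of [cont_frac ms], an infinite value having denominator 0. The
    numerator is the determinant of the tridiagonal matrix of the arm. *)
Fixpoint continuant (ms : seq int) : int * int :=
  if ms is m :: ms' then
    let: (a, b) := continuant ms' in (m * a - b, a)
  else (1, 0).

(** * Arms as quadratic forms over Z/r *)

Section Arms.
Variables (C : fieldType) (r : nat) (tau : C).
Hypothesis odd_r : odd r.
Hypothesis r_gt1 : (1 < r)%N.
Hypothesis tau_prim : r.-primitive_root tau.
Hypothesis char0 : forall n, (n.+1%:R : C) != 0.
Local Notation chi := (@chi C r tau).
Local Notation qskew := (@qskew C r tau).
Implicit Types (ms : seq int) (x y a : 'Z_r).

Lemma sum_row_mx m n (f : 'rV['Z_r]_(m + n) -> C) :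
  \sum_k f k = \sum_k1 \sum_k2 f (row_mx k1 k2).
Proof.
rewrite pair_bigA /= (reindex (fun p : 'rV_m * 'rV_n => row_mx p.1 p.2)) //.
exists (fun k => (lsubmx k, rsubmx k)) => [[k1 k2] _|k _] /=.
  by rewrite row_mxKl row_mxKr.
exact: hsubmxK.
Qed.

Lemma sum_scalar_mx (f : 'rV['Z_r]_1 -> C) : \sum_k f k = \sum_a f a%:M.
Proof.
rewrite (reindex (fun a : 'Z_r => a%:M : 'rV['Z_r]_1)) //.
exists (fun k : 'rV_1 => k 0 0) => [a _|k _]; first by rewrite mxE eqxx mulr1n.
by rewrite -mx11_scalar.
Qed.

Lemma dot_row_mx m n (u1 v1 : 'rV['Z_r]_m) (u2 v2 : 'rV['Z_r]_n) :
  dot (row_mx u1 u2) (row_mx v1 v2) = dot u1 v1 + dot u2 v2.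
Proof. by rewrite /dot tr_row_mx mul_row_col mxE. Qed.

Lemma quad_block m n (A : 'M['Z_r]_m) (B : 'M['Z_r]_(m, n)) (D : 'M['Z_r]_n) b1 b2 k1 k2 :
  quad (block_mx A B B^T D) (row_mx b1 b2) (row_mx k1 k2) =
  quad A b1 k1 + quad D b2 k2 + 2 * dot (k1 *m B) k2.
Proof.
rewrite /quad mul_row_block !dot_row_mx !dotDl.
have -> : dot (k2 *m B^T) k1 = dot (k1 *m B) k2.
  by rewrite dotC /dot trmx_mul trmxK mulmxA.
ring.
Qed.

(** The basis vector of the vertex next to the centre; [arm_f] is that of the free end. *)
Fixpoint arm_e ms : 'rV['Z_r]_(size ms) :=
  if ms is _ :: ms' then row_mx (1%:M : 'M['Z_r]_1) (0 : 'rV['Z_r]_(size ms')) else 0.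

Fixpoint arm_mx ms : 'M['Z_r]_(size ms) :=
  if ms is m :: ms' then
    block_mx ((m%:~R)%:M : 'M['Z_r]_1) (arm_e ms') (arm_e ms')^T (arm_mx ms')
  else 0.

(* The free end of an empty arm is the centre itself, whence a term 2xy. *)
Definition arm_c ms : 'Z_r := (nilp ms)%:R.

Fixpoint arm_f ms : 'rV['Z_r]_(size ms) :=
  if ms is _ :: ms' then row_mx ((arm_c ms')%:M : 'M['Z_r]_1) (arm_f ms') else 0.

(** Signed continuants, solving all equations of the chain but the first. *)
Fixpoint arm_w ms : 'rV['Z_r]_(size ms) :=
  if ms is _ :: ms' then
    row_mx (((continuant ms').1%:~R)%:M : 'M['Z_r]_1) (- arm_w ms')
  else 0.

Lemma arm_mx_sym ms : (arm_mx ms)^T = arm_mx ms.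
Proof.
elim: ms => [|m ms IH]; first exact: trmx0.
have := tr_block_mx ((m%:~R)%:M : 'M['Z_r]_1) (arm_e ms) (arm_e ms)^T (arm_mx ms).
by rewrite tr_scalar_mx trmxK IH.
Qed.

Lemma dot_scalar1 a b : dot (a%:M : 'rV_1) b%:M = a * b.
Proof. by rewrite /dot tr_scalar_mx mul_scalar_mx !mxE eqxx. Qed.

Lemma dot_w_e ms : dot (arm_w ms) (arm_e ms) = (continuant ms).2%:~R.
Proof.
case: ms => [|m ms]; first by rewrite /= /dot mul0mx mxE.
rewrite [LHS](@dot_row_mx 1 (size ms)) dot_scalar1 mulr1 /dot trmx0 mulmx0 mxE addr0 /=.
by case: (continuant ms).
Qed.

(** Since the off-diagonal entries are 1, the equations are solved from the free end without
    division. For a = 0 and a unit numerator the kernel is thus trivial. *)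
Lemma arm_mx_kernel ms (k : 'rV_(size ms)) a : k *m arm_mx ms = a *: arm_e ms ->
  exists j, k = j *: arm_w ms /\ a = j * (continuant ms).1%:~R.
Proof.
elim: ms k a => [|m ms IH] k a.
  by move=> _; exists a; rewrite mulr1; split=> //; apply/rowP => -[].
rewrite -[k](@hsubmxK _ 1 1 (size ms)); move: (lsubmx _) (rsubmx _) => k1 k2.
rewrite [k1]mx11_scalar; move: (k1 0 0) => {k1} b.
have E1 := @mul_row_block _ 1 1 (size ms) 1 (size ms) b%:M k2 (m%:~R)%:M (arm_e ms) (arm_e ms)^T (arm_mx ms).
have E2 := @scale_row_mx _ 1 1 (size ms) a 1%:M 0.
move=> /(etrans (esym E1)) /esym /(etrans (esym E2)) /(@eq_row_mx _ 1 1 (size ms)) [e1 e2].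
have {}e2 : k2 *m arm_mx ms = - b *: arm_e ms.
  by apply/eqP; rewrite scaleNr -addr_eq0 addrC -mul_scalar_mx -e2 scaler0.
have [j [k2E bE]] := IH _ _ e2.
exists (- j); split.
  rewrite [RHS](@scale_row_mx _ 1 1 (size ms)).
  by rewrite scale_scalar_mx mulNr -bE opprK k2E scaleNr scalerN opprK.
have := congr1 (fun A : 'M['Z_r]_1 => A 0 0) e1.
rewrite mul_scalar_mx !scale_scalar_mx mulr1 [LHS]mxE [RHS]mxE [_%:M 0 0]mxE eqxx !mulr1n.
rewrite -/(dot k2 (arm_e ms)) k2E dotZl dot_w_e => ->.
have -> : b = - (j * (continuant ms).1%:~R) by rewrite -bE opprK.
rewrite /=; case: (continuant ms) => P Q /=; rewrite rmorphB rmorphM /=; ring.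
Qed.

(** The chain with two open ends, x coupled to its first vertex and y to its last one, and all
    vertices summed out. *)
Definition chain_kernel ms x y : C :=
  chi (2 * x * y * arm_c ms) * gauss_sum tau (arm_mx ms) (x *: arm_e ms + y *: arm_f ms).

(** [arm_sum] over Z/r, up to powers of {1}. An exponential chi(2xy) can replace {xy}, as the sum
    runs over both signs of y and [chain_sum] is odd. *)
Fixpoint chain_sum ms x : C :=
  if ms is m :: ms' then
    \sum_y chi (2 * x * y + m%:~R * (y ^+ 2 - 1)) * chain_sum ms' y
  else qskew x.

Lemma chain_kernel_nil x y : chain_kernel [::] x y = chi (2 * x * y).
Proof.
rewrite /chain_kernel /gauss_sum mulr1 (big_pred1 (0 : 'rV_0)); last first.
  by move=> k; rewrite /= [k]thinmx0 eqxx.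
by rewrite /quad /dot !mul0mx trmx0 mulmx0 !mxE mulr0 addr0 chi0 mulr1.
Qed.

Lemma chain_kernel_cons m ms x y :
  chain_kernel (m :: ms) x y =
  \sum_a chi (2 * x * a + m%:~R * a ^+ 2) * chain_kernel ms a y.
Proof.
rewrite /chain_kernel /arm_c mulr0 chi0 mul1r /gauss_sum [LHS](@sum_row_mx 1 (size ms)).
rewrite sum_scalar_mx; apply: eq_bigr => a _.
rewrite !mulr_sumr; apply: eq_bigr => k _; rewrite -!(chiD r_gt1 tau_prim); congr chi.
have -> : x *: arm_e (m :: ms) + y *: arm_f (m :: ms) =
   row_mx ((x + y * arm_c ms)%:M : 'M['Z_r]_1) (y *: arm_f ms).
  rewrite [X in X + _](@scale_row_mx _ 1 1 (size ms)) [X in _ + X](@scale_row_mx _ 1 1 (size ms)).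
  by rewrite [LHS](@add_row_mx _ 1 1 (size ms)) scaler0 add0r !scale_scalar_mx mulr1 -raddfD.
rewrite [LHS](@quad_block 1 (size ms)) /quad !dotDl !dotZl.
rewrite !mul_scalar_mx !dotZl !dot_scalar1.
ring.
Qed.

(** The final {x} is chi(2x) - chi(-2x), that is, the open chain closed at 1 minus the one closed at
    -1; the -1 in each m (y^2 - 1) is collected in front. *)
Lemma chain_sumE ms x :
  chain_sum ms x = chi (- \sum_(m <- ms) m%:~R) * (chain_kernel ms x 1 - chain_kernel ms x (-1)).
Proof.
elim: ms x => [|m ms IH] x.
  by rewrite big_nil oppr0 chi0 mul1r !chain_kernel_nil /qskew mulrN !mulr1.
rewrite /= !chain_kernel_cons -sumrB mulr_sumr; apply: eq_bigr => y _.
rewrite IH big_cons -mulrBr !mulrA -!(chiD r_gt1 tau_prim); congr (chi _ * _).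
ring.
Qed.

Lemma chain_kernelN ms x y : chain_kernel ms (- x) (- y) = chain_kernel ms x y.
Proof.
rewrite /chain_kernel /gauss_sum; congr (chi _ * _); first by ring.
rewrite (reindex_inj oppr_inj) /=; apply: eq_bigr => k _; congr chi.
by rewrite /quad !mulNmx !(dotNl, dotNr, dotDl, dotZl, dotDr); ring.
Qed.

Lemma chain_sumN ms x : chain_sum ms (- x) = - chain_sum ms x.
Proof.
rewrite !chain_sumE -(chain_kernelN ms x 1) -(chain_kernelN ms x (-1)) opprK.
by ring.
Qed.

Lemma chain_sum0 ms : chain_sum ms 0 = 0.
Proof.
have := chain_sumN ms 0; rewrite oppr0 => /eqP; rewrite -addr_eq0 -mulr2n -mulr_natr.
by rewrite mulf_eq0 (negbTE (char0 1)) orbF => /eqP.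
Qed.

End Arms.

(** * The Gauss sums of a star *)

Section StarGauss.
Variables (C : fieldType) (r : nat) (tau : C).
Hypothesis odd_r : odd r.
Hypothesis r_gt1 : (1 < r)%N.
Hypothesis tau_prim : r.-primitive_root tau.
Hypothesis char0 : forall n, (n.+1%:R : C) != 0.
Local Notation chi := (@chi C r tau).
Local Notation qskew := (@qskew C r tau).
Local Notation chain_sum := (@chain_sum C r tau).
Local Notation chain_kernel := (@chain_kernel C r tau).
Implicit Types (ms : seq int) (x y a : 'Z_r).

Let chD := chiD r_gt1 tau_prim.
Let chN := chiN r_gt1 tau_prim.

Lemma qskewM b : exists s : seq 'Z_r,
  forall x, qskew (b * x) = qskew x * \sum_(a <- s) chi (2 * a * x).
Proof.
(* The exponents b - 1 - 2i are the weights of a b-dimensional representation, b being taken as a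
   natural number. *)
exists [seq b%:R - 1 - 2 * (val i)%:R | i : 'I_b <- enum 'I_b] => x.
rewrite /qskew big_map big_enum /=.
have -> : chi (2 * (b * x)) = chi (2 * x) ^+ b.
  by rewrite chiX // natr_Zp; congr chi; ring.
have -> : chi (- (2 * (b * x))) = chi (- (2 * x)) ^+ b.
  by rewrite chiX // natr_Zp; congr chi; ring.
rewrite subrXX; congr (_ * _); apply: eq_bigr => i _.
rewrite !chiX // -chD; congr chi.
have -> : (b.-1 - i)%N%:R = b%:R - 1 - (val i)%:R :> 'Z_r.
  rewrite natrB; last by have := ltn_ord i; lia.
  by rewrite -subn1 natrB //; apply: leq_ltn_trans (ltn_ord i).
by rewrite /=; ring.
Qed.

(** A unit numerator makes the form of the arm nondegenerate, so the square can be completed for all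
    x and y at once; the coefficient of the mixed term 2xy is b. *)
Lemma chain_sum_good ms : ((continuant ms).1%:~R : 'Z_r) \is a GRing.unit ->
  exists g al b, [/\ sqrt_dvd (r ^ size ms)%:R g &
    forall x, chain_sum ms x = g * chi (al * x ^+ 2) * qskew (b * x)].
Proof.
move=> uP; have sQ := arm_mx_sym r ms.
have k1 : #|kerQ (arm_mx r ms)| = 1%N.
  apply/eqP; rewrite eqn_leq kerQ_card_gt0 andbT; apply/card_le1_eqP => u v.
  have ker0 w : w \in kerQ (arm_mx r ms) -> w = 0.
    rewrite unfold_in => /eqP e.
    have [|j [-> /esym]] := @arm_mx_kernel r ms w 0; first by rewrite scale0r.
    by move=> j0; rewrite -[j](mulrK uP) j0 mul0r scale0r.
  by move=> /ker0-> /ker0->.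
have [u1 e1] := kerQ_surj (arm_e r ms) k1.
have [u2 e2] := kerQ_surj (arm_f r ms) k1.
set Z := gauss_sum tau (arm_mx r ms) 0.
set al := dot (arm_e r ms) u1; set be := dot (arm_e r ms) u2; set de := dot (arm_f r ms) u2.
have be' : dot (arm_f r ms) u1 = be by rewrite -e2 dot_sym // e1.
have kE x y : chain_kernel ms x y = chi (2 * x * y * (arm_c r ms - be)) * chi (- (al * x ^+ 2) - de * y ^+ 2) * Z.
  have e : (x *: u1 + y *: u2) *m arm_mx r ms = x *: arm_e r ms + y *: arm_f r ms.
    by rewrite mulmxDl -!scalemxAl e1 e2.
  rewrite /chain_kernel (gauss_sum_shift r_gt1 tau_prim sQ e) mulrA -!chD.
  congr (chi _ * _); rewrite !(dotDl, dotDr, dotZl, dotZr) be' -/al -/be -/de; ring.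
exists (chi (- \sum_(m <- ms) m%:~R) * chi (- de) * Z), (- al), (arm_c r ms - be); split.
  by apply: sqrt_dvdM; [apply: aintM; exact: aint_chi | exact: gauss_sum_sqrt_dvd].
move=> x; rewrite chain_sumE // !kE /qskew; set c := arm_c r ms - be.
have -> : 2 * x * 1 * c = 2 * (c * x) by ring.
have -> : 2 * x * (-1) * c = - (2 * (c * x)) by ring.
have -> : - al * x ^+ 2 = - (al * x ^+ 2) by ring.
(* Only y = 1 and y = -1 occur, so the term in y^2 is a constant. *)
have E (y : 'Z_r) : y ^+ 2 = 1 -> chi (- (al * x ^+ 2) - de * y ^+ 2) = chi (- (al * x ^+ 2)) * chi (- de).
  by move=> ->; rewrite mulr1 chD.
by rewrite !E ?sqrrN ?expr1n //; ring.
Qed.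

(** Each quotient {bx} / {x} is a sum of characters, and such sums are closed under products. This
    fails to make sense at x = 0, which is excluded. *)
Lemma good_arms (good : seq (seq int)) :
  (forall ms, ms \in good -> ((continuant ms).1%:~R : 'Z_r) \is a GRing.unit) ->
  exists g al (s : seq 'Z_r), sqrt_dvd (r ^ size (flatten good))%:R g /\
    forall x, x != 0 -> \prod_(ms <- good) (chain_sum ms x / qskew x) =
      g * chi (al * x ^+ 2) * \sum_(a <- s) chi (2 * a * x).
Proof.
elim: good => [|ms good IH] H.
  exists 1, 0, [:: 0]; split; first by rewrite /sqrt_dvd expr1n divr1; exact: aint1.
  by move=> x _; rewrite big_nil big_seq1 mulr0 !mul0r !chi0 !mulr1.
have [|g [al [s [dg gE]]]] := IH; first by move=> ms' hs; apply: H; rewrite inE hs orbT.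
have [g' [al' [b [dg' gE']]]] := chain_sum_good (H ms (mem_head _ _)).
have [s' sE] := qskewM b.
exists (g' * g), (al' + al), [seq a + a' | a <- s', a' <- s]; split.
  by rewrite /= size_cat expnD natrM; exact: sqrt_dvd_mul.
move=> x x0; rewrite big_cons gE // gE' sE big_allpairs_dep /=.
have q0 : qskew x != 0 by rewrite qskew_eq0.
have -> : chi ((al' + al) * x ^+ 2) = chi (al' * x ^+ 2) * chi (al * x ^+ 2).
  by rewrite mulrDl chD.
have -> : \sum_(i <- s') \sum_(j <- s) chi (2 * (i + j) * x) =
   (\sum_(a <- s') chi (2 * a * x)) * \sum_(a <- s) chi (2 * a * x).
  rewrite mulr_suml; apply: eq_bigr => a _; rewrite mulr_sumr; apply: eq_bigr => a' _.
  by rewrite -chD; congr chi; ring.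
by field.
Qed.

(** The form on the centre and the two exceptional arms; M is the coefficient of x^2 left by the
    good arms. *)
Definition star_mx ms1 ms2 (M : 'Z_r) : 'M['Z_r]_(1 + (size ms1 + size ms2)) :=
  block_mx (M%:M : 'M['Z_r]_1) (row_mx (arm_e r ms1) (arm_e r ms2))
    (row_mx (arm_e r ms1) (arm_e r ms2))^T
    (block_mx (arm_mx r ms1) 0 0^T (arm_mx r ms2)).

Lemma star_mx_sym ms1 ms2 M : (star_mx ms1 ms2 M)^T = star_mx ms1 ms2 M.
Proof.
by rewrite /star_mx !tr_block_mx trmxK tr_scalar_mx !arm_mx_sym !trmx0.
Qed.

Lemma star_gauss_sum ms1 ms2 (M a y1 y2 : 'Z_r) : exists b,
  \sum_x chi (M * x ^+ 2 + 2 * a * x) * chain_kernel ms1 x y1 * chain_kernel ms2 x y2 =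
  gauss_sum tau (star_mx ms1 ms2 M) b.
Proof.
exists (row_mx (a + arm_c r ms1 * y1 + arm_c r ms2 * y2)%:M
  (row_mx (y1 *: arm_f r ms1) (y2 *: arm_f r ms2))).
rewrite /gauss_sum sum_row_mx sum_scalar_mx; apply: eq_bigr => x _.
rewrite sum_row_mx exchange_big /chain_kernel /gauss_sum /= !mulr_sumr.
apply: eq_bigr => k2 _; rewrite mulr_suml; apply: eq_bigr => k1 _.
rewrite -!chD; congr chi.
rewrite /star_mx !quad_block /quad !mulmx0 !mul_scalar_mx !dotZl dot_row_mx.
rewrite !dot_scalar1 !dotDl !dotZl (_ : dot 0 k2 = 0); last by rewrite /dot mul0mx mxE.
ring.
Qed.

Lemma star_sum_sqrt_dvd ms1 ms2 (good : seq (seq int)) :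
  (forall ms, ms \in good -> ((continuant ms).1%:~R : 'Z_r) \is a GRing.unit) ->
  sqrt_dvd ((r ^ (size (flatten (ms1 :: ms2 :: good))).+1)%:R * qskew 1 ^+ 2)
    ((\sum_(x | x != 0) chain_sum ms1 x * chain_sum ms2 x *
        \prod_(ms <- good) (chain_sum ms x / qskew x)) / 2).
Proof.
move=> H; have [g [al [s [dg gE]]]] := good_arms H.
pose E x : C := g * chi (al * x ^+ 2) * \sum_(a <- s) chi (2 * a * x).
pose O x := E x * chain_sum ms2 x.
(* [E] equals the product over the good arms only for x != 0; at 0 the value of [O] is 0 because of
   [chain_sum]. *)
have ON x : O (- x) = - O x.
  have [->|x0] := eqVneq x 0; first by rewrite oppr0 /O chain_sum0 // mulr0 oppr0.
  rewrite /O chain_sumN // mulrN /E -!gE ?oppr_eq0 //; congr (- (_ * _)).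
  by apply: eq_bigr => ms _; rewrite chain_sumN // qskewN // invrN mulrNN.
set T := \sum_(x | _) _.
have TE : T = \sum_x O x * chain_sum ms1 x.
  rewrite /T [RHS](bigD1 0) //= chain_sum0 // mulr0 add0r; apply: eq_bigr => x x0.
  by rewrite gE // /O /E; ring.
have two0 : (2%:R : C) != 0 by exact: char0.
(* By oddness of [O], the boundary values 1 and -1 of the first arm contribute equally, which
   removes the division by 2. *)
have T2 : T / 2 = chi (- \sum_(m <- ms1) m%:~R) * \sum_x O x * chain_kernel ms1 x 1.
  rewrite TE; under eq_bigr do rewrite chain_sumE // mulrCA mulrBr.
  rewrite -mulr_sumr sumrB -[RHS]mulr1 -mulrA -[RHS]mulrA; congr (_ * _).
  rewrite [X in _ - X](reindex_inj oppr_inj) /=.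
  under [X in _ - X]eq_bigr do rewrite ON chain_kernelN // mulNr.
  by rewrite sumrN opprK -mulr2n -[X in X / _]mulr_natr mulfK // mulr1.
pose G a y := \sum_x chi (al * x ^+ 2 + 2 * a * x) * chain_kernel ms1 x 1 * chain_kernel ms2 x y.
have -> : T / 2 = chi (- \sum_(m <- ms1) m%:~R) * chi (- \sum_(m <- ms2) m%:~R) *
    (g * \sum_(a <- s) (G a 1 - G a (-1))).
  rewrite T2 -mulrA; congr (_ * _).
  have -> : \sum_(a <- s) (G a 1 - G a (-1)) = \sum_x \sum_(a <- s)
      chi (al * x ^+ 2 + 2 * a * x) * chain_kernel ms1 x 1 * (chain_kernel ms2 x 1 - chain_kernel ms2 x (-1)).
    rewrite exchange_big /=; apply: eq_bigr => a _; rewrite /G -sumrB.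
    by apply: eq_bigr => x _; rewrite mulrBr.
  rewrite 2!mulr_sumr; apply: eq_bigr => x _.
  rewrite /O /E chain_sumE // !mulr_sumr !mulr_suml; apply: eq_bigr => a _.
  by rewrite chD; ring.
apply: sqrt_dvdM; first by apply: aintM; exact: aint_chi.
have -> : (r ^ (size (flatten [:: ms1, ms2 & good])).+1)%:R * qskew 1 ^+ 2 =
    (r ^ size (flatten good))%:R *
    ((r ^ (1 + (size ms1 + size ms2)))%:R * qskew 1 ^+ 2).
  rewrite mulrA -natrM -expnD; congr ((r ^ _)%:R * _).
  by rewrite /= !size_cat; lia.
apply: sqrt_dvd_mul => //; apply: sqrt_dvd_sum => a _; rewrite /G.
have [b1 ->] := star_gauss_sum ms1 ms2 al a 1 1.
have [b2 ->] := star_gauss_sum ms1 ms2 al a 1 (-1).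
by apply: gauss_sum_sub => //; exact: star_mx_sym.
Qed.

End StarGauss.

(** * From colors to residues mod r *)

Section KirbySum.
Variables (C : fieldType) (r : nat) (t tau : C).
Hypothesis odd_r : odd r.
Hypothesis r_gt1 : (1 < r)%N.
Hypothesis tau_prim : r.-primitive_root tau.
Hypothesis t4 : t ^+ 4 = tau ^+ 4.
Hypothesis char0 : forall n, (n.+1%:R : C) != 0.
Local Notation s := (t ^+ 2).
Local Notation chi := (@chi C r tau).
Local Notation qskew := (@qskew C r tau).
Local Notation chain_sum := (@chain_sum C r tau).
Implicit Types (ms : seq int) (x y a : 'Z_r).

Let chD := chiD r_gt1 tau_prim.
Let chN := chiN r_gt1 tau_prim.

Lemma chi_int (z : int) : chi z%:~R = tau ^ z.
Proof.
case: z => n; first exact: chi_nat.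
by rewrite NegzE rmorphN /= chN -exprnN; congr (_^-1); exact: chi_nat.
Qed.

Lemma odd_sqr_sub1 k : odd k -> exists u : int, k%:Z ^+ 2 - 1 = 8 * u.
Proof.
move=> ok; exists ('C(k./2.+1, 2))%:Z.
set h := k./2; have -> : k%:Z = 2 * h%:Z + 1.
  by have := odd_double_half k; rewrite ok -/h; lia.
have : (2 * 'C(h.+1, 2) = h.+1 * h)%N.
  by rewrite bin2 /= mul2n; have := odd_double_half (h.+1 * h); rewrite oddM /= andNb.
move=> /(congr1 Posz); rewrite !PoszM => E.
transitivity (4 * (h.+1%:Z * h%:Z)); last by rewrite -E; ring.
by rewrite (_ : h.+1%:Z = h%:Z + 1); [ring | lia].
Qed.

(** For odd k the exponent is a multiple of 8, so only t^4 = tau^4 matters. *)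
Lemma framing_chi m k : odd k ->
  t ^ (m * (k%:Z ^+ 2 - 1)) = chi (m%:~R * (k%:R ^+ 2 - 1)).
Proof.
move=> ok; have [u uE] := odd_sqr_sub1 ok.
have -> : m%:~R * (k%:R ^+ 2 - 1) = (m * (k%:Z ^+ 2 - 1))%:~R :> 'Z_r.
  by rewrite rmorphM rmorphB rmorphXn.
rewrite chi_int uE.
have -> : m * (8 * u) = 4%:Z * (2 * m * u) by ring.
by rewrite -!exprz_exp -!exprnP t4.
Qed.

(** From s^2 = tau^4 one gets s = tau^2 or s = -tau^2, and [k] does not see the sign for odd k. *)
Lemma qint_qskew k : odd k -> qint s k = qskew k%:R / qskew 1.
Proof.
move=> ok; rewrite /qint /qskew mulr1.
have E n : chi (2 * n%:R) = (tau ^+ 2) ^+ n by rewrite -natrM chi_nat // exprM.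
have E1 : chi 2 = tau ^+ 2 by exact: chi_nat.
rewrite !chN E E1.
have /eqP : (tau ^+ 2) ^+ 2 = s ^+ 2 by rewrite -!exprM t4.
rewrite eqf_sqr => /orP[/eqP->//|/eqP->].
by rewrite exprNn -signr_odd ok expr1 mulN1r !invrN -!opprD invrN mulrNN.
Qed.

(** As r is odd, x -> r - x exchanges odd and nonzero even residues. *)
Lemma sum_odd (g : 'Z_r -> C) : (forall x, g (- x) = g x) ->
  \sum_(x | x != 0) g x = 2 * \sum_(k < r | odd k) g k%:R.
Proof.
move=> ge.
have H (P : pred nat) : \sum_(x : 'Z_r | P x) g x = \sum_(k < r | P k) g k%:R.
  transitivity (\sum_(0 <= k < (Zp_trunc r).+2 | P k) g k%:R).
    by rewrite big_mkord; apply: eq_bigr => x _; rewrite natr_Zp.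
  rewrite -(big_mkord P (fun k => g k%:R)).
  by apply: congr_big => //; rewrite Zp_cast.
rewrite (bigID (fun x : 'Z_r => odd x)) /= mulr_natl mulr2n; congr (_ + _).
  by rewrite -H; apply: eq_bigl => x; case: eqP => [->|].
rewrite -H (reindex_inj oppr_inj) /=; apply: eq_big => [x|x _]; last exact: ge.
have xr : (x < r)%N by apply: leq_trans (ltn_ord x) _; rewrite Zp_cast.
rewrite oppr_eq0; have [->//|x0] := eqVneq x 0.
have x_gt0 : (0 < x)%N by rewrite lt0n; apply: contraNneq x0 => e; apply/eqP/val_inj.
have : nat_of_ord (- x) = (r - x)%N.
  have e := Zp_cast r_gt1.
  by rewrite /= modn_small; [congr (_ - _)%N | rewrite ltn_subrL x_gt0].
by move=> /= ->; rewrite oddB ?(ltnW xr) // odd_r /= ?andbT ?negbK.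
Qed.
Lemma arm_sum_chain ms k : odd k ->
  arm_sum r t ms k = chain_sum ms k%:R / qskew 1 ^+ (size ms).+1.
Proof.
elim: ms k => [|m ms IH] k ok /=; first by rewrite qint_qskew // expr1.
pose h y := qskew (k%:R * y) * chi (m%:~R * (y ^+ 2 - 1)) * chain_sum ms y.
have he y : h (- y) = h y.
  by rewrite /h mulrN qskewN // sqrrN chain_sumN // mulrN !mulNr opprK.
have q0 : qskew 1 != 0 by exact: qskew1_neq0.
have two0 : (2 : C) != 0 by exact: (char0 1).
transitivity ((\sum_(k' < r | odd k') h k'%:R) / qskew 1 ^+ (size ms).+2).
  rewrite mulr_suml; apply: eq_bigr => k' ok'.
  rewrite qint_qskew ?oddM ?ok // natrM framing_chi // IH // /h !exprS.
  by field; rewrite q0 expf_neq0.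
congr (_ / _); apply: (mulfI two0); rewrite -sum_odd //.
transitivity (\sum_y h y).
  have h0 : h 0 = 0 by rewrite /h chain_sum0 // mulr0.
  by rewrite [RHS](bigD1 0) //= h0 add0r.
pose h' y := chi (2 * k%:R * y + m%:~R * (y ^+ 2 - 1)) * chain_sum ms y.
(* [h] is [h'] at y plus [h'] at -y, by oddness of [chain_sum]. *)
have -> : \sum_y h y = \sum_y h' y + \sum_y h' y.
  rewrite [X in _ = _ + X](reindex_inj oppr_inj) -big_split /=; apply: eq_bigr => y _.
  rewrite /h /h' /qskew chain_sumN // sqrrN !chD.
  have -> : 2 * k%:R * y = 2 * (k%:R * y) by ring.
  have -> : 2 * k%:R * - y = - (2 * (k%:R * y)) by ring.
  by ring.
by rewrite [RHS]mulr_natl [RHS]mulr2n; congr (_ + _); apply: eq_bigl.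
Qed.

(** Powers of {1} in the denominator: two from [k]^2 and, after division by [k], one per vertex of
    each arm. *)
Lemma kirby_star arms :
  \sum_(k < r | odd k) qint s k ^+ 2 * \prod_(ms <- arms) (arm_sum r t ms k / qint s k) =
  (\sum_(x | x != 0) qskew x ^+ 2 * \prod_(ms <- arms) (chain_sum ms x / qskew x)) / 2
    / qskew 1 ^+ (size (0 :: flatten arms)).+1.
Proof.
have q0 : qskew 1 != 0 by exact: qskew1_neq0.
have two0 : (2 : C) != 0 by exact: (char0 1).
rewrite sum_odd => [|x]; last first.
  rewrite qskewN // sqrrN; congr (_ * _); apply: eq_bigr => ms _.
  by rewrite chain_sumN // invrN mulrNN.
rewrite [X in X / _]mulrAC divff // mul1r mulr_suml; apply: eq_bigr => k ok.
have k0 : (k%:R : 'Z_r) != 0.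
  apply/eqP => /(congr1 (@nat_of_ord _)); rewrite val_Zp_nat // modn_small ?ltn_ord //=.
  by case: (nat_of_ord k) ok.
have qk0 : qskew k%:R != 0 by rewrite qskew_eq0.
rewrite qint_qskew //.
have -> : \prod_(ms <- arms) (arm_sum r t ms k / (qskew k%:R / qskew 1)) =
    (\prod_(ms <- arms) (chain_sum ms k%:R / qskew k%:R)) / qskew 1 ^+ size (flatten arms).
  elim: arms => [|ms arms IH]; first by rewrite !big_nil /= divr1.
  rewrite !big_cons arm_sum_chain // IH /= size_cat exprD exprS.
  by field; rewrite q0 qk0 !expf_neq0.
rewrite /= !exprS; field.
by rewrite q0 expf_neq0.
Qed.

Lemma dot0l n (u : 'rV['Z_r]_n) : dot 0 u = 0.
Proof. by rewrite /dot mul0mx mxE. Qed.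

Definition gauss1 (a : 'Z_r) : C := \sum_x chi (a * x ^+ 2).

Lemma gauss1E a : gauss1 a = gauss_sum tau (a%:M : 'M['Z_r]_1) 0.
Proof.
rewrite /gauss1 /gauss_sum sum_scalar_mx; apply: eq_bigr => x _; congr chi.
rewrite /quad mul_scalar_mx dotZl dot_scalar1.
by rewrite dot0l; ring.
Qed.

Lemma gauss1_sqrt_dvd a : sqrt_dvd r%:R (gauss1 a).
Proof.
rewrite gauss1E -[r in r%:R]expn1; apply: gauss_sum_sqrt_dvd => //.
exact: tr_scalar_mx.
Qed.

Lemma gauss1M : gauss1 1 * gauss1 (-1) = r%:R.
Proof.
rewrite !gauss1E.
have -> : (-1)%:M = - 1%:M :> 'M['Z_r]_1 by rewrite raddfN.
rewrite gauss_sumM ?tr_scalar_mx // expn1 (big_pred1 0) ?subr0.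
  by rewrite dot0l chi0 mulr1.
by move=> u; rewrite /= mulmx1 addr0 oppr0.
Qed.

Lemma gauss1_neq0 : gauss1 1 != 0 /\ gauss1 (-1) != 0.
Proof.
have : gauss1 1 * gauss1 (-1) != 0 by rewrite gauss1M natr_r_neq0.
by rewrite mulf_eq0 negb_or => /andP.
Qed.

Lemma kirby_unknot (e : bool) :
  \sum_(k < r | odd k) qint s k ^+ 2 * t ^ ((-1) ^+ e * (k%:Z ^+ 2 - 1)) =
  - (-1) ^+ e * chi (- (3 * (-1) ^+ e)) * gauss1 ((-1) ^+ e) / qskew 1.
Proof.
have q0 : qskew 1 != 0 by exact: qskew1_neq0.
have two0 : (2 : C) != 0 by exact: (char0 1).
set a : 'Z_r := (-1) ^+ e.
pose h x := qskew x ^+ 2 * chi (a * (x ^+ 2 - 1)).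
transitivity ((\sum_(k < r | odd k) h k%:R) / qskew 1 ^+ 2).
  rewrite mulr_suml; apply: eq_bigr => k ok.
  rewrite qint_qskew // framing_chi // expr_div_n rmorphXn rmorphN1 /h.
  by rewrite mulrAC.
have aa : a * a = 1 by rewrite /a -expr2 -exprM mulnC exprM sqrrN !expr1n.
have H : 2 * \sum_(k < r | odd k) h k%:R = chi (- a) * (2 * (chi (- 4 * a) - 1) * gauss1 a).
  rewrite -sum_odd => [|x]; last by rewrite /h qskewN // !sqrrN.
  transitivity (\sum_x h x).
    by rewrite [RHS](bigD1 0) //= /h qskew0 expr0n mul0r add0r.
  transitivity (chi (- a) * (\sum_x chi (a * x ^+ 2 + 4 * x) + \sum_x chi (a * x ^+ 2 - 4 * x) - \sum_x 2 * chi (a * x ^+ 2))).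
    rewrite -big_split -sumrB mulr_sumr /=; apply: eq_bigr => x _.
    rewrite /h /qskew mulrBr mulr1 !chD !chN.
    have -> : chi (4 * x) = chi (2 * x) ^+ 2 by rewrite chiX //; congr chi; ring.
    by field; rewrite !chi_unit.
  (* Completing the square by x -> x - 2ac, with a^2 = c^2 = 1, leaves the constant 4a - 8a =
     -4a. *)
  have shift c : c * c = 1 -> \sum_x chi (a * x ^+ 2 + 4 * c * x) = chi (- 4 * a) * gauss1 a.
    move=> cc; rewrite /gauss1 mulr_sumr (reindex_inj (addIr (- 2 * a * c))) /=.
    apply: eq_bigr => x _; rewrite -chD; congr chi.
    transitivity (a * x ^+ 2 + 4 * (1 - a * a) * c * x + a * (4 * (a * a) - 8) * (c * c)); first by ring.
    by rewrite aa cc subrr; ring.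
  have -> : \sum_x chi (a * x ^+ 2 + 4 * x) = chi (- 4 * a) * gauss1 a.
    by rewrite -(shift 1) ?mulr1 //; apply: eq_bigr => x _; congr chi; ring.
  have -> : \sum_x chi (a * x ^+ 2 - 4 * x) = chi (- 4 * a) * gauss1 a.
    by rewrite -(shift (-1)) ?mulrNN ?mulr1 //; apply: eq_bigr => x _; congr chi; ring.
  by rewrite -mulr_sumr -/(gauss1 a); ring.
have -> : \sum_(k < r | odd k) h k%:R = chi (- a) * (chi (- 4 * a) - 1) * gauss1 a.
  by apply: (mulfI two0); rewrite H; ring.
(* This is a unit times {1} and cancels one of the two factors {1} in the denominator. *)
have -> : chi (- 4 * a) - 1 = - (-1) ^+ e * chi (- 2 * a) * qskew 1.
  rewrite /qskew mulr1 /a; case: (e) => /=.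
    rewrite expr1 !mulrN1 !opprK mul1r mulrBr -!chD subrr chi0; congr (chi _ - _); ring.
  rewrite expr0 !mulr1 mulN1r mulNr mulrBr opprB -!chD addNr chi0; congr (chi _ - _); ring.
have -> : - (3 * a) = - a + - 2 * a by ring.
by rewrite chD; field.
Qed.

End KirbySum.

Section Integrality.
Variables (C : fieldType) (r : nat) (t tau : C).
Hypothesis odd_r : odd r.
Hypothesis r_gt1 : (1 < r)%N.
Hypothesis tau_prim : r.-primitive_root tau.
Hypothesis t4 : t ^+ 4 = tau ^+ 4.
Hypothesis char0 : forall n, (n.+1%:R : C) != 0.
Local Notation s := (t ^+ 2).
Local Notation chi := (@chi C r tau).
Local Notation qskew := (@qskew C r tau).
Local Notation chain_sum := (@chain_sum C r tau).
Local Notation gauss1 := (@gauss1 C r tau).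

Lemma star_sum_sqrt_dvd_perm arms bad good : perm_eq arms (bad ++ good) ->
  (size bad <= 2)%N ->
  (forall ms, ms \in good -> ((continuant ms).1%:~R : 'Z_r) \is a GRing.unit) ->
  sqrt_dvd ((r ^ (size (0 :: flatten arms)))%:R * qskew 1 ^+ 2)
    ((\sum_(x | x != 0) qskew x ^+ 2 * \prod_(ms <- arms) (chain_sum ms x / qskew x)) / 2).
Proof.
move=> pe sb H.
(* An empty arm contributes the factor qskew x / qskew x. *)
have [ms1 [ms2 [sz E]]] : exists ms1 ms2, size (flatten [:: ms1; ms2]) = size (flatten bad) /\
    forall x, x != 0 -> qskew x ^+ 2 * \prod_(ms <- bad) (chain_sum ms x / qskew x) =
      chain_sum ms1 x * chain_sum ms2 x.
  have q0 x : x != 0 -> qskew x != 0 by rewrite qskew_eq0.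
  case: bad sb {pe} => [|ms1 [|ms2 [|//]]] _.
  - exists [::], [::]; split=> // x x0; by rewrite big_nil mulr1 expr2.
  - exists ms1, [::]; split; first by rewrite /= cats0.
    by move=> x x0; rewrite big_seq1 /=; field; apply: q0.
  - exists ms1, ms2; split=> // x x0.
    by rewrite big_cons big_seq1; field; apply: q0.
have -> : size (0 :: flatten arms) = (size (flatten [:: ms1, ms2 & good])).+1.
  have -> : size (flatten [:: ms1, ms2 & good]) = (size (flatten [:: ms1; ms2]) + size (flatten good))%N.
    by rewrite /= !size_cat addn0 addnA.
  rewrite sz /=; congr _.+1; rewrite !size_flatten /shape (perm_sumn (perm_map size pe)).
  by rewrite map_cat sumn_cat.
have := star_sum_sqrt_dvd odd_r r_gt1 tau_prim char0 ms1 ms2 H.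
rewrite (eq_bigr (fun x => qskew x ^+ 2 * \prod_(ms <- arms) (chain_sum ms x / qskew x))) //.
by move=> x x0; rewrite (perm_big _ pe) big_cat /= mulrA E.
Qed.

(** Since [gauss1 1 * gauss1 (-1)] is r, the quotient is the square of the opposite Gauss sum
    divided by r. *)
Lemma aint_gauss1_inv b : b = 1 \/ b = -1 -> algebraic_integer (r%:R / gauss1 b ^+ 2).
Proof.
have [g1 g2] := gauss1_neq0 odd_r r_gt1 tau_prim char0.
have gM := gauss1M odd_r r_gt1 tau_prim.
have E (u v : C) : u != 0 -> v != 0 -> u * v / u ^+ 2 = v ^+ 2 / (u * v).
  by move=> u0 v0; field; rewrite u0 v0.
case=> ->; first by rewrite -gM E // gM; exact: gauss1_sqrt_dvd.
by rewrite -gM [gauss1 1 * _]mulrC E // [gauss1 (-1) * _]mulrC gM; exact: gauss1_sqrt_dvd.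
Qed.

Definition kirby_arms arms : C :=
  \sum_(k < r | odd k) qint s k ^+ 2 * \prod_(ms <- arms) (arm_sum r t ms k / qint s k).

Definition kirby_sign (e : bool) : C :=
  \sum_(k < r | odd k) qint s k ^+ 2 * t ^ ((-1) ^+ e * (k%:Z ^+ 2 - 1)).

Lemma kirby_sign_inv e : exists w, algebraic_integer w /\
  kirby_sign e != 0 /\ (kirby_sign e)^-1 = w * qskew 1 / gauss1 ((-1) ^+ e).
Proof.
have q0 := qskew1_neq0 odd_r r_gt1 tau_prim.
have [g1 g2] := gauss1_neq0 odd_r r_gt1 tau_prim char0.
have ge : gauss1 ((-1) ^+ e) != 0 by case: e => /=; rewrite ?expr1 ?expr0.
exists (- (-1) ^+ e * chi (3 * (-1) ^+ e)).
rewrite /kirby_sign (kirby_unknot odd_r r_gt1 tau_prim t4 char0 e); split.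
  apply: aintM; last exact: aint_chi.
  by apply: aintN; apply: aintX; apply: aintN; exact: aint1.
have nz : - (-1) ^+ e * chi (- (3 * (-1) ^+ e)) != 0.
  by rewrite mulf_neq0 ?chi_unit // oppr_eq0 signr_eq0.
split; first by rewrite mulf_neq0 ?invr_eq0 // mulf_neq0.
by rewrite !invfM invrK chiN // invrK invrN invr_sign mulrAC.
Qed.

Lemma aint_star arms bad good N b1 b2 : perm_eq arms (bad ++ good) ->
  (size bad <= 2)%N ->
  (forall ms, ms \in good -> ((continuant ms).1%:~R : 'Z_r) \is a GRing.unit) ->
  N = size (0 :: flatten arms) -> (b1 + b2 = N \/ (b1 + b2).+1 = N)%N ->
  algebraic_integer (kirby_arms arms / (kirby_sign false ^+ b1 * kirby_sign true ^+ b2)).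
Proof.
move=> pe sb H NE bN.
have q0 := qskew1_neq0 odd_r r_gt1 tau_prim.
have [g1 g2] := gauss1_neq0 odd_r r_gt1 tau_prim char0.
have r0 := natr_r_neq0 r_gt1 char0.
have := star_sum_sqrt_dvd_perm pe sb H.
rewrite /kirby_arms (kirby_star odd_r r_gt1 tau_prim t4 char0) -NE.
set Y := _ / 2; rewrite /sqrt_dvd => dY.
have [w1 [aw1 [_ e1]]] := kirby_sign_inv false.
have [w2 [aw2 [_ e2]]] := kirby_sign_inv true.
rewrite expr0 in e1; rewrite expr1 in e2.
have i1 := aint_gauss1_inv (or_introl erefl); have i2 := aint_gauss1_inv (or_intror erefl).
rewrite invfM -!exprVn e1 e2.
(* After squaring, each squared Gauss sum in the denominator is replaced by r at the cost of an
   integral factor. *)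
apply: (@aint_root _ _ 2) => //.
have rq := aint_divisor_skew odd_r r_gt1 tau_prim r_gt1 (dvdnn r) (dvdnn r).
move: (gauss1 1) (gauss1 (-1)) (qskew 1) rq g1 g2 q0 i1 i2 dY => g h q rq g0 h0 q0 i1 i2 dY.
rewrite (_ : _ ^+ 2 = (w1 ^+ b1 * w2 ^+ b2) ^+ 2 * (r%:R / g ^+ 2) ^+ b1 * (r%:R / h ^+ 2) ^+ b2 *
   ((Y * q ^+ (b1 + b2) / q ^+ N.+1) ^+ 2 / r%:R ^+ (b1 + b2))); last first.
  rewrite !expr2 !expr_div_n !exprMn !exprD !exprVn.
  by field; rewrite !expf_neq0.
apply: aintM.
  by apply: aintM; [apply: aintM; [apply: aintX; apply: aintM; exact: aintX | exact: aintX] | exact: aintX].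
case: bN => bN.
  rewrite bN ?exprVn [q ^+ N.+1]exprS (_ : _ / _ = Y ^+ 2 / ((r ^ N)%:R * q ^+ 2)) // natrX.
  by field; rewrite ?q0 ?expf_neq0.
(* One sign is missing, so r^(N-1) and two more powers of {1} appear: the surplus is r / {1}^2,
   which is integral. *)
rewrite -bN ?exprVn [q ^+ _.+2]exprS [q ^+ _.+1]exprS (_ : _ / _ = Y ^+ 2 / ((r ^ N)%:R * q ^+ 2) * (r%:R / q ^+ 2)); last first.
  by rewrite -bN natrX [r%:R ^+ _.+1]exprS; field; rewrite ?q0 ?r0 ?expf_neq0.
exact: aintM.
Qed.

End Integrality.

(** * The field generated by a root of unity *)

Section RationalAdjunction.
Variables (C : numFieldType) (zeta : C).
Local Notation QK := (in_Q_adjoin zeta).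
Implicit Types x y : C.

Lemma Qadj_rat (c : rat) : QK (ratr c).
Proof. by exists c%:P; rewrite map_polyC hornerC. Qed.

Lemma Qadj_nat n : QK n%:R.
Proof. by rewrite -(ratr_nat C); exact: Qadj_rat. Qed.

Lemma QadjD x y : QK x -> QK y -> QK (x + y).
Proof. by move=> [g ->] [h ->]; exists (g + h); rewrite rmorphD hornerD. Qed.

Lemma QadjM x y : QK x -> QK y -> QK (x * y).
Proof. by move=> [g ->] [h ->]; exists (g * h); rewrite rmorphM hornerM. Qed.

Lemma QadjN x : QK x -> QK (- x).
Proof. by move=> [g ->]; exists (- g); rewrite rmorphN hornerN. Qed.

Lemma QadjB x y : QK x -> QK y -> QK (x - y).
Proof. by move=> gx gy; apply: QadjD => //; exact: QadjN. Qed.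

Lemma QadjX x n : QK x -> QK (x ^+ n).
Proof.
move=> gx; elim: n => [|n IH]; first exact: (Qadj_nat 1).
by rewrite exprS; exact: QadjM.
Qed.

Lemma Qadj_sum (I : Type) (s : seq I) (P : pred I) (f : I -> C) :
  (forall i, P i -> QK (f i)) -> QK (\sum_(i <- s | P i) f i).
Proof. by move=> H; apply: big_ind => //; [exact: (Qadj_nat 0) | exact: QadjD]. Qed.

Lemma Qadj_prod (I : Type) (s : seq I) (P : pred I) (f : I -> C) :
  (forall i, P i -> QK (f i)) -> QK (\prod_(i <- s | P i) f i).
Proof. by move=> H; apply: big_ind => //; [exact: (Qadj_nat 1) | exact: QadjM]. Qed.

(* For x = g(zeta) nonzero, the part of p prime to g still vanishes at zeta,
   and a Bezout relation between it and g inverts x. *)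
Lemma Qadj_inv (p : {poly rat}) x : p != 0 -> root (map_poly ratr p) zeta ->
  QK x -> QK x^-1.
Proof.
move=> p0 pz [g xE]; have [->|x0] := eqVneq x 0; first by rewrite invr0; exact: (Qadj_nat 0).
have := coprimep_gdco g p0; rewrite coprimep_sym => /Bezout_eq1_coprimepP [[u v] /= uv].
have dz : root (map_poly ratr (gdcop g p)) zeta.
  by rewrite gdcop_map root_gdco ?map_poly_eq0 // pz /root -xE.
exists u; apply: (mulIf x0); rewrite mulVf // xE.
have : (map_poly (ratr : rat -> C) (u * g + v * gdcop g p)).[zeta] = 1.
  by rewrite uv rmorph1 hornerC.
by rewrite rmorphD !rmorphM hornerD !hornerM (rootP dz) mulr0 addr0.
Qed.

End RationalAdjunction.

Section KirbyRational.
Variables (C : numFieldType) (r : nat) (t tau zeta : C).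
Hypothesis odd_r : odd r.
Hypothesis r_gt1 : (1 < r)%N.
Hypothesis tau_prim : r.-primitive_root tau.
Hypothesis t4 : t ^+ 4 = tau ^+ 4.
Hypothesis tauQ : in_Q_adjoin zeta tau.
Hypothesis zeta_r : zeta ^+ r = 1.
Local Notation QK := (in_Q_adjoin zeta).

Lemma num_char0 n : (n.+1%:R : C) != 0.
Proof. by rewrite pnatr_eq0. Qed.

Lemma QadjV x : QK x -> QK x^-1.
Proof.
apply: (@Qadj_inv _ _ ('X^r - 1)).
  by rewrite -size_poly_eq0 size_Xn_sub_1 // ltnW.
by rewrite rmorphB rmorphXn /= map_polyX rmorph1 /root !hornerE ?hornerXn zeta_r subrr.
Qed.

Lemma Qadj_chi x : QK (@chi C r tau x).
Proof. exact: QadjX. Qed.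

Lemma Qadj_qskew x : QK (@qskew C r tau x).
Proof. by apply: QadjB; exact: Qadj_chi. Qed.

Lemma Qadj_chain_sum ms x : QK (@chain_sum C r tau ms x).
Proof.
elim: ms x => [|m ms IH] x; first exact: Qadj_qskew.
by apply: Qadj_sum => y _; apply: QadjM => //; exact: Qadj_chi.
Qed.

Lemma Qadj_kirby_arms arms : QK (kirby_arms r t arms).
Proof.
rewrite /kirby_arms (kirby_star odd_r r_gt1 tau_prim t4 num_char0).
apply: QadjM; last by apply/QadjV/QadjX/Qadj_qskew.
apply: QadjM; last by apply/QadjV/Qadj_nat.
apply: Qadj_sum => x _; apply: QadjM; first exact/QadjX/Qadj_qskew.
by apply: Qadj_prod => ms _; apply: QadjM; [exact: Qadj_chain_sum | exact/QadjV/Qadj_qskew].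
Qed.

Lemma Qadj_kirby_sign e : QK (kirby_sign r t e).
Proof.
rewrite /kirby_sign (kirby_unknot odd_r r_gt1 tau_prim t4 num_char0).
apply: QadjM; last exact/QadjV/Qadj_qskew.
apply: QadjM; last by apply: Qadj_sum => x _; exact: Qadj_chi.
apply: QadjM; last exact: Qadj_chi.
by apply/QadjN/QadjX/QadjN/(Qadj_nat _ 1).
Qed.

End KirbyRational.

(** * Nullity of the linking matrix *)

Lemma char_poly_conj (F : fieldType) n (P A : 'M[F]_n) : P \in unitmx ->
  char_poly (invmx P *m A *m P) = char_poly A.
Proof.
move=> uP; rewrite /char_poly /char_poly_mx.
have -> : 'X%:M - map_mx polyC (invmx P *m A *m P) =
   map_mx polyC (invmx P) *m ('X%:M - map_mx polyC A) *m map_mx polyC P.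
  rewrite mulmxBr mulmxBl !map_mxM; congr (_ - _).
  by rewrite mul_mx_scalar -scalemxAl -map_mxM mulVmx // map_mx1 scalemx1.
rewrite !det_mulmx mulrAC -det_mulmx -map_mxM mulVmx // map_mx1 det1 mul1r //.
Qed.

Section SymmetricNullity.
Variables (C : numClosedFieldType) (n : nat) (A : 'M[C]_n) (e : seq C).
Hypothesis symA : A^T = A.
Hypothesis realA : forall i j, A i j \is Num.real.
Hypothesis eE : char_poly A = \prod_(x <- e) ('X - x%:P).

Let P := spectralmx A.
Let d := spectral_diag A.

Let hermA : A \is hermsymmx.
Proof.
apply: realsym_hermsym; last by apply/mxOverP.
by apply/is_hermitianmxP; rewrite expr0 scale1r map_mx_id.
Qed.

Let AE : A = invmx P *m diag_mx d *m P.
Proof. exact/orthomx_spectralP/hermitian_normalmx. Qed.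

Lemma eigen_perm : perm_eq e [seq d 0 i | i <- enum 'I_n].
Proof.
apply: prod_XsubC_eq; rewrite -eE {1}AE char_poly_conj ?spectral_unit //.
rewrite char_poly_trig ?is_diag_mx_is_trig ?diag_mx_is_diag //.
rewrite big_map big_enum /=; apply: eq_bigr => i _; by rewrite !mxE eqxx mulr1n.
Qed.

Lemma size_eigen : size e = n.
Proof. by rewrite (perm_size eigen_perm) size_map size_enum_ord. Qed.

(** A real symmetric matrix is Hermitian, so its eigenvalues are real and comparable with 0 in the
    partial order of C. *)
Lemma count_eigen : (count (fun z => (0 < z)%R) e + count (fun z => (z < 0)%R) e = n - count_mem (0%R : C) e)%N.
Proof.
have real_d x : x \in e -> x \is Num.real.
  rewrite (perm_mem eigen_perm) => /mapP [i _ ->].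
  by have /mxOverP /(_ 0 i) := hermitian_spectral_diag_real hermA.
rewrite -size_eigen -[in RHS](count_predC (pred1 0)) addKn.
elim: e real_d => [|x l IH] H //=.
rewrite addnACA IH; last by move=> y yl; apply: H; rewrite inE yl orbT.
congr (_ + _)%N.
have := H x (mem_head _ _); rewrite realE.
by case: (comparable_ltgtP (_ : 0 >=< x)%R) => //; rewrite /Order.comparable -realE; exact: H (mem_head _ _).
Qed.

Let eigrow i : row i P *m A = d 0 i *: row i P.
Proof.
rewrite {1}AE !mulmxA -row_mul mulmxV ?spectral_unit // row1 -rowE.
by rewrite row_diag_mx -scalemxAl -rowE.
Qed.

Let eigrow_neq0 i : row i P != 0.
Proof.
apply/eqP => e0; have := congr1 (mulmx^~ (invmx P)) e0.
rewrite -row_mul mulmxV ?spectral_unit // mul0mx row1 => /rowP /(_ i).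
by rewrite !mxE !eqxx => /eqP; rewrite oner_eq0.
Qed.

Lemma nullity0 : (forall u : 'rV_n, u *m A = 0 -> u = 0) -> count_mem (0%R : C) e = 0%N.
Proof.
move=> inj; rewrite (seq.permP eigen_perm); apply/count_memPn/mapP => -[i _ di].
have := eigrow i; rewrite -di scale0r => /inj /eqP; by rewrite (negbTE (eigrow_neq0 i)).
Qed.

(** The rows of P are independent eigenvectors, and those for the eigenvalue 0 all lie on the line
    of v, so there is at most one. *)
Lemma nullity1 (v : 'rV_n) : v != 0 -> v *m A = 0 ->
  (forall u : 'rV_n, u *m A = 0 -> exists a, u = a *: v) -> count_mem (0%R : C) e = 1%N.
Proof.
move=> v0 vA H; rewrite (seq.permP eigen_perm) count_map.
have ker i : d 0 i = 0 -> exists2 a, a != 0 & row i P = a *: v.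
  move=> di; have [a ra] := H (row i P) (etrans (eigrow i) (etrans (congr1 ( *:%R^~ _) di) (scale0r _))).
  by exists a => //; apply: contraNneq (eigrow_neq0 i) => a0; rewrite ra a0 scale0r.
have uniq_zero i j : d 0 i = 0 -> d 0 j = 0 -> i = j.
  move=> /ker [a a0 ra] /ker [b b0 rb].
  have : b *: row i P = a *: row j P by rewrite ra rb !scalerA mulrC.
  move/(congr1 (mulmx^~ (invmx P))); rewrite -!scalemxAl -!row_mul mulmxV ?spectral_unit // !row1.
  move=> /rowP /(_ i); rewrite !mxE !eqxx /= mulr1.
  by case: eqP => // _; rewrite mulr0 => /eqP; rewrite (negbTE b0).
(* With no zero on the diagonal, v P^-1 and hence v would vanish. *)
have [i di] : exists i, d 0 i = 0.
  suff /existsP [i /eqP di] : [exists i, d 0 i == 0] by exists i.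
  apply: contraT; rewrite negb_exists => /forallP nz.
  case/eqP: v0; have : v *m invmx P *m diag_mx d = 0.
    have := congr1 (mulmx^~ (invmx P)) vA; rewrite {1}AE mul0mx !mulmxA mulmxK ?spectral_unit //.
  move=> w0; rewrite -[v](mulmxKV (spectral_unit A)) -/P.
  have -> : v *m invmx P = 0; last by rewrite mul0mx.
  apply/rowP => j; have /rowP /(_ j) := w0.
  by rewrite mul_mx_diag !mxE => /eqP; rewrite mulf_eq0 (negbTE (nz j)) orbF => /eqP.
rewrite (eq_count (a2 := pred1 i)) ?count_uniq_mem ?enum_uniq ?mem_enum // => j /=.
by apply/eqP/eqP => [dj|->//]; exact: uniq_zero.
Qed.

End SymmetricNullity.

(** * The kernel of the linking matrix of a star *)

Section StarKernel.
Variable C : numFieldType.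
Implicit Types (v : nat -> C) (ms : seq int) (E : seq (nat * nat)).

Definition adjacency E v (i : nat) : C :=
  \sum_(e <- E) ((e.1 == i)%:R * v e.2 + (e.2 == i)%:R * v e.1).

Lemma adjacency_cat E E' v i : adjacency (E ++ E') v i = adjacency E v i + adjacency E' v i.
Proof. exact: big_cat. Qed.

Lemma adjacency_cons e E v i : adjacency (e :: E) v i =
  (e.1 == i)%:R * v e.2 + (e.2 == i)%:R * v e.1 + adjacency E v i.
Proof. exact: big_cons. Qed.

Lemma adjacency_nil v i : adjacency [::] v i = 0.
Proof. exact: big_nil. Qed.

Lemma adjacency_arm0 x c ms v i : i != x -> (i < c)%N || (c + size ms <= i)%N ->
  adjacency (arm_edges x c ms) v i = 0.
Proof.
elim: ms x c => [|m ms IH] x c ix ic /=; first exact: adjacency_nil.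
rewrite adjacency_cons /= eq_sym (negbTE ix) mul0r add0r.
have -> : (c == i) = false by move: ic => /=; lia.
rewrite mul0r add0r IH //; first by move: ic => /=; lia.
by move: ic => /=; lia.
Qed.

Lemma adjacency_arms0 c arms v i : i != 0%N -> (i < c)%N || (c + size (flatten arms) <= i)%N ->
  adjacency (arms_edges c arms) v i = 0.
Proof.
move=> i0; elim: arms c => [|ms arms IH] c ic /=; first exact: adjacency_nil.
by rewrite adjacency_cat adjacency_arm0 ?IH ?addr0 //; move: ic; rewrite /= size_cat; lia.
Qed.

Fixpoint arm_vec ms : seq C :=
  if ms is _ :: ms' then - (continuant ms').1%:~R :: [seq - x | x <- arm_vec ms'] else [::].

Lemma size_arm_vec ms : size (arm_vec ms) = size ms.
Proof. by elim: ms => //= m ms IH; rewrite size_map IH. Qed.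

Lemma nth_arm_vecN ms j : nth 0 [seq - x | x <- arm_vec ms] j = - nth 0 (arm_vec ms) j.
Proof.
have [js|sj] := ltnP j (size (arm_vec ms)); first exact: nth_map.
by rewrite !nth_default ?size_map // oppr0.
Qed.

Lemma adjacency_arm_root x c ms v a : (x < c)%N -> v x = a * (continuant ms).1%:~R ->
  (forall j, (j < size ms)%N -> v (c + j)%N = a * nth 0 (arm_vec ms) j) ->
  adjacency (arm_edges x c ms) v x = - (a * (continuant ms).2%:~R).
Proof.
case: ms => [|m ms] xc vx H /=; first by rewrite adjacency_nil mulr0 oppr0.
rewrite adjacency_cons /= eqxx mul1r (gtn_eqF xc) mul0r addr0.
rewrite adjacency_arm0 ?addr0 ?(ltn_eqF xc) // ?ltnS ?(ltnW xc) //.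
have := H 0%N isT; rewrite addn0 => ->; rewrite /= mulrN.
by case: (continuant ms).
Qed.

(** The equations at the vertices of the arm leave one free parameter a, by the recursion of
    [arm_mx_kernel], now in characteristic 0. *)
Lemma arm_kernelP x c ms v : (x < c)%N ->
  (forall j, (j < size ms)%N ->
     (nth 0 ms j)%:~R * v (c + j)%N + adjacency (arm_edges x c ms) v (c + j)%N = 0) <->
  (exists a, v x = a * (continuant ms).1%:~R /\
     forall j, (j < size ms)%N -> v (c + j)%N = a * nth 0 (arm_vec ms) j).
Proof.
elim: ms x c => [|m ms IH] x c xc.
  by split=> // _; exists (v x); split=> //=; rewrite mulr1.
set E := arm_edges c c.+1 ms.
have adj0 : adjacency (arm_edges x c (m :: ms)) v c = v x + adjacency E v c.
  by rewrite /= adjacency_cons /= eqxx mul1r (ltn_eqF xc) mul0r add0r.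
have adjS j : adjacency (arm_edges x c (m :: ms)) v (c + j.+1)%N = adjacency E v (c.+1 + j)%N.
  rewrite /= adjacency_cons /= addnS -addSn.
  have -> : (x == (c.+1 + j)%N) = false by lia.
  have -> : (c == (c.+1 + j)%N) = false by lia.
  by rewrite !mul0r !add0r.
have [IH1 IH2] := IH c c.+1 (ltnSn c).
have Pc : ((continuant (m :: ms)).1%:~R : C) =
    m%:~R * (continuant ms).1%:~R - (continuant ms).2%:~R.
  by rewrite /=; case: (continuant ms) => P Q /=; rewrite rmorphB rmorphM.
split=> [H|[a [vx H]]].
  have [j js|a [vc Ha]] := IH1; first by have := H j.+1 js; rewrite adjS addnS -addSn.
  exists (- a); split.
    have := H 0%N isT; rewrite addn0 adj0 (adjacency_arm_root (ltnSn c) vc Ha) vc Pc /= => e.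
    apply/eqP; rewrite -subr_eq0; apply/eqP; rewrite -e; ring.
  case=> [|j] js; first by rewrite addn0 vc /= mulrNN.
  by rewrite addnS -addSn Ha // /= nth_arm_vecN mulrNN.
have vc : v c = - a * (continuant ms).1%:~R.
  by have := H 0%N isT; rewrite addn0 /= mulrN mulNr.
have Ha j : (j < size ms)%N -> v (c.+1 + j)%N = - a * nth 0 (arm_vec ms) j.
  by move=> js; have := H j.+1 js; rewrite addnS -addSn /= nth_arm_vecN mulrN mulNr.
case=> [|j] js.
  rewrite addn0 adj0 (adjacency_arm_root (ltnSn c) vc Ha) vc vx Pc /=; ring.
rewrite adjS addnS -addSn; apply: IH2 => //; by exists (- a).
Qed.


(** Normalized so that the central entry is 1: the parameter of each arm is the inverse of its
    numerator. *)
Definition star_vec (arms : seq (seq int)) : seq C :=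
  flatten [seq [seq x / (continuant ms).1%:~R | x <- arm_vec ms] | ms <- arms].

Lemma arms_kernelP c (arms : seq (seq int)) v : (0 < c)%N ->
  (forall ms, ms \in arms -> (continuant ms).1 != 0) ->
  (forall j, (j < size (flatten arms))%N ->
     (nth 0 (flatten arms) j)%:~R * v (c + j)%N + adjacency (arms_edges c arms) v (c + j)%N = 0) <->
  (forall j, (j < size (flatten arms))%N -> v (c + j)%N = v 0%N * nth 0 (star_vec arms) j).
Proof.
elim: arms c => [|ms arms IH] c c0 nz; first by [].
have nz' : forall ms, ms \in arms -> (continuant ms).1 != 0.
  by move=> ms' h; apply: nz; rewrite inE h orbT.
have Pn : ((continuant ms).1%:~R : C) != 0 by rewrite intr_eq0 nz ?mem_head.
have [I1 I2] := IH (c + size ms)%N (leq_trans c0 (leq_addr _ _)) nz'.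
have [A1 A2] := @arm_kernelP 0 c ms v c0.
have adjl j : (j < size ms)%N -> adjacency (arms_edges c (ms :: arms)) v (c + j)%N =
    adjacency (arm_edges 0 c ms) v (c + j)%N.
  by move=> js; rewrite /= adjacency_cat (@adjacency_arms0 (c + size ms)) ?addr0 //; lia.
have adjr j : adjacency (arms_edges c (ms :: arms)) v (c + size ms + j)%N =
    adjacency (arms_edges (c + size ms) arms) v (c + size ms + j)%N.
  by rewrite /= adjacency_cat adjacency_arm0 ?add0r //; lia.
have vecl j : (j < size ms)%N ->
    nth 0 (star_vec (ms :: arms)) j = nth 0 (arm_vec ms) j / (continuant ms).1%:~R.
  by move=> js; rewrite /star_vec /= nth_cat size_map size_arm_vec js (nth_map 0) ?size_arm_vec.
have vecr j : nth 0 (star_vec (ms :: arms)) (size ms + j) = nth 0 (star_vec arms) j.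
  by rewrite /star_vec /= nth_cat size_map size_arm_vec ltnNge leq_addr addKn.
have frl j : (j < size ms)%N -> nth 0 (flatten (ms :: arms)) j = nth 0 ms j.
  by move=> js; rewrite /= nth_cat js.
have frr j : nth 0 (flatten (ms :: arms)) (size ms + j) = nth 0 (flatten arms) j.
  by rewrite /= nth_cat ltnNge leq_addr addKn.
have szE : size (flatten (ms :: arms)) = (size ms + size (flatten arms))%N by rewrite /= size_cat.
split=> H j; rewrite szE => js.
  have [jm|mj] := ltnP j (size ms).
    have [i im|a [va Ha]] := A1.
      by have := H i; rewrite szE adjl // frl // => -> //; lia.
    by rewrite Ha // vecl // va; field.
  have -> : j = (size ms + (j - size ms))%N by lia.
  rewrite addnA vecr; apply: I1; last by lia.
  by move=> i ia; have := H (size ms + i)%N; rewrite szE addnA adjr frr => -> //; lia.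
have [jm|mj] := ltnP j (size ms).
  rewrite adjl // frl //; apply: A2 => //; exists (v 0%N / (continuant ms).1%:~R).
  split; first by field.
  by move=> i im; have := H i; rewrite szE vecl // => ->; [ring | lia].
have -> : j = (size ms + (j - size ms))%N by lia.
rewrite addnA adjr frr; apply: I2; last by lia.
by move=> i ia; have := H (size ms + i)%N; rewrite szE addnA vecr => -> //; lia.
Qed.

(** An arm of parameter a = v0 / P, with continuant (P, Q), starts with the entry -a Q, that is -v0
    Q / P. *)
Lemma adjacency_arms_root c (arms : seq (seq int)) v : (0 < c)%N ->
  (forall ms, ms \in arms -> (continuant ms).1 != 0) ->
  (forall j, (j < size (flatten arms))%N -> v (c + j)%N = v 0%N * nth 0 (star_vec arms) j) ->
  adjacency (arms_edges c arms) v 0 =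
  - (v 0%N * \sum_(ms <- arms) (continuant ms).2%:~R / (continuant ms).1%:~R).
Proof.
elim: arms c => [|ms arms IH] c c0 nz H /=.
  by rewrite adjacency_nil big_nil mulr0 oppr0.
have nz' : forall ms, ms \in arms -> (continuant ms).1 != 0.
  by move=> ms' h; apply: nz; rewrite inE h orbT.
have Pn : ((continuant ms).1%:~R : C) != 0 by rewrite intr_eq0 nz ?mem_head.
have szE : size (flatten (ms :: arms)) = (size ms + size (flatten arms))%N by rewrite /= size_cat.
rewrite adjacency_cat big_cons (@adjacency_arm_root 0 c ms v (v 0%N / (continuant ms).1%:~R)) //.
- rewrite IH // ?addn_gt0 ?c0 //; first by ring.
  move=> i ia; have := H (size ms + i)%N; rewrite szE addnA => ->; last by lia.
  by rewrite /star_vec /= nth_cat size_map size_arm_vec ltnNge leq_addr addKn.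
- by field.
move=> i im; rewrite H ?szE; last by lia.
by rewrite /star_vec /= nth_cat size_map size_arm_vec im (nth_map 0) ?size_arm_vec //; ring.
Qed.

End StarKernel.

Lemma arm_edges_bound x c ms e : (x < c)%N -> e \in arm_edges x c ms -> (e.2 < c + size ms)%N.
Proof.
elim: ms x c => [|m ms IH] x c //= xc; rewrite inE => /orP[/eqP->|/IH] /=; first lia.
by move=> /(_ (ltnSn c)); lia.
Qed.

Lemma arms_edges_bound c arms e : (0 < c)%N -> e \in arms_edges c arms ->
  (e.2 < c + size (flatten arms))%N.
Proof.
elim: arms c => [|ms arms IH] c //= c0; rewrite mem_cat size_cat => /orP[/arm_edges_bound|/IH].
  by move=> /(_ c0) h; rewrite addnA ltn_addr.
by rewrite addn_gt0 c0 addnA; apply.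
Qed.

Section StarNullity.
Variables (C : numClosedFieldType) (arms : seq (seq int)).
Hypothesis num_neq0 : forall ms, ms \in arms -> (continuant ms).1 != 0.
Let L := star_link arms.
Let N := ncomp L.
Let A : 'M[C]_N := map_mx intr (linking_matrix L).
Let fr := framings L.
Let E := arms_edges 1 arms.

Lemma linking_mx_sym : A^T = A.
Proof.
apply/matrixP => i j; rewrite !mxE eq_sym; case: eqP => [->//|_].
by rewrite !star_linking_number; congr _%:~R; apply: eq_bigl => e; rewrite orbC.
Qed.

Lemma linking_mx_real i j : A i j \is Num.real.
Proof. by rewrite !mxE realz. Qed.

Definition entry (u : 'rV[C]_N) (k : nat) : C := if insub k is Some i then u 0 i else 0.

Lemma entryE u (i : 'I_N) : entry u i = u 0 i.
Proof. by rewrite /entry valK. Qed.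

Lemma linking_mxE u (i : 'I_N) :
  (u *m A) 0 i = (nth 0 fr i)%:~R * entry u i + adjacency E (entry u) i.
Proof.
rewrite mxE (bigD1 i) //= !mxE eqxx entryE mulrC; congr (_ + _).
under eq_bigr => j ji do rewrite !mxE (negbTE ji) star_linking_number rmorph_sum /= mulr_sumr big_mkcond /=.
rewrite exchange_big /= /adjacency big_seq [RHS]big_seq; apply: eq_bigr => -[a b] ab.
have ltab : (a < b)%N by exact: (arms_edges_lt _ ab).
have bN : (b < N)%N by have := arms_edges_bound (ltn0Sn 0) ab.
have aN : (a < N)%N by exact: ltn_trans bN.
(* As a < b, the vertex i is at most one of the ends of the edge. *)
have [bi|/negbTE bi] := eqVneq b (val i).
  have ai : (a == val i) = false by rewrite -bi ltn_eqF.
  rewrite ai mul0r add0r mul1r (bigD1 (Ordinal aN)) /=; last by rewrite -val_eqE /= ai.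
  rewrite big1 => [|j /andP[_ /negbTE ja]].
    by rewrite !xpair_eqE eqxx bi eqxx /= mulr1 addr0 -(entryE u (Ordinal aN)).
  by rewrite !xpair_eqE ai orbF eq_sym (_ : (val j == a) = false) //= -ja -val_eqE.
rewrite mul0r addr0; have [ai|/negbTE ai] := eqVneq a (val i).
  rewrite mul1r (bigD1 (Ordinal bN)) /=; last by rewrite -val_eqE /= bi.
  rewrite big1 => [|j /andP[_ /negbTE ja]].
    by rewrite !xpair_eqE eqxx ai eqxx /= orbT mulr1 addr0 -(entryE u (Ordinal bN)).
  by rewrite !xpair_eqE bi andbF /= [b == _]eq_sym (_ : (val j == b) = false) ?andbF // -ja -val_eqE.
by rewrite mul0r big1 // => j _; rewrite !xpair_eqE bi ai andbF.
Qed.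

Let D : C := \sum_(ms <- arms) (continuant ms).2%:~R / (continuant ms).1%:~R.

(** The arms determine u from its central entry; the equation of the centre, of framing 0, is the
    remaining condition. *)
Lemma star_kernelP u : u *m A = 0 <->
  (forall j, (j < size (flatten arms))%N ->
     entry u (1 + j)%N = entry u 0%N * nth 0 (star_vec C arms) j) /\ entry u 0%N * D = 0.
Proof.
have [K1 K2] := @arms_kernelP C 1 arms (entry u) isT num_neq0.
split=> [uA|[H uD]].
  have eqs i : (i < N)%N -> (nth 0 fr i)%:~R * entry u i + adjacency E (entry u) i = 0.
    by move=> iN; rewrite -(linking_mxE u (Ordinal iN)) uA mxE.
  have H : forall j, (j < size (flatten arms))%N ->
     entry u (1 + j)%N = entry u 0%N * nth 0 (star_vec C arms) j.
    by apply: K1 => j js; have := eqs j.+1; apply.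
  split=> //; have := eqs 0%N isT; rewrite /= mul0r add0r.
  by rewrite (adjacency_arms_root _ num_neq0 H) // => /eqP; rewrite oppr_eq0 => /eqP.
apply/rowP => i; rewrite linking_mxE [RHS]mxE; case: i => -[|i] iN /=.
  by rewrite mul0r add0r (adjacency_arms_root _ num_neq0 H) // uD oppr0.
exact: K2.
Qed.

Lemma star_nullity e : char_poly A = \prod_(x <- e) ('X - x%:P) ->
  (count (fun z => (0 < z)%R) e + count (fun z => (z < 0)%R) e = N - (D == 0%R))%N.
Proof.
move=> eE; rewrite (count_eigen linking_mx_sym linking_mx_real eE); congr (_ - _)%N.
have entry_eq u u' : (forall i, (i < N)%N -> entry u i = entry u' i) -> u = u'.
  by move=> H; apply/rowP => i; rewrite -!entryE H.
have [D0|D0] := eqVneq D 0; last first.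
  apply: (nullity0 linking_mx_sym linking_mx_real eE) => u /star_kernelP [H /eqP].
  rewrite mulf_eq0 (negbTE D0) orbF => /eqP u0.
  apply: entry_eq => -[|i] iN; have e0 k (kN : (k < N)%N) : entry 0 k = 0.
  - by rewrite -[k]/(val (Ordinal kN)) entryE mxE.
  - by rewrite u0 e0.
  - by rewrite -[k]/(val (Ordinal kN)) entryE mxE.
  - by rewrite H // u0 mul0r e0.
pose z : 'rV[C]_N := \row_i nth 0 (1 :: star_vec C arms) i.
have zE k : (k < N)%N -> entry z k = nth 0 (1 :: star_vec C arms) k.
  by move=> kN; rewrite -[k]/(val (Ordinal kN)) entryE mxE.
apply: (nullity1 linking_mx_sym linking_mx_real eE (v := z)).
- apply/eqP => z0; have := zE 0%N isT; rewrite z0 -[0%N]/(val (@Ordinal N 0 isT)) entryE mxE.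
  by move/eqP; rewrite eq_sym oner_eq0.
- apply/star_kernelP; split; last by rewrite D0 mulr0.
  by move=> j js; rewrite !zE //= mul1r.
move=> u /star_kernelP [H _]; exists (entry u 0%N); apply: entry_eq => k kN.
have -> : entry (entry u 0%N *: z) k = entry u 0%N * nth 0 (1 :: star_vec C arms) k.
  by rewrite -zE // -[k]/(val (Ordinal kN)) !entryE mxE.
by case: k kN => [|k] kN /=; [rewrite mulr1 | rewrite H].
Qed.

End StarNullity.

Lemma star_b_pos_neg (R : realType) arms :
  (forall ms, ms \in arms -> (continuant ms).1 != 0) ->
  (b_pos R (star_link arms) + b_neg R (star_link arms) = ncomp (star_link arms) -
    (\sum_(ms <- arms) (continuant ms).2%:~R / (continuant ms).1%:~R == 0 :> R[i])%R)%N.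
Proof.
move=> nz; apply: star_nullity => //; rewrite /eigenvalues.
case: closed_field_poly_normal => e /=.
by rewrite (monicP (char_poly_monic _)) scale1r.
Qed.

(** * Conclusion *)

Section RootsOfUnity.
Variable R : realType.
Implicit Types x y : R.

Lemma expiD x y : expi (x + y) = expi x * expi y.
Proof. by rewrite /expi cosD sinD; apply/eqP; rewrite eq_complex /= eqxx /= addrC. Qed.

Lemma expi0 : expi 0 = 1 :> R[i].
Proof. by rewrite /expi cos0 sin0. Qed.

Lemma expiX x n : expi x ^+ n = expi (n%:R * x).
Proof.
elim: n => [|n IH]; first by rewrite mul0r expi0.
by rewrite exprS IH -expiD -natr1 mulrDl mul1r addrC.
Qed.

Lemma cos_eq1 x : 0 < x < 2 * pi -> cos x != 1.
Proof.
move=> /andP[x0 x2].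
have H y : 0 < y <= pi -> cos y != 1.
  move=> /andP[y0 ypi]; apply/eqP => c1.
  suff y_eq0 : y = 0 by rewrite y_eq0 ltxx in y0.
  apply: cos_inj; rewrite ?in_itv /= ?cos0 //; first by rewrite (ltW y0).
  by rewrite lexx pi_ge0.
have [xpi|xpi] := leP x pi; first by apply: H; rewrite x0.
have -> : cos x = cos (2 * pi - x).
  by rewrite cosB (_ : 2 * pi = pi *+ 2) ?cos2pi ?sin2pi ?mul1r ?mul0r ?addr0 // mulr_natl.
by apply: H; apply/andP; split; lra.
Qed.

Lemma expi_prim r : (0 < r)%N -> r.-primitive_root (expi (2 * pi / r%:R) : R[i]).
Proof.
move=> r0; have rn0 : (r%:R : R) != 0 by rewrite pnatr_eq0 -lt0n.
have rp : 0 < (r%:R : R) by rewrite ltr0n.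
apply/andP; split=> //; apply/forallP => i; apply/eqP.
rewrite unity_rootE expiX.
have [->|ir] := eqVneq i.+1 r.
  by rewrite (mulrC r%:R) divfK // /expi (_ : 2 * pi = pi *+ 2) ?cos2pi ?sin2pi ?eqxx // mulr_natl.
apply/negP => /eqP /(congr1 (@complex.Re R)) /= /eqP; apply/negP; apply: cos_eq1.
have i1 : (i.+1 < r)%N by rewrite ltn_neqAle ir /= ltn_ord.
have : (i.+1%:R : R) < r%:R by rewrite ltr_nat.
have : 0 < (i.+1%:R : R) by rewrite ltr0n.
have := pi_gt0 R.
move: (i.+1%:R : R) => a p0 a0 ar; apply/andP; split.
  by rewrite !mulr_gt0 ?invr_gt0.
by rewrite mulrCA gtr_pMr ?ltr_pdivrMr ?mul1r // mulr_gt0.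
Qed.

Variable r : nat.
Hypothesis odd_r : odd r.
Hypothesis r_gt1 : (1 < r)%N.
Let zeta : R[i] := expi (2 * pi / r%:R).
Let t := root_t R r.

Lemma root_t4 : t ^+ 4 = zeta.
Proof.
rewrite /t /root_t /zeta expiX natrM; congr expi.
have rn0 : (r%:R : R) != 0 by rewrite pnatr_eq0 -lt0n ltnW.
by field.
Qed.

(** h = (r + 1) / 2 inverts 2 mod r, so zeta^(h^2) is a fourth root of zeta among its own powers:
    (2h)^2 = r (r + 2) + 1. *)
Lemma quarter_root : exists tau, [/\ r.-primitive_root tau, t ^+ 4 = tau ^+ 4 & in_Q_adjoin zeta tau].
Proof.
have zp : r.-primitive_root zeta by apply: expi_prim; exact: ltnW.
pose h := (r.+1./2)%N.
have hE : (h * 2 = r.+1)%N by rewrite /h muln2; have := odd_double_half r.+1; rewrite /= odd_r.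
exists (zeta ^+ (h * h)); split.
- rewrite (prim_root_exp_coprime _ zp) coprimeMl andbb.
  have : coprime (h * 2) r by rewrite hE coprimeSn.
  by rewrite coprimeMl => /andP[].
- rewrite root_t4 -exprM (_ : (h * h * 4 = r * r.+2 + 1)%N) ?exprD ?exprM ?(prim_expr_order zp) ?expr1n ?mul1r ?expr1 //.
  by rewrite (_ : h * h * 4 = (h * 2) * (h * 2))%N ?hE; lia.
- by exists 'X^(h * h); rewrite map_polyXn hornerXn.
Qed.

Lemma root_t_neq0 : t != 0.
Proof.
apply/eqP => t0; have := root_t4; rewrite t0 expr0n => /esym z0.
have zp : r.-primitive_root zeta by apply: expi_prim; exact: ltnW.
have := prim_expr_order zp; rewrite z0 expr0n gtn_eqF ?(ltnW r_gt1) // => /eqP.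
by rewrite eq_sym oner_eq0.
Qed.

Lemma root_t_sub i : (0 < i < r)%N -> (t ^+ 2) ^+ i - (t ^+ 2) ^- i != 0.
Proof.
move=> /andP[i0 ir]; have t0 := root_t_neq0.
have zp : r.-primitive_root zeta by apply: expi_prim; exact: ltnW.
rewrite subr_eq0; apply/eqP => e.
have : zeta ^+ i = 1.
  rewrite -root_t4 (_ : 4 = 2 * 2)%N // exprM -exprM mulnC exprM expr2 {1}e mulVf //.
  by rewrite !expf_neq0.
move/eqP; rewrite -(prim_order_dvd zp) => /dvdn_leq; rewrite i0 => /(_ isT); lia.
Qed.

Lemma root_t_sub1 : t ^+ 2 - (t ^+ 2)^-1 != 0.
Proof. by have := @root_t_sub 1; rewrite expr1; apply; rewrite /= r_gt1. Qed.

Lemma root_t_qint i : (0 < i < r)%N -> qint (t ^+ 2) i != 0.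
Proof. by move=> ir; rewrite /qint mulf_neq0 ?invr_eq0 ?root_t_sub1 ?root_t_sub. Qed.

End RootsOfUnity.

Lemma continuant_coprime ms : coprimez (continuant ms).1 (continuant ms).2.
Proof.
elim: ms => [|m ms] //=; case: (continuant ms) => a b /= ab.
by rewrite coprimez_sym /coprimez gcdzMDl gcdzN.
Qed.

Lemma cont_fracE ms : cont_frac ms =
  if (continuant ms).2 == 0 then None
  else Some ((continuant ms).1%:~R / (continuant ms).2%:~R).
Proof.
elim: ms => [|m ms IH] //=; rewrite /cont_frac /= -/(cont_frac ms) IH.
have := continuant_coprime ms; case: (continuant ms) => a b /= ab.
have [b0|b0] := eqVneq b 0.
  rewrite /= b0 subr0.
  have a0 : a != 0 by apply: contraTneq ab => ->; rewrite b0.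
  by rewrite (negbTE a0) rmorphM /= mulfK // intr_eq0.
rewrite /= mulf_eq0 invr_eq0 !intr_eq0 (negbTE b0) orbF; case: ifP => // /negbT a0.
by rewrite invf_div rmorphB rmorphM /=; congr Some; field; rewrite intr_eq0.
Qed.

(** Equality of the fractions and coprimality of the continuant pair force its numerator to divide
    p. *)
Lemma continuant_presents ms (p q : int) : p != 0 -> q != 0 -> coprimez p q ->
  cont_frac ms = Some (p%:~R / q%:~R) ->
  [/\ (continuant ms).1 != 0,
      (continuant ms).2%:~R / (continuant ms).1%:~R = q%:~R / p%:~R :> rat &
      forall r, coprimez r p -> coprimez r (continuant ms).1].
Proof.
move=> p0 q0 pq; rewrite cont_fracE.
have := continuant_coprime ms; case: (continuant ms) => a b /= ab.
case: eqVneq => // b0 [e].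
have a0 : a != 0.
  apply: contraTneq p0 => a0; move: e; rewrite a0 mul0r => /esym/eqP.
  by rewrite mulf_eq0 invr_eq0 !intr_eq0 (negbTE q0) orbF => /eqP ->.
split=> //; first by apply: invr_inj; rewrite !invf_div.
move=> r rp; have : (a %| p)%Z.
  rewrite -(@Gauss_dvdzl _ _ b) //; apply/dvdzP; exists q.
  have : (p * b)%:~R = (q * a)%:~R :> rat.
    have bn : (b%:~R : rat) != 0 by rewrite intr_eq0.
    have qn : (q%:~R : rat) != 0 by rewrite intr_eq0.
    rewrite !rmorphM /=; move/eqP: e; rewrite eqr_div // => /eqP; rewrite mulrC => ->.
    by rewrite mulrC.
  by move/eqP; rewrite eqr_int => /eqP.
by move=> adp; move: rp; rewrite !coprimezE; apply: coprime_dvdr.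
Qed.

Section Unknot.
Variables (R : realType) (r : nat).
Hypothesis odd_r : odd r.
Hypothesis r_gt1 : (1 < r)%N.
Let t := root_t R r.

Lemma kirby_sum_star arms : kirby_sum R r (star_link arms) = kirby_arms r t arms.
Proof.
apply: star_sum.
- exact: root_t_neq0.
- exact: root_t_qint.
- exact: root_t_sub1.
Qed.

Lemma kirby_sum_unknot (e : bool) :
  kirby_sum R r (unknot ((-1) ^+ e)) = kirby_sign r t e.
Proof.
pose G (w : seq nat) := qint (t ^+ 2) (nth 0%N w 0) *
  (t ^ ((-1) ^+ e * ((nth 0%N w 0)%:Z ^+ 2 - 1)) * qint (t ^+ 2) (nth 0%N w 0)).
rewrite /kirby_sum; transitivity (odd_sum r 1 G); last first.
  by rewrite /= /kirby_sign; apply: eq_bigr => k _; rewrite /G /= expr2; ring.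
rewrite -odd_sumE; apply: eq_bigr => k ok.
rewrite big_ord1 /G /colored_jones big_ord1 /= /self_writhe /= big_nil subr0.
have -> : nth 0%N [seq val c | c <- k] 0 = tnth k ord0.
  by rewrite (nth_map (tnth k ord0)) ?size_tuple //; congr val; exact/esym/tnth_nth.
congr (_ * (_ * _)); under eq_bigr do rewrite eqxx !mulr1.
by apply: sum_weight; [exact: root_t_neq0 | exact: root_t_sub1].
Qed.

End Unknot.

Lemma unit_Zp_int r (a : int) : (1 < r)%N -> coprimez r%:Z a ->
  (a%:~R : 'Z_r) \is a GRing.unit.
Proof.
move=> r_gt1 /coprimez_ex [u [v uv]].
have va : v%:~R * a%:~R = 1 :> 'Z_r.
  have := congr1 (fun z : int => z%:~R : 'Z_r) uv.
  by rewrite rmorphD !rmorphM /= -pmulrn pchar_Zp // mulr0 add0r.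
by apply/unitrP; exists v%:~R; rewrite [a%:~R * _]mulrC.
Qed.

(** The invariant without its trigonometric factor; the arms are sorted by coprimality of their
    numerators with r. *)
Lemma star_tau' (R : realType) (r : nat) arms : odd r -> (1 < r)%N ->
  (count (fun ms => ~~ coprimez r%:Z (continuant ms).1) arms <= 2)%N ->
  (forall ms, ms \in arms -> (continuant ms).1 != 0) ->
  let z := kirby_sum R r (star_link arms) /
    (gauss_pos R r ^+ b_pos R (star_link arms) * gauss_neg R r ^+ b_neg R (star_link arms)) in
  algebraic_integer z /\ in_Q_adjoin (expi (2 * pi / r%:R) : R[i]) z.
Proof.
move=> odd_r r_gt1 bad nz z.
have [tau [tp t4 tauQ]] := quarter_root R odd_r r_gt1.
set zeta : R[i] := expi (2 * pi / r%:R) in tauQ *.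
have zr : zeta ^+ r = 1 by apply: prim_expr_order; apply: expi_prim; exact: ltnW.
have c0 : forall n, (n.+1%:R : R[i]) != 0 by move=> n; rewrite pnatr_eq0.
have Gp : gauss_pos R r = kirby_sign r (root_t R r) false := kirby_sum_unknot R odd_r r_gt1 false.
have Gn : gauss_neg R r = kirby_sign r (root_t R r) true := kirby_sum_unknot R odd_r r_gt1 true.
rewrite /z Gp Gn kirby_sum_star //; split; last first.
  apply: QadjM; first exact: (Qadj_kirby_arms odd_r r_gt1 tp t4 tauQ zr).
  apply: (QadjV r_gt1 zr); apply: QadjM; apply: QadjX;
    exact: (Qadj_kirby_sign odd_r r_gt1 tp t4 tauQ zr).
apply: (aint_star odd_r r_gt1 tp t4 c0
  (bad := [seq ms <- arms | ~~ coprimez r%:Z (continuant ms).1])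
  (good := [seq ms <- arms | coprimez r%:Z (continuant ms).1]) (N := ncomp (star_link arms))) => //.
- by rewrite perm_sym perm_catC perm_filterC.
- by rewrite size_filter.
- by move=> ms; rewrite mem_filter => /andP[/(unit_Zp_int r_gt1)].
rewrite star_b_pos_neg //; case: (_ == _); last by left; rewrite subn0.
by right; rewrite subn1.
Qed.

Theorem theorem2 (R : realType) (r : nat) (n : nat) (p q : 'I_n -> int)
  (L : framed_link) :
  odd r -> (3 <= r)%N ->
  (forall k, p k != 0 /\ q k != 0 /\ coprimez (p k) (q k)) ->
  (n - 2 <= #|[set k : 'I_n | coprimez r%:Z (p k)]|)%N ->
  presents_seifert p q L ->
  let P : int := \prod_k p k in
  let H : rat := P%:~R * \sum_k (q k)%:~R / (p k)%:~R in
  let x : R[i] :=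
    tau' R r L *
      ((Num.sqrt (1 / r%:R) * sin (pi / r%:R))%:C) ^ (sgz `|H| - 1) in
  algebraic_integer x /\ in_Q_adjoin (expi (2 * pi / r%:R) : R[i]) x.
Proof.
move=> odd_r r3 pq good_card [arms [armsE ->]] P H x.
have r_gt1 : (1 < r)%N by exact: ltnW.
set plumbing := [seq arms k | k <- enum 'I_n] in x *.
have aP k : [/\ (continuant (arms k)).1 != 0,
      (continuant (arms k)).2%:~R / (continuant (arms k)).1%:~R = (q k)%:~R / (p k)%:~R :> rat &
      forall r, coprimez r (p k) -> coprimez r (continuant (arms k)).1].
  by have [p0 [q0 cpq]] := pq k; exact: continuant_presents (armsE k).
have nz ms : ms \in plumbing -> (continuant ms).1 != 0.
  by case/mapP => k _ ->; have [] := aP k.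
have bad : (count (fun ms => ~~ coprimez r%:Z (continuant ms).1) plumbing <= 2)%N.
  rewrite count_map; apply: leq_trans (_ : #|~: [set k : 'I_n | coprimez r%:Z (p k)]| <= 2)%N.
    rewrite -size_filter cardE; apply: uniq_leq_size; first by rewrite filter_uniq ?enum_uniq.
    move=> k; rewrite mem_filter mem_enum => /andP[h _].
    rewrite mem_enum !inE; apply: contra h; have [_ _] := aP k; apply.
  by have := cardsC [set k : 'I_n | coprimez r%:Z (p k)]; rewrite card_ord; lia.
have [zA zQ] := star_tau' R odd_r r_gt1 bad nz.
move: zA zQ; set z := _ / _ => zA zQ.
have DH : (\sum_(ms <- plumbing) (continuant ms).2%:~R / (continuant ms).1%:~R == 0 :> R[i]) = (H == 0).
  rewrite big_map big_enum /= /H mulf_eq0 intr_eq0.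
  have -> : (P == 0) = false.
    by apply/negbTE/prodf_neq0 => k _; have [] := pq k.
  rewrite -(fmorph_eq0 (@ratr R[i])) rmorph_sum; congr (_ == _); apply: eq_bigr => k _.
  by have [_ <- _] := aP k; rewrite [RHS]fmorph_div !rmorph_int.
(* The first Betti number is 1 or 0 according to whether H vanishes. *)
have nu : (ncomp (star_link plumbing) - b_pos R (star_link plumbing) - b_neg R (star_link plumbing) = (H == 0%R))%N.
  rewrite -subnDA star_b_pos_neg // DH subKn //; by case: (H == 0).
have rp : 0 < (r%:R : R) by rewrite ltr0n ltnW.
have s0 : Num.sqrt (1 / r%:R) * sin (pi / r%:R) != 0 :> R.
  rewrite gt_eqF // mulr_gt0 ?sqrtr_gt0 ?divr_gt0 // sin_gt0_pi //.
  by rewrite divr_gt0 ?pi_gt0 //= ltr_pdivrMr // ltr_pMr ?pi_gt0 // ltr1n.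
have s2 : Num.sqrt (4 / r%:R) * sin (pi / r%:R) = 2 * (Num.sqrt (1 / r%:R) * sin (pi / r%:R)) :> R.
  rewrite mulrA; congr (_ * _).
  have -> : 4 / r%:R = 2 ^+ 2 * (1 / r%:R) :> R by field; rewrite gt_eqF.
  by rewrite sqrtrM ?sqr_ge0 // sqrtr_sqr ger0_norm.
(* For H = 0 the two trigonometric factors cancel up to sqrt(4/r) / sqrt(1/r) = 2; otherwise both
   exponents are 0. *)
have -> : x = (2 ^+ (H == 0)) * z.
  rewrite /x /tau' nu s2; move: (Num.sqrt _ * _) s0 => c c0.
  have cC : (c%:C)%C != 0 :> R[i] by rewrite eq_complex /= eqxx andbT.
  rewrite -mulrA -/z; have [->|H0] := eqVneq H 0.
    rewrite normr0 sgz0 /= expr1 exprN1 rmorphM rmorph_nat.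
    by field.
  by rewrite gtr0_sgz ?normr_gt0 // subrr expr0z mulr1 /= expr0.
split; first by apply: aintM => //; apply: aintX; exact: aint_nat.
by apply: QadjM => //; apply: QadjX; exact: Qadj_nat.
Qed.
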